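(* Let $T>0$, $\nu>0$, and let $(\mathcal{F}'_t)_{t\in[0,T]}$ be a filtration. Let $\eta:[0,T]\times\mathbb{R}^n\times\Omega\to\mathbb{R}^n$, $F:[0,T]\times\mathbb{R}^n\times\mathbb{R}^n\times\Omega\to\mathbb{R}^n$ and $h:\mathbb{R}^n\times\Omega\to\mathbb{R}^n$ be random functions such that for each fixed $(x,y)\in\mathbb{R}^{2n}$ the processes $\eta(t,x)$ and $F(t,x,y)$ are $\mathcal{F}'_t$-adapted, $h(x)$ is $\mathcal{F}'_0$-measurable, and for almost every $\omega$, $\eta\in{\rm C}^{0,2}_b([0,T]\times\mathbb{R}^n)$, $F\in{\rm C}^{0,2}_b([0,T]\times\mathbb{R}^{2n})$, $h\in{\rm C}^2_b(\mathbb{R}^n)$, with norms bounded by deterministic constants. Let $K$ and $C$ be the constants defined in the context. Then there exists a constant $\gamma_{K,C}>0$, depending only on $K$ and $C$, such that on $[T-\gamma_{K,C},T]$ there exists an $\mathcal{F}'_{T-t}$-adapted solution $\bar y(t,x)$, of class ${\rm C}^{1,2}_b$, of the backward equation \[ \bar y(t,x)=h(x)+\int_t^T\big[\nu\Delta\bar y(s,x)-(\bar\eta(s,x)+\bar y(s,x),\nabla)\bar y(s,x)+\bar F(s,x,\bar y(s,x))\big]\,ds, \] where $\bar\eta(t,x)=\eta(T-t,x)$ and $\bar F(t,x,y)=F(T-t,x,y)$.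
   Context: ${\rm C}^{0,l}_b$ denotes functions bounded and continuous in all variables together with their spatial derivatives (in $x$, resp. $(x,y)$) up to order $l$; ${\rm C}^{1,2}_b$ denotes bounded functions with bounded continuous $\partial_t$ and spatial derivatives up to order 2. $(u,\nabla)v=\sum_j u_j\partial_{x_j}v$. Let $\Omega_0$ be a full-measure set on which the regularity and deterministic bounds hold. The constants are $K=\sup_{\Omega_0\times\mathbb{R}^n}|\nabla h|+\sup_{\Omega_0\times[0,T]\times\mathbb{R}^n}|\partial_x\eta|+\sup_{\Omega_0\times[0,T]\times\mathbb{R}^{2n}}(|\partial_xF|+|\partial_yF|)$ and $C=\sup_{\Omega_0\times\mathbb{R}^n}|\nabla^2h|+\sup_{\Omega_0\times[0,T]\times\mathbb{R}^n}|\partial^2_{xx}\eta|+\sup_{\Omega_0\times[0,T]\times\mathbb{R}^{2n}}(|\partial^2_{xx}F|+|\partial^2_{yy}F|+|\partial^2_{xy}F|)$. *)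

(* Defs.v *)
From HB Require Import structures.
From mathcomp Require Import all_boot all_order all_algebra.
From mathcomp Require Import all_classical all_reals all_analysis.
Import numFieldNormedType.Exports.
Set Implicit Arguments. Unset Strict Implicit. Unset Printing Implicit Defensive.
Import Order.TTheory GRing.Theory Num.Theory.
Local Open Scope classical_set_scope.
Local Open Scope ring_scope.

Definition ebase (R : realType) (n : nat) (j : 'I_n) : 'rV[R]_n := delta_mx 0 j.

Definition ebase2 (R : realType) (n : nat) (k : 'I_(n + n)%N) : 'rV[R]_n * 'rV[R]_n :=
  match fintype.split k with
  | inl i => (ebase R i, 0)
  | inr j => (0, ebase R j)
  end.

Section Regularity.
Variables (R : realType) (V W : normedModType R) (m : nat) (e : 'I_m -> V).

Definition pd1 (f : V -> W) (i : 'I_m) (z : V) : W := derive f z (e i).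
Definition pd2 (f : V -> W) (i j : 'I_m) (z : V) : W :=
  derive (fun w => derive f w (e j)) z (e i).

Definition jcont (D : set R) (g : R -> V -> W) : Prop :=
  {within [set p : R * V | D p.1], continuous (fun p : R * V => g p.1 p.2)}.

Definition C02 (D : set R) (g : R -> V -> W) : Prop :=
  [/\ jcont D g,
      (forall t z i, D t -> derivable (g t) z (e i)),
      (forall t z i j, D t ->
          derivable (fun w => derive (g t) w (e j)) z (e i)),
      (forall i, jcont D (fun t => pd1 (g t) i))
    & (forall i j, jcont D (fun t => pd2 (g t) i j))].

Definition bnd02 (D : set R) (g : R -> V -> W) (M : R) : Prop :=
  forall t z, D t ->
    [/\ `|g t z| <= M,
        (forall i, `|pd1 (g t) i z| <= M)
      & (forall i j, `|pd2 (g t) i j z| <= M)].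

Definition C02b (D : set R) (g : R -> V -> W) : Prop :=
  C02 D g /\ exists M, bnd02 D g M.
End Regularity.

Section Stoch.
Variables (R : realType) (d : measure_display) (Omega : measurableType d).

Definition meas_wrt (G : set (set Omega)) (f : Omega -> R) : Prop :=
  forall B : set R, measurable B -> G (f @^-1` B).

Definition meas_wrt_vec (n : nat) (G : set (set Omega)) (f : Omega -> 'rV[R]_n) : Prop :=
  forall i : 'I_n, meas_wrt G (fun w => f w 0 i).

Definition filtration (T : R) (Ft : R -> set (set Omega)) : Prop :=
  (forall t, 0 <= t <= T -> sigma_algebra setT (Ft t)) /\
  (forall t, 0 <= t <= T -> Ft t `<=` measurable) /\
  (forall s t, 0 <= s -> s <= t -> t <= T -> Ft s `<=` Ft t).
End Stoch.

Section Operators.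
Variables (R : realType) (n : nat).
Local Notation V := 'rV[R]_n.

Definition jacn (f : V -> V) (z : V) : R :=
  \big[Num.max/0]_(j < n) `|derive f z (ebase R j)|.
Definition hessn (f : V -> V) (z : V) : R :=
  \big[Num.max/0]_(i < n) \big[Num.max/0]_(j < n)
     `|derive (fun w => derive f w (ebase R j)) z (ebase R i)|.
Definition mixn (F : V -> V -> V) (x y : V) : R :=
  \big[Num.max/0]_(i < n) \big[Num.max/0]_(j < n)
     `|derive (fun x' => derive (F x') y (ebase R j)) x (ebase R i)|.

Definition lapl (f : V -> V) (z : V) : V :=
  \sum_(j < n) derive (fun w => derive f w (ebase R j)) z (ebase R j).
Definition transp (u : V) (f : V -> V) (z : V) : V :=
  \sum_(j < n) u 0 j *: derive f z (ebase R j).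
End Operators.

Section Constants.
Variables (R : realType) (n : nat) (d : measure_display) (Omega : measurableType d).
Variables (T : R) (Omega0 : set Omega).
Variables (eta : R -> 'rV[R]_n -> Omega -> 'rV[R]_n)
          (F : R -> 'rV[R]_n -> 'rV[R]_n -> Omega -> 'rV[R]_n)
          (h : 'rV[R]_n -> Omega -> 'rV[R]_n).

Definition Kconst : R :=
  sup [set r | exists w x, Omega0 w /\ r = jacn (fun z => h z w) x]
  + sup [set r | exists w t x, [/\ Omega0 w, 0 <= t <= T &
                     r = jacn (fun z => eta t z w) x]]
  + sup [set r | exists w t x y, [/\ Omega0 w, 0 <= t <= T &
                     r = jacn (fun z => F t z y w) x + jacn (fun z => F t x z w) y]].

Definition Cconst : R :=
  sup [set r | exists w x, Omega0 w /\ r = hessn (fun z => h z w) x]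
  + sup [set r | exists w t x, [/\ Omega0 w, 0 <= t <= T &
                     r = hessn (fun z => eta t z w) x]]
  + sup [set r | exists w t x y, [/\ Omega0 w, 0 <= t <= T &
                     r = hessn (fun z => F t z y w) x + hessn (fun z => F t x z w) y
                         + mixn (fun x' y' => F t x' y' w) x y]].
End Constants.

(* Main.v *)
Require Import Defs.
From HB Require Import structures.
From mathcomp Require Import all_boot all_order all_algebra.
From mathcomp Require Import all_classical all_reals all_analysis.
From mathcomp Require Import measurable_realfun.
From mathcomp Require Import ring lra.
Import numFieldNormedType.Exports.
Set Implicit Arguments. Unset Strict Implicit. Unset Printing Implicit Defensive.
Import Order.TTheory GRing.Theory Num.Theory.
Local Open Scope classical_set_scope.
Local Open Scope ring_scope.

(** Taking the gradient as a separate unknown makes the nonlinearity a zero-order function of the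
    unknowns, so that only the integrable loss of one derivative on the heat kernel must be paid for
    in the fixed point. The heat semigroup is an average over a Gaussian vector [Z]. Moving [x] by
    [a v] amounts to moving [Z] by [a v / s], and the Cameron-Martin formula transfers this shift to
    a smooth weight: spatial derivatives exist for merely bounded continuous functions, and no
    kernel on the space of row vectors is needed. The choice of the truncation levels is not
    circular, because the bound of the maximum principle does not see the size [B] of the
    first-order coefficient. The level for [u] enters only through [B], so it can be set to the
    bound finally proved; the level for the gradient affects the growth rate only, and the lifespan
    is the time during which the exponent stays below 1. For the same reason this time involves
    neither [nu], nor [T], nor the bound on the data themselves. The set [Omega0] is not assumed to
    lie in any sigma-algebra of the filtration; this is what forces the trace. *)

(** Reversing time turns the equation into the forward Burgers-type system
    [d_t u = nu Lap u - (eta + u, grad) u + F(t, x, u)], [u(0) = h], solved omega by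
    omega.  Truncating [u] and [grad u] in the nonlinearity makes it bounded and
    Lipschitz, and Duhamel's formula for the pair [(u, grad u)] is then a
    contraction in the norm [sup e^(-la t) |.|] for large [la]; difference
    quotients obey the same estimate, so the nonlinearity is Lipschitz in [x] along
    the solution, [u] is [C^{1,2}], and the heat equation follows by mollifying the
    source.  A maximum principle bounds [u] on the whole interval and bounds the
    difference quotients of [u] by [(K + 1) e] up to a time depending on [K] alone;
    hence the truncations are inactive there.

    The Picard iterates at time [t] only involve the data up to time [t], so they
    are measurable for the trace of the sigma-algebra at time [t] on [Omega0]
    (data being set to [0] off [Omega0]); a bounded function measurable for the
    trace agrees on [Omega0] with an adapted one. *)

(** Dominated convergence speaks of sequences, so continuity of parametric integrals is tested along
    them; the balls of radius [1/(m+1)] suffice because the domain is pseudometric. *)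
Lemma seq_continuous_at (R : realType) (X : pseudoMetricType R) (f : X -> R) (x : X) :
  (forall u : nat -> X, u m @[m --> \oo] --> x -> f (u m) @[m --> \oo] --> f x) ->
  {for x, continuous f}.
Proof.
move=> H; apply/cvgrPdist_lt => e e0; apply: contrapT => nP.
have B m : exists y, ball x (m.+1%:R^-1) y /\ e <= `|f x - f y|.
  apply: contrapT => nB; apply: nP.
  have m0 : 0 < (m.+1%:R^-1 : R) by rewrite invr_gt0.
  near=> y; rewrite ltNge; apply/negP => ey; apply: nB; exists y; split => //.
  by near: y; exact: nbhsx_ballx.
have {B} [u uP] := choice B.
have ux : u m @[m --> \oo] --> x.
  apply/cvg_ballP => r r0; near=> m.
  have [+ _] := uP m; apply: le_ball.
  by apply: ltW; near: m; exact: (near_infty_natSinv_lt (PosNum r0)).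
have /cvgrPdist_lt /(_ e e0) [N _ /(_ N (leqnn N))] := H u ux.
by case: (uP N) => _ /le_lt_trans h /h; rewrite ltxx.
Unshelve. all: by end_near. Qed.

(** * Calculus under the integral sign *)

Section DominatedIntegral.
Context (R : realType) d (Y : measurableType d) (mu : {measure set Y -> \bar R}).
Variable (B : set Y).
Hypothesis mB : measurable B.

Lemma dominated_integrableR (f g : Y -> R) :
  measurable_fun B f -> mu.-integrable B (EFin \o g) ->
  (forall y, B y -> `|f y| <= g y) -> mu.-integrable B (EFin \o f).
Proof.
move=> mf ig fg; apply: (le_integrable mB _ _ ig).
  exact/measurable_EFinP.
by move=> y By /=; rewrite lee_fin (le_trans (fg _ By))// ler_norm.
Qed.

Lemma integrable_scale (c : R) (f : Y -> R) :
  mu.-integrable B (EFin \o f) -> mu.-integrable B (EFin \o (fun y => c * f y)).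
Proof.
move=> fi; rewrite (_ : EFin \o _ = (fun y => c%:E * (EFin \o f) y)%E).
  exact: integrableZl.
by apply/funext => y; rewrite /= EFinM.
Qed.

Lemma Rintegral_dominated_cvg (f_ : nat -> Y -> R) (f g : Y -> R) :
  (forall m, measurable_fun B (f_ m)) ->
  mu.-integrable B (EFin \o g) ->
  (forall m y, B y -> `|f_ m y| <= g y) ->
  (forall y, B y -> f_ m y @[m --> \oo] --> f y) ->
  \int[mu]_(y in B) f_ m y @[m --> \oo] --> \int[mu]_(y in B) f y.
Proof.
move=> mf ig fg cf; apply: fine_cvg.
have mf' : measurable_fun B f.
  apply/measurable_EFinP.
  apply: (@emeasurable_fun_cvg _ _ _ _ (fun m y => (f_ m y)%:E)).
    by move=> m; exact/measurable_EFinP.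
  by move=> y By; apply: cvg_EFin; [exact: nearW|exact: cf].
have fg' y : B y -> `|f y| <= g y.
  move=> By; have h : `|f_ m y| @[m --> \oo] --> `|f y| by apply: cvg_norm; exact: cf.
  rewrite -(cvg_lim _ h)//; apply: limr_le; first by apply: cvgP; exact: h.
  by apply: nearW => m; exact: fg.
rewrite fineK; last first.
  by apply: integrable_fin_num => //; exact: (dominated_integrableR mf' ig fg').
apply: (@dominated_cvg _ _ _ mu _ mB (fun m y => (f_ m y)%:E) _ (EFin \o g)) => //.
- by move=> m; exact/measurable_EFinP.
- by move=> y By; apply: cvg_EFin; [exact: nearW|exact: cf].
Qed.

Lemma dominated_continuous_at (X : pseudoMetricType R) (f : X -> Y -> R) (g : Y -> R)
    (x : X) :
  (forall z, measurable_fun B (f z)) ->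
  mu.-integrable B (EFin \o g) ->
  (forall z y, B y -> `|f z y| <= g y) ->
  (forall y, B y -> {for x, continuous (f^~ y)}) ->
  {for x, continuous (fun z => \int[mu]_(y in B) f z y)}.
Proof.
move=> mf ig fg cf; apply: seq_continuous_at => u ux.
apply: (@Rintegral_dominated_cvg (fun m y => f (u m) y) (f x) g) => //.
  by move=> m y; exact: fg.
by move=> y By; exact: (cvg_comp u (f^~ y) ux (cf y By)).
Qed.

End DominatedIntegral.

(** The two difference quotients coincide term by term. Directional derivatives are thereby reduced
    to one real variable, where the mean value theorem and differentiation under the integral
    apply. *)
Lemma is_derive_line (R : realType) (V W : normedModType R) (f : V -> W) (x v : V) (l : W) :
  is_derive x v f l <-> is_derive (0 : R) (1 : R) (fun a => f (a *: v + x)) l.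
Proof.
have E : (fun h : R => h^-1 *: ((f \o shift x) (h *: v) - f x)) =
    (fun h : R => h^-1 *: (((fun a => f (a *: v + x)) \o shift (0 : R)) (h *: (1 : R)) -
      f ((0 : R) *: v + x))).
  by apply/funext => h /=; rewrite addr0 scale0r add0r /GRing.scale/= mulr1.
split=> [] [d1 d2]; split.
- by rewrite /derivable -E.
- by rewrite -d2 /derive -E.
- by rewrite /derivable E.
- by rewrite -d2 /derive E.
Qed.

Lemma is_derive_line_at (R : realType) (V W : normedModType R) (f : V -> W) (x v : V)
    (l : W) (a : R) :
  is_derive (a *: v + x) v f l -> is_derive a (1 : R) (fun b => f (b *: v + x)) l.
Proof.
move=> /is_derive_line [d1 d2].
have E : (fun h : R => h^-1 *: (((fun b => f (b *: v + x)) \o shift a) (h *: (1 : R)) -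
      f (a *: v + x))) =
    (fun h : R => h^-1 *: (((fun b => f (b *: v + (a *: v + x))) \o shift (0 : R)) (h *: (1 : R)) -
      f ((0 : R) *: v + (a *: v + x)))).
  by apply/funext => h /=; rewrite addr0 scale0r add0r scalerDl addrA.
by split; [rewrite /derivable E|rewrite -d2 /derive E].
Qed.

(** Domination is required for [|a| < 1] only: the Gaussian tilts [expR (a * si - a * a * ka)] met
    later have no bound uniform in all [a]. *)
Lemma dominated_is_derive0 (R : realType) d (Y : measurableType d)
    (mu : {measure set Y -> \bar R}) (B : set Y) (k dk : R -> Y -> R) (g : Y -> R) :
  measurable B ->
  (forall a, `|a| < 1 -> mu.-integrable B (EFin \o k a)) ->
  mu.-integrable B (EFin \o g) ->
  (forall a y, `|a| < 1 -> B y -> is_derive a (1 : R) (k^~ y) (dk a y)) ->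
  (forall a y, `|a| < 1 -> B y -> `|dk a y| <= g y) ->
  is_derive (0 : R) (1 : R) (fun a => \int[mu]_(y in B) k a y) (\int[mu]_(y in B) dk 0 y).
Proof.
move=> mB fi gi kd dkg.
have I0 : (`](-1 : R), 1[%classic : set R) 0 by rewrite /= in_itv/= ltrN10 ltr01.
have I1 a : (`](-1 : R), 1[%classic : set R) a -> `|a| < 1.
  by rewrite /= in_itv/= ltr_norml.
have ik a : (`](-1 : R), 1[%classic : set R) a -> mu.-integrable B (EFin \o k a).
  by move=> /I1; exact: fi.
have dk' a y : (`](-1 : R), 1[%classic : set R) a -> B y -> derivable (k^~ y) a 1.
  by move=> /I1 a1 By; have [] := kd a y a1 By.
have gi' : mu.-integrable B (EFin \o (fun y => `|g y|)).
  exact: (integrable_norm gi).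
have bk a y : (`](-1 : R), 1[%classic : set R) a -> B y ->
    `|partial1of2 k a y| <= `|g y|.
  move=> /I1 a1 By; rewrite partial1of2E; have [_ ->] := kd a y a1 By.
  by rewrite (le_trans (dkg _ _ a1 By))// ler_norm.
have g0 y : 0 <= `|g y| by [].
split; first exact: (derivable_under_integral mB I0 ik dk' g0 gi' bk).
rewrite -derive1E (differentiation_under_integral mB I0 ik dk' g0 gi' bk).
apply: eq_Rintegral => y; rewrite inE => By.
by rewrite partial1of2E; have [_ ->] := kd 0 y (I1 _ I0) By.
Qed.

Lemma dominated_is_derive (R : realType) d (Y : measurableType d)
    (mu : {measure set Y -> \bar R}) (B : set Y) (V : normedModType R)
    (f df : V -> Y -> R) (g : Y -> R) (x v : V) :
  measurable B ->
  (forall z, mu.-integrable B (EFin \o f z)) ->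
  mu.-integrable B (EFin \o g) ->
  (forall z y, B y -> is_derive z v (f^~ y) (df z y)) ->
  (forall z y, B y -> `|df z y| <= g y) ->
  is_derive x v (fun z => \int[mu]_(y in B) f z y) (\int[mu]_(y in B) df x y).
Proof.
move=> mB fi gi fd dfg; apply/is_derive_line.
have := @dominated_is_derive0 R _ Y mu B (fun a y => f (a *: v + x) y)
  (fun a y => df (a *: v + x) y) g mB (fun a _ => fi _) gi.
rewrite scale0r add0r; apply.
  move=> a y _ By.
  exact: (@is_derive_line_at _ _ _ (f^~ y) x v (df (a *: v + x) y) a (fd _ _ By)).
by move=> a y _ By; exact: dfg.
Qed.

Lemma continuous_edP (R : realType) (V W : normedModType R) (f : V -> W) (x : V) :
  {for x, continuous f} <->
  forall e : R, 0 < e -> exists2 d : R, 0 < d & forall y, `|x - y| < d -> `|f x - f y| < e.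
Proof.
split=> [/cvgrPdist_lt cf e e0|H].
  have /nbhs_ballP[d d0 dP] := cf e e0.
  by exists d => // y xy; apply: dP; rewrite -ball_normE.
apply/cvgrPdist_lt => e e0; have [d d0 dP] := H e e0.
by apply/nbhs_ballP; exists d => // y; rewrite -ball_normE; exact: dP.
Qed.

Lemma is_derive_translate (R : realType) (V W : normedModType R) (f : V -> W) (x v c : V) (l : W) :
  is_derive (x + c) v f l -> is_derive x v (fun z => f (z + c)) l.
Proof.
move=> /is_derive_line H; apply/is_derive_line.
rewrite (_ : (fun a => _) = (fun a : R => f (a *: v + (x + c))))//.
by apply/funext => a; rewrite addrA.
Qed.

Lemma is_derive_mulc (R : realType) (V : normedModType R) (f : V -> R) (x v : V) (l k : R) :
  is_derive x v f l -> is_derive x v (fun z => f z * k) (l * k).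
Proof.
move=> H; have := @is_deriveZ R V R f k x v l H.
rewrite (_ : k \*: f = (fun z => f z * k)); last first.
  by apply/funext => z /=; rewrite mulrC.
by move=> H2; apply: is_derive_eq; rewrite [LHS]mulrC.
Qed.

(** * Continuity and derivative rules for functions given by explicit expressions *)

Section ContinuityLambda.
Context (R : realType) (X : topologicalType).

Lemma cont_cst (Y : topologicalType) (c : Y) : continuous (fun _ : X => c).
Proof. by move=> x; exact: cvg_cst. Qed.

Lemma cont_id : continuous (fun x : X => x).
Proof. by move=> x; exact: cvg_id. Qed.

Lemma cont_comp (Y W : topologicalType) (f : X -> Y) (g : Y -> W) :
  continuous f -> continuous g -> continuous (fun x => g (f x)).
Proof. by move=> cf cg x; exact: (cvg_comp f g (cf x) (cg (f x))). Qed.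

Lemma cont_pair (Y W : topologicalType) (f : X -> Y) (g : X -> W) :
  continuous f -> continuous g -> continuous (fun x => (f x, g x)).
Proof. by move=> cf cg x; exact: (cvg_pair (cf x) (cg x)). Qed.

Lemma cont_uncurry (Y W U : topologicalType) (f : X -> Y) (g : X -> W) (k : Y -> W -> U) :
  continuous (fun p : Y * W => k p.1 p.2) -> continuous f -> continuous g ->
  continuous (fun x => k (f x) (g x)).
Proof.
by move=> ck cf cg; exact: (cont_comp (cont_pair cf cg) ck).
Qed.

Lemma contD (V : normedModType R) (f g : X -> V) :
  continuous f -> continuous g -> continuous (fun x => f x + g x).
Proof. by move=> cf cg x; apply: cvgD; [exact: cf|exact: cg]. Qed.

Lemma contB (V : normedModType R) (f g : X -> V) :
  continuous f -> continuous g -> continuous (fun x => f x - g x).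
Proof. by move=> cf cg x; apply: cvgB; [exact: cf|exact: cg]. Qed.

Lemma contN (V : normedModType R) (f : X -> V) :
  continuous f -> continuous (fun x => - f x).
Proof. by move=> cf x; apply: cvgN; exact: cf. Qed.

Lemma contZ (V : normedModType R) (s : X -> R) (f : X -> V) :
  continuous s -> continuous f -> continuous (fun x => s x *: f x).
Proof. by move=> cs cf x; apply: cvgZ; [exact: cs|exact: cf]. Qed.

Lemma contM (f g : X -> R) :
  continuous f -> continuous g -> continuous (fun x => f x * g x).
Proof. by move=> cf cg x; apply: cvgM; [exact: cf|exact: cg]. Qed.

Lemma cont_norm (V : normedModType R) (f : X -> V) :
  continuous f -> continuous (fun x => `|f x|).
Proof. by move=> cf x; apply: cvg_norm; exact: cf. Qed.

Lemma cont_exp (f : X -> R) : continuous f -> continuous (fun x => expR (f x)).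
Proof. by move=> cf; apply: (cont_comp cf); exact: continuous_expR. Qed.

Lemma cont_sqrt (f : X -> R) : continuous f -> continuous (fun x => Num.sqrt (f x)).
Proof. by move=> cf; apply: (cont_comp cf); exact: sqrt_continuous. Qed.

Lemma cont_sum (I : Type) (r : seq I) (P : pred I) (f : I -> X -> R) :
  (forall i, continuous (f i)) -> continuous (fun x => \sum_(i <- r | P i) f i x).
Proof.
move=> cf; elim: r => [|i r IH].
  rewrite (_ : (fun x => _) = (fun _ => 0)); first exact: cont_cst.
  by apply/funext => x; rewrite big_nil.
rewrite (_ : (fun x => _) =
  (fun x => (if P i then f i x else 0) + \sum_(i <- r | P i) f i x)); last first.
  by apply/funext => x; rewrite big_cons; case: (P i); rewrite ?add0r.
by apply: contD => //; case: (P i); [exact: cf|exact: cont_cst].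
Qed.

Lemma cont_max (f g : X -> R) :
  continuous f -> continuous g -> continuous (fun x => Num.max (f x) (g x)).
Proof. by move=> cf cg x; apply: continuous_max; [exact: cf|exact: cg]. Qed.

Lemma cont_min (f g : X -> R) :
  continuous f -> continuous g -> continuous (fun x => Num.min (f x) (g x)).
Proof. by move=> cf cg x; apply: continuous_min; [exact: cf|exact: cg]. Qed.

End ContinuityLambda.

Lemma cont_fst (X Y : topologicalType) : continuous (fun p : X * Y => p.1).
Proof. by move=> [x y]; exact: cvg_fst. Qed.

Lemma cont_snd (X Y : topologicalType) : continuous (fun p : X * Y => p.2).
Proof. by move=> [x y]; exact: cvg_snd. Qed.

Lemma cont_coord (R : realType) (n : nat) (X : topologicalType) (f : X -> 'rV[R]_n) i :
  continuous f -> continuous (fun x => f x 0 i).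
Proof.
move=> cf; apply: (@cont_comp X _ _ f (fun y : 'rV[R]_n => y 0 i) cf).
exact: coord_continuous.
Qed.

Lemma cont_row (R : realType) (n : nat) (X : topologicalType) (f : 'I_n -> X -> R) :
  (forall i, continuous (f i)) -> continuous (fun x => \row_i f i x : 'rV[R]_n).
Proof.
move=> cf x; apply/cvgrPdist_lt => e e0.
have : \forall y \near x, forall j, `|f j x - f j y| < e.
  apply: filter_forall => j.
  by have /cvgrPdist_lt := cf j x; exact.
apply: filterS => y H.
rewrite [ltLHS]/Num.Def.normr/= mx_normrE; apply/bigmax_ltP; split => //= -[i j] _.
by rewrite !mxE.
Qed.

Section DeriveLambda.
Context (R : realType) (V : normedModType R).
Implicit Types (f g : V -> R).

Lemma isd_add f g x v a b : is_derive x v f a -> is_derive x v g b ->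
  is_derive x v (fun z => f z + g z) (a + b).
Proof. by move=> H1 H2; exact: (@is_deriveD _ _ _ f g x v a b H1 H2). Qed.

Lemma isd_sub f g x v a b : is_derive x v f a -> is_derive x v g b ->
  is_derive x v (fun z => f z - g z) (a - b).
Proof. by move=> H1 H2; exact: (@is_deriveB _ _ _ f g x v a b H1 H2). Qed.

Lemma isd_mul f g x v a b : is_derive x v f a -> is_derive x v g b ->
  is_derive x v (fun z => f z * g z) (f x * b + g x * a).
Proof. by move=> H1 H2; exact: (@is_deriveM _ _ f g x v a b H1 H2). Qed.

Lemma isd_cst (c : R) (x v : V) : is_derive x v (fun _ => c) 0.
Proof. exact: is_derive_cst. Qed.

Lemma isd_sum (n : nat) (h : 'I_n -> V -> R) (x v : V) (dh : 'I_n -> R) :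
  (forall i, is_derive x v (h i) (dh i)) ->
  is_derive x v (fun z => \sum_i h i z) (\sum_i dh i).
Proof.
move=> H; have := @is_derive_sum _ _ _ n h x v dh H.
rewrite (_ : \sum_(i < n) h i = (fun z => \sum_i h i z))//.
by apply/funext => z; elim/big_ind2 : _ => //= f1 ? f2 ? <- <-.
Qed.

End DeriveLambda.

Lemma isd_id (R : realType) (a : R) : is_derive a (1 : R) (fun b : R => b) (1 : R).
Proof. exact: is_derive_id. Qed.

Lemma isd_exp (R : realType) (f : R -> R) (a l : R) : is_derive a (1 : R) f l ->
  is_derive a (1 : R) (fun b => expR (f b)) (expR (f a) * l).
Proof.
move=> H; exact: (@is_derive1_comp R expR f a _ _ (is_derive_expR _) H).
Qed.

Lemma isd_eq (R : realType) (V W : normedModType R) (f : V -> W) (x v : V) (a b : W) :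
  is_derive x v f a -> a = b -> is_derive x v f b.
Proof. by move=> H <-. Qed.

Lemma Rintegral_sum_ord (R : realType) d (Y : measurableType d) (mu : {measure set Y -> \bar R})
    (B : set Y) (n : nat) (f : 'I_n -> Y -> R) : measurable B ->
  (forall i, mu.-integrable B (EFin \o f i)) ->
  \int[mu]_(y in B) (\sum_i f i y) = \sum_i \int[mu]_(y in B) f i y.
Proof.
move=> mB fi.
suff [] : mu.-integrable B (EFin \o (fun y => \sum_i f i y)) /\
  \int[mu]_(y in B) (\sum_i f i y) = \sum_i \int[mu]_(y in B) f i y by [].
elim: n f fi => [|n IH] f fi.
  rewrite big_ord0 (_ : (fun y => \sum_i f i y) = (fun=> 0)); last first.
    by apply/funext => y; rewrite big_ord0.
  by rewrite Rintegral_cst ?mul0r//; split => //; exact: integrable0.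
have [i1 i2] := IH (fun i => f (lift ord0 i)) (fun i => fi _).
rewrite (_ : (fun y => \sum_i f i y) = (fun y => f ord0 y + \sum_i f (lift ord0 i) y)); last first.
  by apply/funext => y; rewrite big_ord_recl.
split; last by rewrite big_ord_recl -i2 RintegralD.
rewrite /comp; under eq_fun do rewrite EFinD.
by apply: integrableD => //; exact: fi.
Qed.

(** * Gaussian vectors *)

Section Caratheodory.
Context (R : realType) d (T : measurableType d) (n : nat).
Implicit Types (Y : T -> 'rV[R]_n).

Definition grid_round (N : nat) (y : 'rV[R]_n) : 'rV[R]_n :=
  \row_i ((Num.floor (N.+1%:R * y 0 i))%:~R / N.+1%:R).

Lemma grid_round_cvg (y : 'rV[R]_n) : grid_round N y @[N --> \oo] --> y.
Proof.
apply/cvgrPdist_lt => e e0; near=> N.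
have N0 : 0 < (N.+1%:R : R) by rewrite ltr0n.
have Ne : (N.+1%:R^-1 : R) < e by near: N; exact: (near_infty_natSinv_lt (PosNum e0)).
apply: le_lt_trans Ne.
rewrite [leLHS]/Num.Def.normr/= mx_normrE; apply/bigmax_leP; split => //=.
move=> [i j] _; rewrite !mxE/= (ord1 i).
set r := N.+1%:R * y 0 j.
have -> : y 0 j = r / N.+1%:R by rewrite /r mulrAC mulfV ?mul1r// gt_eqF.
rewrite -mulrBl normrM (@ger0_norm _ N.+1%:R^-1) ?invr_ge0 ?(ltW N0)//.
apply: ler_piMl; first by rewrite invr_ge0 ltW.
have /andP[h1 h2] : (Num.floor r)%:~R <= r < (Num.floor r + 1)%:~R.
  by rewrite floor_le_tmp floorD1_gt.
move: h2; rewrite intrD => h2.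
by rewrite ger0_norm ?subr_ge0//; lra.
Unshelve. all: by end_near. Qed.

(** A Caratheodory function, measurable in [t] and continuous in [y], may be composed with a
    measurable [y = Y t]. Rounding [Y] to a grid leaves countably many values of [y], each handled
    by measurability in [t]; refining the grid uses continuity in [y]. Vectors thus enter only
    through the measurability of their coordinates. *)
Lemma measurable_caratheodory_comp Y (H : 'rV[R]_n -> T -> R) :
  (forall i, measurable_fun setT (fun t => Y t 0 i)) ->
  (forall y, measurable_fun setT (H y)) ->
  (forall t, continuous (H^~ t)) ->
  measurable_fun setT (fun t => H (Y t) t).
Proof.
move=> mY mH cH.
apply: (@measurable_fun_cvg _ _ _ _ (fun N t => H (grid_round N (Y t)) t)); last first.
  by move=> t _; apply: (cvg_comp (fun N => grid_round N (Y t)) (H^~ t));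
     [exact: grid_round_cvg|exact: cH].
move=> N _ B mB; rewrite setTI.
(* On [cell k] the rounded vector is the constant [pt k]; the index type of the cells is
   countable. *)
pose cell (k : {ffun 'I_n -> int}) : set T :=
  \bigcap_(i in [set: 'I_n]) [set t | Num.floor (N.+1%:R * Y t 0 i) = k i].
pose pt (k : {ffun 'I_n -> int}) : 'rV[R]_n := \row_i ((k i)%:~R / N.+1%:R).
rewrite (_ : _ @^-1` _ = \bigcup_(k : {ffun 'I_n -> int}) (cell k `&` H (pt k) @^-1` B)).
  apply: countable_bigcupT_measurable; first exact: countableP.
  move=> k; apply: measurableI; last by rewrite -[_ @^-1` _]setTI; exact: mH.
  apply: fin_bigcap_measurable => [|i _]; first exact: finite_finset.
  have -> : [set t | Num.floor (N.+1%:R * Y t 0 i) = k i] =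
      (fun t => N.+1%:R * Y t 0 i) @^-1` (`[(k i)%:~R, (k i + 1)%:~R[%classic : set R).
    by apply/seteqP; split => t /=; rewrite in_itv/= => h;
      [rewrite -h floor_le_tmp floorD1_gt|exact: floor_def].
  rewrite -[_ @^-1` _]setTI.
  by apply: (measurable_funM (measurable_cst _) (mY i)) => //; exact: measurable_itv.
apply/seteqP; split => [t Bt|t [k _ [ck Bk]]].
  exists [ffun i => Num.floor (N.+1%:R * Y t 0 i)] => //; split.
    by move=> i _ /=; rewrite ffunE.
  by move: Bt; rewrite /= /pt /grid_round; congr (B (H _ t)); apply/rowP => i;
    rewrite !mxE ffunE.
rewrite /=; move: Bk; rewrite /= /pt /grid_round.
congr (B (H _ t)); apply/rowP => i; rewrite !mxE.
by have /= -> := ck i I.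
Qed.

Lemma continuous_measurable_comp Y (f : 'rV[R]_n -> R) :
  (forall i, measurable_fun setT (fun t => Y t 0 i)) ->
  continuous f -> measurable_fun setT (f \o Y).
Proof.
move=> mY cf; apply: (@measurable_caratheodory_comp Y (fun y _ => f y)) => //.
Qed.

End Caratheodory.

(** * The standard Gaussian density on the line *)

Section Gauss1.
Context (R : realType).
Local Notation mu := (@lebesgue_measure R).

Definition gdens (z : R) : R := normal_peak 1 * expR (- z ^+ 2 / 2).

Lemma gdensE : gdens = normal_pdf 0 1.
Proof.
apply/funext => z; rewrite normal_pdfE ?oner_eq0//= /gdens /normal_fun.
by rewrite subr0 expr1n -[2%:R]/(1 *+ 2).
Qed.

Lemma gdens_ge0 z : 0 <= gdens z. Proof. by rewrite gdensE normal_pdf_ge0. Qed.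

Lemma continuous_gdens : continuous gdens.
Proof. by rewrite gdensE; apply: continuous_normal_pdf; rewrite oner_eq0. Qed.

Lemma measurable_gdens : measurable_fun setT gdens.
Proof. exact: continuous_measurable_fun continuous_gdens. Qed.

Lemma integral_gdens : (\int[mu]_z (gdens z)%:E = 1)%E.
Proof. by rewrite gdensE integral_normal_pdf. Qed.

(** From [(c - |z|/2)^2 >= 0] follows [c |z| - z^2/2 <= c^2 - z^2/4], so the integrand is at most a
    multiple of the Gaussian density of variance 2, whence the [Num.sqrt 2]. *)
Lemma gdens_exp_integrable (c : R) :
  mu.-integrable setT (fun z => (expR (c * `|z|) * gdens z)%:E).
Proof.
have s0 : Num.sqrt 2 != 0 :> R by rewrite gt_eqF// sqrtr_gt0.
pose C : R := expR (c ^+ 2) * normal_peak 1 / normal_peak (Num.sqrt 2).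
have p2 : 0 < normal_peak (Num.sqrt 2 : R) by exact: normal_peak_gt0.
apply: (@dominated_integrableR _ _ _ mu _ measurableT (fun z => expR (c * `|z|) * gdens z)
  (fun z => C * normal_pdf 0 (Num.sqrt 2) z)).
- apply: measurable_funM measurable_gdens.
  apply: measurableT_comp => //; apply: measurable_funM => //.
- rewrite /comp; under eq_fun do rewrite EFinM.
  by apply: integrableZl => //; exact: integrable_normal_pdf.
- move=> z _; rewrite ger0_norm ?mulr_ge0 ?expR_ge0 ?gdens_ge0//.
  rewrite normal_pdfE//= /C /gdens /normal_fun subr0 sqr_sqrtr//.
  have aux (x p q y : R) : q != 0 -> x * p / q * (q * y) = p * (x * y).
    by move=> q0; field.
  rewrite aux ?gt_eqF// mulrCA.
  apply: ler_wpM2l; rewrite ?normal_peak_ge0//.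
  rewrite -!expRD ler_expR.
  have -> : z ^+ 2 = `|z| ^+ 2 by rewrite real_normK// num_real.
  have := sqr_ge0 (c - `|z| / 2); rewrite (_ : 2 *+ 2 = 4 :> R); last by ring.
  nra.
exact: normal_peak_ge0.
Qed.

(** One-dimensional Cameron-Martin formula: translate the variable and use [gdens (z - a) = expR (a
    z - a^2/2) * gdens z]. For nonnegative [f] it is an identity in the extended reals, free of
    integrability conditions. *)
Lemma gdens_shift (f : R -> R) (a : R) :
  continuous f -> (forall z, 0 <= f z) ->
  (\int[mu]_z (f (z + a) * gdens z)%:E =
   \int[mu]_z (f z * expR (a * z - a ^+ 2 / 2) * gdens z)%:E)%E.
Proof.
move=> cf f0.
pose F (z : R) : R := z + a.
have dF (z : R) : is_derive z (1 : R) F 1.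
  exact: is_derive_shift.
have F' : F^`()%classic = cst 1.
  by apply/funext => z; rewrite derive1E; have [_ ->] := dF z.
rewrite (@increasing_ge0_integration_by_substitutionT R F
  (fun z => f z * expR (a * z - a ^+ 2 / 2) * gdens z)); first last.
- by move=> z; rewrite mulr_ge0 ?gdens_ge0// mulr_ge0 ?expR_ge0.
- move=> z; apply: cvgM; last exact: continuous_gdens.
  apply: cvgM; first exact: cf.
  apply: (cvg_comp (fun z => a * z - a ^+ 2 / 2) expR); last exact: continuous_expR.
  by apply: cvgB; [apply: cvgM; [exact: cvg_cst|exact: cvg_id]|exact: cvg_cst].
- exact: cvg_addrr.
- exact: cvg_addrr_Ny.
- by move=> z; have [] := dF z.
- by rewrite F'; exact: is_cvg_cst.
- by rewrite F'; exact: is_cvg_cst.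
- by rewrite F' => ?; exact: cvg_cst.
- by move=> x y xy; rewrite /F ltrD2r.
apply: eq_integral => z _; congr EFin; rewrite F' !fctE mulr1 /= /F -mulrA.
congr (_ * _); rewrite /gdens mulrCA -expRD; congr (_ * expR _).
by field.
Qed.

End Gauss1.

(* Only the properties of the standard Gaussian vector that the heat semigroup
   needs are kept: exponential moments and the Cameron-Martin shift formula. *)
Record gaussian_vector (R : realType) (n : nat) := GaussianVector {
  gv_disp : measure_display;
  gv_type : measurableType gv_disp;
  gv_mu : {sigma_finite_measure set gv_type -> \bar R};
  gv_Z : gv_type -> 'rV[R]_n;
  gv_rho : gv_type -> R;
  gv_Z_meas : forall i, measurable_fun setT (fun w => gv_Z w 0 i);
  gv_rho_meas : measurable_fun setT gv_rho;
  gv_rho_ge0 : forall w, 0 <= gv_rho w;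
  gv_mass : (\int[gv_mu]_w (gv_rho w)%:E = 1)%E;
  gv_exp : forall c : R, gv_mu.-integrable setT
    (fun w => (expR (c * \sum_i `|gv_Z w 0 i|) * gv_rho w)%:E);
  gv_shift : forall (f : 'rV[R]_n -> R) (v : 'rV[R]_n),
    continuous f -> (forall z, 0 <= f z) ->
    (\int[gv_mu]_w (f (gv_Z w + v) * gv_rho w)%:E =
     \int[gv_mu]_w (f (gv_Z w) *
        expR (\sum_i v 0 i * gv_Z w 0 i - (\sum_i v 0 i ^+ 2) / 2) * gv_rho w)%:E)%E }.

Arguments gv_Z_meas {R n} g i.
Arguments gv_rho_meas {R n} g.
Arguments gv_rho_ge0 {R n} g w.
Arguments gv_mass {R n} g.
Arguments gv_exp {R n} g c.
Arguments gv_shift {R n} g f v.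

Section ProductSigmaFinite.
Context (R : realType) d1 d2 (T1 : measurableType d1) (T2 : measurableType d2).
Variables (m1 : {sigma_finite_measure set T1 -> \bar R})
          (m2 : {sigma_finite_measure set T2 -> \bar R}).

Let product_sigma_finite : sigma_finite setT (m1 \x m2)%E.
Proof.
have [F FT FP] := sigma_finiteT m1; have [G GT GP] := sigma_finiteT m2.
(* A single enumeration of all pairs of indices, so that the rectangles [F i] times [G j] form one
   sequence. *)
have [f [g fg]] : exists f g : nat -> nat, forall i j, exists k, f k = i /\ g k = j.
  exists (fun k => (odflt (0, 0)%N (unpickle k : option (nat * nat))).1).
  exists (fun k => (odflt (0, 0)%N (unpickle k : option (nat * nat))).2).
  by move=> i j; exists (pickle (i, j)); rewrite pickleK.
exists (fun k => F (f k) `*` G (g k)).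
  apply/seteqP; split => // -[x y] _.
  have [i _ Fi] : (\bigcup_k F k) x by rewrite -FT.
  have [j _ Gj] : (\bigcup_k G k) y by rewrite -GT.
  by have [k [fk burgers_rhs]] := fg i j; exists k => //; split; rewrite /= ?fk ?burgers_rhs.
move=> k; have [mF Foo] := FP (f k); have [mG Goo] := GP (g k).
split; first exact: measurableX.
by rewrite product_measure1E// lte_mul_pinfty// ge0_fin_numE.
Qed.

Definition product_sfm : {sigma_finite_measure set (T1 * T2)%type -> \bar R} :=
  HB.pack (product_measure1 m1 m2)
    (@Measure_isSigmaFinite.Build _ _ _ (m1 \x m2)%E product_sigma_finite).
End ProductSigmaFinite.

Section GaussianVectorExists.
Context (R : realType).

(** In dimension 0 a point mass does: there is one row vector and all the sums are empty. *)
Lemma gaussian_vector0 : inhabited (gaussian_vector R 0).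
Proof.
have E (F : 'I_0 -> R) : \sum_i F i = 0 by rewrite big_ord0.
constructor.
apply: (@GaussianVector R 0 _ _ (dirac (0 : R)) (fun _ => 0) (fun _ => 1)) => //.
- by rewrite integral_cst//= diracT mule1.
- move=> c; rewrite (_ : (fun _ => _) = cst 1%:E).
    by apply/finite_measure_integrable_cst.
  by apply/funext => w; rewrite E mulr0 expR0 mulr1.
- move=> f v cf f0; apply: eq_integral => w _; rewrite !E mul0r subr0 expR0 mulr1.
  by rewrite (thinmx0 v) addr0 !mulr1.
Qed.

Lemma continuous_row_mxl n (y : 'rV[R]_n) :
  continuous (fun z : R => row_mx (z%:M : 'rV[R]_1) y).
Proof.
move=> z; apply/continuous_edP => e e0; exists e => // x zx.
rewrite [ltLHS]/Num.Def.normr/= mx_normrE; apply/bigmax_ltP; split => //= -[i j] _.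
rewrite (ord1 i) !mxE/=; case: (split_ordP j) => k _; rewrite ?mxE ?subrr ?normr0//.
by rewrite (ord1 k) eqxx !mulr1n.
Qed.

Lemma continuous_row_mxr n (z : R) :
  continuous (fun y : 'rV[R]_n => row_mx (z%:M : 'rV[R]_1) y).
Proof.
move=> y; apply/continuous_edP => e e0; exists e => // x yx.
rewrite [ltLHS]/Num.Def.normr/= mx_normrE; apply/bigmax_ltP; split => //= -[i j] _.
rewrite (ord1 i) !mxE/=; case: (split_ordP j) => k _; rewrite ?mxE ?subrr ?normr0//.
apply: le_lt_trans yx; rewrite [leRHS]/Num.Def.normr/= mx_normrE.
by have := le_bigmax (0 : R) (fun i : 'I_1 * 'I_n => `|(y - x) i.1 i.2|) (0, k); rewrite /= !mxE.
Qed.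

(** An independent Gaussian coordinate is prepended. The density is a product, so exponential
    moments factor by Tonelli; the shift is carried out on one block at a time, exchanging the order
    of integration in between. *)
Lemma gaussian_vectorS n : gaussian_vector R n -> gaussian_vector R n.+1.
Proof.
move=> G; pose mu : {sigma_finite_measure set (measurableTypeR R) -> \bar R} := @lebesgue_measure R.
pose m := gv_mu G.
pose Z (p : measurableTypeR R * gv_type G) : 'rV[R]_(1 + n) := row_mx ((p.1 : R)%:M) (gv_Z p.2).
pose rho (p : measurableTypeR R * gv_type G) := gdens p.1 * gv_rho p.2.
have mfst (f : R -> R) : measurable_fun setT f ->
    measurable_fun setT (fun p : measurableTypeR R * gv_type G => f p.1).
  by move=> mf; exact: (measurableT_comp mf measurable_fst).
have msnd (f : gv_type G -> R) : measurable_fun setT f ->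
    measurable_fun setT (fun p : measurableTypeR R * gv_type G => f p.2).
  by move=> mf; exact: (measurableT_comp mf measurable_snd).
have mrho : measurable_fun setT rho.
  by apply: measurable_funM; [apply: mfst; exact: measurable_gdens|apply: msnd; exact: gv_rho_meas].
have mZ i : measurable_fun setT (fun w => Z w 0 i).
  rewrite /Z; case: (split_ordP i) => k ->.
    under eq_fun do rewrite row_mxEl (ord1 k) !mxE/= mulr1n.
    exact: measurable_fst.
  rewrite (_ : (fun w => _) = (fun p : measurableTypeR R * gv_type G => gv_Z p.2 0 k)); last first.
    by apply/funext => p; rewrite row_mxEr.
  exact: (msnd (fun w => gv_Z w 0 k) (gv_Z_meas G k)).
have rho0 p : 0 <= rho p by rewrite mulr_ge0 ?gdens_ge0 ?gv_rho_ge0.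
have prodint (f : R -> R) (g : gv_type G -> R) :
    measurable_fun setT f -> measurable_fun setT g ->
    (forall z, 0 <= f z) -> (forall w, 0 <= g w) ->
    (\int[mu \x m]_p (f p.1 * g p.2)%:E =
     (\int[mu]_z (f z)%:E) * (\int[m]_w (g w)%:E))%E.
  move=> mf mg f0 g0; rewrite fubini_tonelli1/=; last 2 first.
  - by apply/measurable_EFinP/measurable_funM; [exact: (mfst f mf)|exact: (msnd g mg)].
  - by move=> p; rewrite lee_fin mulr_ge0.
  rewrite /fubini_F/= -ge0_integralZr//.
  - apply: eq_integral => z _; rewrite -ge0_integralZl//.
    + exact/measurable_EFinP.
    + by move=> w _; rewrite lee_fin.
    + by rewrite lee_fin.
  - exact/measurable_EFinP.
  - by move=> z _; rewrite lee_fin.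
  - by apply: integral_ge0 => w _; rewrite lee_fin.
pose mm := product_sfm mu m.
have h1 : (\int[mm]_w (rho w)%:E = 1)%E.
  rewrite prodint ?integral_gdens ?gv_mass ?mule1//.
  + exact: measurable_gdens.
  + exact: gv_rho_meas.
  + exact: gdens_ge0.
  + exact: gv_rho_ge0.
refine (@GaussianVector R (1 + n) _ (measurableTypeR R * gv_type G)%type mm Z rho mZ mrho rho0 h1
  _ _).
- move=> c.
  have S p : expR (c * \sum_(i < 1 + n) `|Z p 0 i|) * rho p =
     (expR (c * `|p.1 : R|) * gdens p.1) *
     (expR (c * \sum_i `|gv_Z p.2 0 i|) * gv_rho p.2).
    rewrite big_split_ord/= big_ord1 /Z row_mxEl !mxE/= mulr1n.
    under eq_bigr do rewrite row_mxEr.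
    by rewrite mulrDr expRD /rho; ring.
  under eq_fun do rewrite S.
  have /integrableP[m1 i1] := gdens_exp_integrable c.
  have /integrableP[m2 i2] := gv_exp G c.
  have p1 z : 0 <= expR (c * `|z|) * gdens z.
    by apply: mulr_ge0; [exact: expR_ge0|exact: gdens_ge0].
  have p2 w : 0 <= expR (c * \sum_i `|gv_Z w 0 i|) * gv_rho w.
    by apply: mulr_ge0; [exact: expR_ge0|exact: gv_rho_ge0].
  apply/integrableP; split.
    apply/measurable_EFinP/measurable_funM.
      exact: (mfst (fun z => expR (c * `|z|) * gdens z) (iffLR (measurable_EFinP _ _) m1)).
    exact: (msnd (fun w => expR (c * \sum_i `|gv_Z w 0 i|) * gv_rho w)
      (iffLR (measurable_EFinP _ _) m2)).
  rewrite (eq_integral (fun p : measurableTypeR R * gv_type G => ((expR (c * `|p.1 : R|) * gdens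
    p.1) *
      (expR (c * \sum_i `|gv_Z p.2 0 i|) * gv_rho p.2))%:E)); last first.
    by move=> p _; rewrite gee0_abs// lee_fin; apply: mulr_ge0; [exact: p1|exact: p2].
  rewrite (prodint (fun z => expR (c * `|z|) * gdens z)
     (fun w => expR (c * \sum_i `|gv_Z w 0 i|) * gv_rho w))//; last 2 first.
  + exact/measurable_EFinP.
  + exact/measurable_EFinP.
  apply: lte_mul_pinfty.
  + by apply: integral_ge0 => z _; rewrite lee_fin.
  + rewrite ge0_fin_numE; last by apply: integral_ge0 => z _; rewrite lee_fin.
    rewrite (_ : integral _ _ _ = \int[mu]_z `|(expR (c * `|z : R|) * gdens z)%:E|)%E//.
    by apply: eq_integral => z _; rewrite gee0_abs// lee_fin; exact: p1.
  + rewrite (_ : integral _ _ _ =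
        \int[m]_w `|(expR (c * \sum_i `|gv_Z w 0 i|) * gv_rho w)%:E|)%E//.
    by apply: eq_integral => w _; rewrite gee0_abs// lee_fin; exact: p2.
- move=> f v cf f0.
  pose a := v 0 (lshift n ord0); pose v' : 'rV[R]_n := rsubmx (v : 'rV[R]_(1 + n)).
  have vE : v = row_mx (a%:M : 'rV[R]_1) v'.
    rewrite -[LHS](hsubmxK (v : 'rV[R]_(1 + n))); congr row_mx.
    by apply/rowP => i; rewrite (ord1 i) !mxE/= mulr1n.
  pose e1 (w : gv_type G) := expR (\sum_i v' 0 i * gv_Z w 0 i - (\sum_i v' 0 i ^+ 2) / 2).
  have me1 : measurable_fun setT e1.
    apply: measurableT_comp => //; apply: measurable_funB => //.
    by apply: measurable_sum => i; apply: measurable_funM => //; exact: gv_Z_meas.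
  have mfZ (b : R) (u : 'rV[R]_n) : measurable_fun setT
     (fun p : measurableTypeR R * gv_type G => f (row_mx (((p.1 : R) + b)%:M : 'rV[R]_1) (gv_Z
       p.2 + u))).
    apply: (@continuous_measurable_comp R _ _ (1 + n)
      (fun p : measurableTypeR R * gv_type G => row_mx (((p.1 : R) + b)%:M : 'rV[R]_1) (gv_Z p.2
        + u)) f) => //.
    move=> i; case: (split_ordP i) => k ->.
      rewrite (_ : (fun t => _) = (fun p : measurableTypeR R * gv_type G => (p.1 : R) + b)); last
        first.
        by apply/funext => p; rewrite row_mxEl (ord1 k) !mxE/= mulr1n.
      by apply: measurable_funD => //; exact: measurable_fst.
    rewrite (_ : (fun t => _) = (fun p : measurableTypeR R * gv_type G => gv_Z p.2 0 k + u 0 k));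
      last first.
      by apply/funext => p; rewrite row_mxEr mxE.
    by apply: measurable_funD => //; exact: (msnd (fun w => gv_Z w 0 k) (gv_Z_meas G k)).
  (* The last [n] coordinates are shifted first, in the inner integral, with the first coordinate
     frozen at [z + a]. *)
  transitivity (\int[mu]_z \int[m]_w
     (f (row_mx ((z + a)%:M : 'rV[R]_1) (gv_Z w)) * e1 w * (gdens z * gv_rho w))%:E)%E.
    rewrite fubini_tonelli1/=; last 2 first.
    - apply/measurable_EFinP/measurable_funM => //.
      have -> : (fun x => f (Z x + v)) = (fun p : measurableTypeR R * gv_type G =>
          f (row_mx (((p.1 : R) + a)%:M : 'rV[R]_1) (gv_Z p.2 + v'))).
        by apply/funext => p; rewrite /Z vE add_row_mx -raddfD.
      exact: mfZ.
    - by move=> p; rewrite lee_fin mulr_ge0.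
    apply: eq_integral => z _; rewrite /fubini_F/=.
    have := gv_shift G (fun y => f (row_mx ((z + a)%:M : 'rV[R]_1) y) * gdens z) v'.
    rewrite -/m => H.
    transitivity (\int[m]_w (f (row_mx ((z + a)%:M : 'rV[R]_1) (gv_Z w + v')) * gdens z * gv_rho
      w)%:E)%E.
      by apply: eq_integral => w _; rewrite /rho/= mulrA /Z vE add_row_mx -raddfD.
    rewrite H; last 2 first.
    - by apply: contM; [apply: cont_comp cf; exact: continuous_row_mxr|exact: cont_cst].
    - by move=> y; rewrite mulr_ge0 ?gdens_ge0.
    by apply: eq_integral => w _; congr EFin; rewrite /e1; ring.
  have mk (b : R) : measurable_fun setT (fun p : measurableTypeR R * gv_type G =>
      (f (row_mx (((p.1 : R) + b)%:M : 'rV[R]_1) (gv_Z p.2)) * e1 p.2 * (gdens p.1 * gv_rho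
        p.2))%:E).
    apply/measurable_EFinP/measurable_funM => //; apply: measurable_funM; last exact: (msnd e1 me1).
    by have := mfZ b 0; under eq_fun do rewrite addr0.
  have nk (b : R) (p : measurableTypeR R * gv_type G) : (0 <=
      (f (row_mx (((p.1 : R) + b)%:M : 'rV[R]_1) (gv_Z p.2)) * e1 p.2 * (gdens p.1 * gv_rho
        p.2))%:E)%E.
    rewrite lee_fin; apply: mulr_ge0; last exact: rho0.
    by repeat apply: mulr_ge0; rewrite ?f0 ?expR_ge0.
  rewrite (@fubini_tonelli _ _ _ _ _ mu m (fun p => (f (row_mx (((p.1 : R) + a)%:M : 'rV[R]_1)
    (gv_Z p.2)) * e1 p.2 * (gdens p.1 * gv_rho p.2))%:E))//.
  pose e2 (z : R) := expR (a * z - a ^+ 2 / 2).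
  (* After the exchange of integrals the first coordinate is the inner variable, and the
     one-dimensional shift by [a] produces its tilt [e2]. *)
  transitivity (\int[m]_w \int[mu]_z
     (f (row_mx (z%:M : 'rV[R]_1) (gv_Z w)) * e2 z * e1 w * (gdens z * gv_rho w))%:E)%E.
    apply: eq_integral => w _.
    have H := @gdens_shift R (fun z => f (row_mx (z%:M : 'rV[R]_1) (gv_Z w)) * (e1 w * gv_rho w)) a.
    transitivity (\int[mu]_z (f (row_mx ((z + a)%:M : 'rV[R]_1) (gv_Z w)) * (e1 w * gv_rho w) *
      gdens z)%:E)%E.
      by apply: eq_integral => z _; congr EFin => /=; ring.
    rewrite H; last 2 first.
    - by apply: contM; [apply: cont_comp cf; exact: continuous_row_mxl|exact: cont_cst].
    - by move=> z; apply: mulr_ge0 => //; apply: mulr_ge0; [exact: expR_ge0|exact: gv_rho_ge0].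
    by apply: eq_integral => z _; congr EFin; rewrite /e2; ring.
  have mk2 : measurable_fun setT (fun p : measurableTypeR R * gv_type G =>
      (f (row_mx ((p.1 : R)%:M : 'rV[R]_1) (gv_Z p.2)) * e2 p.1 * e1 p.2 * (gdens p.1 * gv_rho
        p.2))%:E).
    apply/measurable_EFinP/measurable_funM => //; apply: measurable_funM; last exact: (msnd e1 me1).
    apply: measurable_funM; first by have := mfZ 0 0; under eq_fun do rewrite !addr0.
    apply: (mfst e2); apply: measurableT_comp => //.
    by apply: measurable_funB => //; exact: measurable_funM.
  have nk2 (p : measurableTypeR R * gv_type G) : (0 <=
      (f (row_mx ((p.1 : R)%:M : 'rV[R]_1) (gv_Z p.2)) * e2 p.1 * e1 p.2 * (gdens p.1 * gv_rho
        p.2))%:E)%E.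
    rewrite lee_fin; apply: mulr_ge0; last exact: rho0.
    by repeat apply: mulr_ge0; rewrite ?f0 ?expR_ge0.
  transitivity (\int[mu \x m]_p (f (row_mx ((p.1 : R)%:M : 'rV[R]_1) (gv_Z p.2)) * e2 p.1 * e1
    p.2 * (gdens p.1 * gv_rho p.2))%:E)%E.
    by rewrite fubini_tonelli2.
  apply: eq_integral => p _; congr EFin; rewrite -/(rho p) -/(Z p) -!mulrA; congr (_ * _).
  rewrite mulrA; congr (_ * _); rewrite /e1 /e2 -expRD; congr expR.
  rewrite !big_split_ord/= !big_ord1 /Z !row_mxEl !mxE/= mulr1n -/a.
  under [in RHS]eq_bigr do rewrite row_mxEr.
  have -> : \sum_i v' 0 i * gv_Z p.2 0 i = \sum_i v 0 (rshift 1 i) * gv_Z p.2 0 i.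
    by apply: eq_bigr => i _; rewrite mxE.
  have -> : \sum_i v' 0 i ^+ 2 = \sum_i v 0 (rshift 1 i) ^+ 2.
    by apply: eq_bigr => i _; rewrite mxE.
  by field.
Qed.

Lemma gaussian_vector_exists n : inhabited (gaussian_vector R n).
Proof.
elim: n => [|n [G]]; first exact: gaussian_vector0.
by constructor; exact: gaussian_vectorS.
Qed.

End GaussianVectorExists.

(** * Gaussian averages and the heat semigroup *)

Section GaussianAverage.
Context (R : realType) (n : nat) (G : gaussian_vector R n).
Local Notation V := 'rV[R]_n.
Local Notation m := (gv_mu G).
Local Notation Z := (@gv_Z R n G).
Local Notation rho := (@gv_rho R n G).
Implicit Types (q : gv_type G -> R) (f : V -> R).

(** Common form of the heat semigroup and of its derivatives: [q0], [q1], [q2] are the density times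
    the Hermite polynomials of degree 0, 1, 2, and each derivative in [x] raises the degree at the
    cost of a factor [1/s]. *)
Definition Eg q f (s : R) (x : V) : R := \int[m]_w (f (x + s *: Z w) * q w).

Definition gS (w : gv_type G) : R := \sum_i `|Z w 0 i|.
Definition q0 (w : gv_type G) : R := rho w.
Definition q1 (j : 'I_n) (w : gv_type G) : R := Z w 0 j * rho w.
Definition q2 (i j : 'I_n) (w : gv_type G) : R :=
  (Z w 0 i * Z w 0 j - (i == j)%:R) * rho w.

Lemma gS_ge0 w : 0 <= gS w. Proof. by apply: sumr_ge0. Qed.

Lemma Z_le_gS w i : `|Z w 0 i| <= gS w.
Proof. by rewrite /gS (bigD1 i)//= lerDl sumr_ge0. Qed.

Lemma norm_Z_le_gS w : `|Z w| <= gS w.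
Proof.
rewrite [leLHS]/Num.Def.normr/= mx_normrE; apply/bigmax_leP; split; first exact: gS_ge0.
by move=> [i j] _ /=; rewrite (ord1 i); exact: Z_le_gS.
Qed.

Lemma gS_le_exp w : gS w <= expR (gS w).
Proof. by have := expR_ge1Dx (gS w); lra. Qed.

Lemma one_le_exp w : 1 <= expR (gS w).
Proof. by rewrite -expR0 ler_expR gS_ge0. Qed.

Lemma measurable_gS : measurable_fun setT gS.
Proof.
apply: measurable_sum => i; apply: measurableT_comp => //; exact: gv_Z_meas.
Qed.

Lemma measurable_avg f (s : R) (x : V) : continuous f ->
  measurable_fun setT (fun w => f (x + s *: Z w)).
Proof.
move=> cf; apply: (@continuous_measurable_comp R _ _ n (fun w => x + s *: Z w) f) => // i.
rewrite (_ : (fun t => _) = (fun w => x 0 i + s * Z w 0 i)).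
  by apply: measurable_funD => //; apply: measurable_funM => //; exact: gv_Z_meas.
by apply/funext => w; rewrite !mxE.
Qed.

Lemma exp_integrable q (C c : R) : measurable_fun setT q ->
  (forall w, `|q w| <= C * expR (c * gS w) * rho w) -> m.-integrable setT (EFin \o q).
Proof.
move=> mq qb; apply: (@dominated_integrableR _ _ _ m _ measurableT q
  (fun w => C * (expR (c * gS w) * rho w))) => //.
  rewrite /comp; under eq_fun do rewrite EFinM.
  by apply: integrableZl => //; exact: gv_exp.
by move=> w _; rewrite mulrA; exact: qb.
Qed.

Lemma q0_integrable : m.-integrable setT (EFin \o q0).
Proof.
apply: (@exp_integrable _ 1 0); first exact: gv_rho_meas.
by move=> w; rewrite mul0r expR0 !mul1r ger0_norm// gv_rho_ge0.
Qed.

Lemma measurable_q1 j : measurable_fun setT (q1 j).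
Proof. by apply: measurable_funM; [exact: gv_Z_meas|exact: gv_rho_meas]. Qed.

Lemma q1_integrable j : m.-integrable setT (EFin \o q1 j).
Proof.
apply: (@exp_integrable _ 1 1); first exact: measurable_q1.
move=> w; rewrite !mul1r normrM (ger0_norm (gv_rho_ge0 _ _)).
apply: ler_wpM2r; first exact: gv_rho_ge0.
by rewrite (le_trans (Z_le_gS _ _))// gS_le_exp.
Qed.

Lemma measurable_q2 i j : measurable_fun setT (q2 i j).
Proof.
apply: measurable_funM; last exact: gv_rho_meas.
by apply: measurable_funB => //; apply: measurable_funM; exact: gv_Z_meas.
Qed.

Lemma q2_bound i j w : `|q2 i j w| <= 2 * expR (2 * gS w) * rho w.
Proof.
rewrite /q2 normrM (ger0_norm (gv_rho_ge0 _ _)).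
apply: ler_wpM2r; first exact: gv_rho_ge0.
have -> : 2 * expR (2 * gS w) = expR (gS w) * expR (gS w) + expR (gS w) * expR (gS w).
  by rewrite -expRD -mulr2n mulr_natl mulr_natl.
apply: (le_trans (ler_normB _ _)); apply: lerD.
  by rewrite normrM; apply: ler_pM => //; rewrite (le_trans (Z_le_gS _ _))// gS_le_exp.
apply: (@le_trans _ _ 1); first by case: (i == j); rewrite ?normr1 ?normr0.
by rewrite -[leLHS]mulr1 ler_pM// one_le_exp.
Qed.

Lemma q2_integrable i j : m.-integrable setT (EFin \o q2 i j).
Proof. exact: exp_integrable (measurable_q2 i j) (q2_bound i j). Qed.

Lemma gS_q2_integrable i j : m.-integrable setT (EFin \o (fun w => gS w * `|q2 i j w|)).
Proof.
apply: (@exp_integrable _ 2 3).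
  apply: measurable_funM; first exact: measurable_gS.
  by apply: measurableT_comp => //; exact: measurable_q2.
move=> w; rewrite normrM (ger0_norm (gS_ge0 w)) normr_id.
have -> : 2 * expR (3 * gS w) * rho w = expR (gS w) * (2 * expR (2 * gS w) * rho w).
  have -> : 3 * gS w = gS w + 2 * gS w by ring.
  by rewrite expRD; move: (expR (gS w)) (expR (2 * gS w)) => a b; ring.
by apply: ler_pM => //; [exact: gS_ge0|exact: gS_le_exp|exact: q2_bound].
Qed.

Section Basic.
Variables (q : gv_type G -> R).
Hypothesis iq : m.-integrable setT (EFin \o q).

Let mq : measurable_fun setT q.
Proof. by have /integrableP[/measurable_EFinP] := iq. Qed.

Let inq : m.-integrable setT (EFin \o (fun w => `|q w|)).
Proof. exact: (integrable_norm iq). Qed.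

Lemma Eg_integrable f (M s : R) x : continuous f -> (forall z, `|f z| <= M) ->
  m.-integrable setT (EFin \o (fun w => f (x + s *: Z w) * q w)).
Proof.
move=> cf fM; apply: (@dominated_integrableR _ _ _ m _ measurableT _ (fun w => M * `|q w|)).
- by apply: measurable_funM => //; exact: measurable_avg.
- rewrite /comp; under eq_fun do rewrite EFinM.
  exact: integrableZl.
- by move=> w _; rewrite normrM; apply: ler_wpM2r.
Qed.

Lemma Eg_bound f (M s : R) x : continuous f -> (forall z, `|f z| <= M) ->
  `|Eg q f s x| <= M * \int[m]_w `|q w|.
Proof.
move=> cf fM; rewrite /Eg.
apply: (le_trans (le_normr_Rintegral measurableT (Eg_integrable s x cf fM))).
rewrite -RintegralZl//; apply: le_Rintegral => //.
- exact: (integrable_norm (Eg_integrable s x cf fM)).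
- rewrite /comp; under eq_fun do rewrite EFinM.
  exact: integrableZl.
- by move=> w _; rewrite normrM; apply: ler_wpM2r.
Qed.

Lemma EgB f g (M N s : R) x : continuous f -> (forall z, `|f z| <= M) ->
  continuous g -> (forall z, `|g z| <= N) ->
  Eg q (fun z => f z - g z) s x = Eg q f s x - Eg q g s x.
Proof.
move=> cf fM cg gN; rewrite /Eg -RintegralB//.
- by apply: eq_Rintegral => w _; rewrite mulrBl.
- exact: Eg_integrable cf fM.
- exact: Eg_integrable cg gN.
Qed.

Lemma Eg_translate f s x v : Eg q (fun z => f (z + v)) s x = Eg q f s (x + v).
Proof. by apply: eq_Rintegral => w _; rewrite addrAC. Qed.

Lemma Eg_continuous (X : pseudoMetricType R) (f : R -> V -> R) (M : R) (tau s : X -> R) (y : X ->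
  V) :
  continuous (fun p : R * V => f p.1 p.2) -> (forall t z, `|f t z| <= M) ->
  continuous tau -> continuous s -> continuous y ->
  continuous (fun a => Eg q (f (tau a)) (s a) (y a)).
Proof.
move=> cf fM ct cs cy a0.
have cft t : continuous (f t).
  by apply: (cont_uncurry cf); [exact: cont_cst|exact: cont_id].
apply: (@dominated_continuous_at R _ _ m setT measurableT X
  (fun a w => f (tau a) (y a + s a *: Z w) * q w) (fun w => M * `|q w|) a0).
- by move=> a; apply: measurable_funM => //; exact: measurable_avg.
- rewrite /comp; under eq_fun do rewrite EFinM.
  exact: integrableZl.
- by move=> a w _; rewrite normrM; apply: ler_wpM2r.
- move=> w _; move: a0; apply: contM; last exact: cont_cst.
  apply: (cont_uncurry cf) => //; apply: contD => //.
  by apply: contZ => //; exact: cont_cst.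
Qed.

Lemma Eg_derive f df (M N s : R) (x v : V) :
  continuous f -> continuous df -> (forall z, `|f z| <= M) -> (forall z, `|df z| <= N) ->
  (forall z, is_derive z v f (df z)) -> is_derive x v (Eg q f s) (Eg q df s x).
Proof.
move=> cf cdf fM dfN fd.
apply: (@dominated_is_derive R _ _ m setT V (fun z w => f (z + s *: Z w) * q w)
  (fun z w => df (z + s *: Z w) * q w) (fun w => N * `|q w|) x v measurableT).
- by move=> z; exact: Eg_integrable cf fM.
- rewrite /comp; under eq_fun do rewrite EFinM.
  exact: integrableZl.
- by move=> z w _; apply: is_derive_mulc; apply: is_derive_translate; exact: fd.
- by move=> z w _; rewrite normrM; apply: ler_wpM2r.
Qed.

End Basic.

Lemma Eg0 f x : Eg q0 f 0 x = f x.
Proof.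
rewrite /Eg; under eq_Rintegral do rewrite scale0r addr0.
rewrite RintegralZl//; last exact: q0_integrable.
by rewrite /Rintegral gv_mass mulr1.
Qed.

Lemma q0_mass : \int[m]_w `|q0 w| = 1.
Proof.
under eq_Rintegral do rewrite ger0_norm ?gv_rho_ge0//.
by rewrite /Rintegral gv_mass.
Qed.

Lemma dot_bound (v : V) w : `|\sum_i v 0 i * Z w 0 i| <= `|v| * gS w.
Proof.
rewrite /gS mulr_sumr (le_trans (ler_norm_sum _ _ _))//; apply: ler_sum => i _.
rewrite normrM; apply: ler_wpM2r => //.
rewrite [leRHS]/Num.Def.normr/= mx_normrE.
exact: (le_bigmax (0 : R) (fun i : 'I_1 * 'I_n => `|v i.1 i.2|) (0, i)).
Qed.

Lemma continuous_coord (i : 'I_n) : continuous (fun z : V => z 0 i).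
Proof. exact: coord_continuous. Qed.

Lemma continuous_sumnorm : continuous (fun z : V => \sum_i `|z 0 i|).
Proof.
by apply: cont_sum => i; apply: cont_norm; exact: continuous_coord.
Qed.

(** [gv_shift] covers nonnegative functions only. With [k] the exponential majorant of [f], it
    applies to [f + k] and to [k]; exponential moments make all terms finite, so the two identities
    may be subtracted. *)
Lemma gauss_shift f (A c : R) (v : V) : continuous f -> 0 <= c ->
  (forall z, `|f z| <= A * expR (c * \sum_i `|z 0 i|)) ->
  \int[m]_w (f (Z w + v) * rho w) =
  \int[m]_w (f (Z w) * expR (\sum_i v 0 i * Z w 0 i - (\sum_i v 0 i ^+ 2) / 2) * rho w).
Proof.
move=> cf c0 fb.
pose k (z : V) := A * expR (c * \sum_i `|z 0 i|).
have ck : continuous k.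
  apply: contM; first exact: cont_cst.
  by apply: cont_exp; apply: contM; [exact: cont_cst|exact: continuous_sumnorm].
have k0 z : 0 <= k z by rewrite (le_trans _ (fb z)).
have A0 : 0 <= A by have := k0 0; rewrite /k pmulr_lge0// expR_gt0.
pose e w := expR (\sum_i v 0 i * Z w 0 i - (\sum_i v 0 i ^+ 2) / 2).
have me : measurable_fun setT e.
  apply: measurableT_comp => //; apply: measurable_funB => //.
  by apply: measurable_sum => i; apply: measurable_funM => //; exact: gv_Z_meas.
have mZv (g : V -> R) : continuous g -> measurable_fun setT (fun w => g (Z w + v)).
  move=> cg; have := measurable_avg 1 v cg.
  by under eq_fun do rewrite scale1r addrC.
have mZ0 (g : V -> R) : continuous g -> measurable_fun setT (fun w => g (Z w)).
  move=> cg; have := measurable_avg 1 0 cg.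
  by under eq_fun do rewrite scale1r add0r.
have iL (g : V -> R) : continuous g -> (forall z, `|g z| <= k z) ->
    m.-integrable setT (EFin \o (fun w => g (Z w + v) * rho w)).
  move=> cg burgers_rhs; apply: (@exp_integrable _ (A * expR (c * \sum_i `|v 0 i|)) c).
    by apply: measurable_funM; [exact: mZv|exact: gv_rho_meas].
  move=> w; rewrite normrM (ger0_norm (gv_rho_ge0 _ _)).
  apply: ler_wpM2r; first exact: gv_rho_ge0.
  apply: (le_trans (burgers_rhs _)); rewrite /k -mulrA; apply: ler_wpM2l => //.
  rewrite -expRD ler_expR -mulrDr; apply: ler_wpM2l => //.
  rewrite /gS -big_split; apply: ler_sum => i _; rewrite mxE addrC.
  exact: ler_normD.
have iR (g : V -> R) : continuous g -> (forall z, `|g z| <= k z) ->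
    m.-integrable setT (EFin \o (fun w => g (Z w) * e w * rho w)).
  move=> cg burgers_rhs; apply: (@exp_integrable _ A (c + `|v|)).
    by apply: measurable_funM; [apply: measurable_funM => //; exact: mZ0|exact: gv_rho_meas].
  move=> w; rewrite !normrM (ger0_norm (gv_rho_ge0 _ _)) (ger0_norm (expR_ge0 _)).
  apply: ler_wpM2r; first exact: gv_rho_ge0.
  have -> : expR ((c + `|v|) * gS w) = expR (c * gS w) * expR (`|v| * gS w).
    by rewrite -expRD mulrDl.
  rewrite mulrA; apply: ler_pM => //.
  rewrite ler_expR (@le_trans _ _ (\sum_i v 0 i * Z w 0 i))//.
    by rewrite gerBl divr_ge0// sumr_ge0// => i _; exact: sqr_ge0.
  by rewrite (le_trans (ler_norm _))// dot_bound.
have pos (g : V -> R) : continuous g -> (forall z, 0 <= g z) ->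
    \int[m]_w (g (Z w + v) * rho w) = \int[m]_w (g (Z w) * e w * rho w).
  by move=> cg g0; rewrite /Rintegral gv_shift.
have kk z : `|k z| <= k z by rewrite ger0_norm.
pose g z := f z + k z.
have cg : continuous g by exact: contD.
have g0 z : 0 <= g z.
  by rewrite /g -lerBlDr sub0r; have := fb z; rewrite ler_norml => /andP[].
have := pos g cg g0.
have -> : \int[m]_w (g (Z w + v) * rho w) =
    \int[m]_w (f (Z w + v) * rho w) + \int[m]_w (k (Z w + v) * rho w).
  by rewrite -RintegralD//; [apply: eq_Rintegral => w _; rewrite mulrDl|exact: iL|exact: iL].
have -> : \int[m]_w (g (Z w) * e w * rho w) =
    \int[m]_w (f (Z w) * e w * rho w) + \int[m]_w (k (Z w) * e w * rho w).
  by rewrite -RintegralD//; [apply: eq_Rintegral => w _; rewrite !mulrDl|exact: iR|exact: iR].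
by rewrite (pos k ck k0) => /addIr.
Qed.

(** An affine weight contains both [q0] and [q1], so a single differentiation argument yields the
    first and the second derivative. *)
Definition qa (c0 c1 : R) (j : 'I_n) (w : gv_type G) : R := (c0 + c1 * Z w 0 j) * rho w.

Lemma is_derive_affexp (al be si ka a : R) :
  is_derive a (1 : R) (fun b : R => (al - b * be) * expR (b * si - b * b * ka))
    ((- be + (al - a * be) * (si - 2 * a * ka)) * expR (a * si - a * a * ka)).
Proof.
have d1 := isd_sub (isd_cst al a (1 : R)) (is_derive_mulc be (isd_id a)).
have d2 := isd_exp (isd_sub (is_derive_mulc si (isd_id a))
  (is_derive_mulc ka (isd_mul (isd_id a) (isd_id a)))).
apply: (isd_eq (isd_mul d1 d2)).
by move: (expR _) => E; ring.
Qed.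

(** Gaussian integration by parts without differentiating [f]. Displacing [x] by [a v] is displacing
    [Z] by [a v / s]; after the Cameron-Martin shift, [a] occurs only in a smooth weight, which is
    differentiated under the integral at [a = 0]. *)
Lemma Eg_gauss_derive f (M s : R) (x v : V) c0 c1 j : continuous f -> (forall z, `|f z| <= M) ->
  s != 0 ->
  is_derive x v (Eg (qa c0 c1 j) f s)
    (s^-1 * Eg (fun w => ((c0 + c1 * Z w 0 j) * (\sum_i v 0 i * Z w 0 i) - c1 * v 0 j) * rho w) f
      s x).
Proof.
move=> cf fM s0.
pose v' := s^-1 *: v.
pose ka := (\sum_i v' 0 i ^+ 2) / 2.
pose be := c1 * v' 0 j.
pose si w := \sum_i v' 0 i * Z w 0 i.
pose al w := c0 + c1 * Z w 0 j.
have M0 : 0 <= M by rewrite (le_trans _ (fM 0)).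
have ka0 : 0 <= ka by rewrite divr_ge0// sumr_ge0// => i _; exact: sqr_ge0.
pose A1 : R := `|c0| + `|c1| + `|be|.
have msi : measurable_fun setT si.
  by apply: measurable_sum => i; apply: measurable_funM => //; exact: gv_Z_meas.
have mal : measurable_fun setT al.
  by apply: measurable_funD => //; apply: measurable_funM => //; exact: gv_Z_meas.
have bal w : `|al w| + `|be| <= A1 * expR (gS w).
  rewrite /A1 !mulrDl; apply: lerD; last by rewrite ler_peMr// one_le_exp.
  rewrite (le_trans (ler_normD _ _))// lerD//; first by rewrite ler_peMr// one_le_exp.
  by rewrite normrM ler_wpM2l// (le_trans (Z_le_gS _ _))// gS_le_exp.
have bsi w : `|si w| <= `|v'| * gS w by exact: dot_bound.
(* Integrand after the shift: the affine weight is now evaluated at [Z - a v'], which gives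
   [al - a * be], and the exponential is the Cameron-Martin density. *)
pose k (a : R) w := f (x + s *: Z w) * ((al w - a * be) * expR (a * si w - a * a * ka)) * rho w.
pose dk (a : R) w := f (x + s *: Z w) *
  ((- be + (al w - a * be) * (si w - 2 * a * ka)) * expR (a * si w - a * a * ka)) * rho w.
have mE a : measurable_fun setT (fun w => expR (a * si w - a * a * ka)).
  apply: measurableT_comp => //; apply: measurable_funB => //.
  exact: measurable_funM.
have mk a : measurable_fun setT (k a).
  apply: measurable_funM; last exact: gv_rho_meas.
  apply: measurable_funM; first exact: measurable_avg.
  by apply: measurable_funM => //; exact: measurable_funB.
have bE (a : R) w : `|a| < 1 -> expR (a * si w - a * a * ka) <= expR (`|v'| * gS w).
  move=> a1; rewrite ler_expR.
  have : a * si w <= `|v'| * gS w.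
    rewrite (le_trans (ler_norm _))// normrM (le_trans _ (bsi w))// ler_piMl// ltW//.
  have : 0 <= a * a * ka by rewrite mulr_ge0// -expr2 sqr_ge0.
  lra.
have baf (a : R) w : `|a| < 1 -> `|al w - a * be| <= A1 * expR (gS w).
  move=> a1; rewrite (le_trans (ler_normB _ _))// (le_trans _ (bal w))// lerD2l normrM.
  by rewrite ler_piMl// ltW.
have ik (a : R) : `|a| < 1 -> m.-integrable setT (EFin \o k a).
  move=> a1; apply: (@exp_integrable _ (M * A1) (1 + `|v'|)) => // w.
  rewrite !normrM (ger0_norm (gv_rho_ge0 _ _)) (ger0_norm (expR_ge0 _)).
  apply: ler_wpM2r; first exact: gv_rho_ge0.
  rewrite -(mulrA M); apply: ler_pM => //.
  have -> : expR ((1 + `|v'|) * gS w) = expR (gS w) * expR (`|v'| * gS w).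
    by rewrite -expRD mulrDl mul1r.
  rewrite mulrA; apply: ler_pM => //.
    exact: baf.
  exact: bE.
pose C2 := M * (`|be| + A1 * (`|v'| + 2 * ka)).
have A10 : 0 <= A1 by rewrite !addr_ge0.
have bdk (a : R) w : `|a| < 1 -> `|dk a w| <= C2 * (expR ((2 + `|v'|) * gS w) * rho w).
  move=> a1; rewrite !normrM (ger0_norm (gv_rho_ge0 _ _)) (ger0_norm (expR_ge0 _)) [leRHS]mulrA.
  apply: ler_wpM2r; first exact: gv_rho_ge0.
  rewrite /C2 -(mulrA M); apply: ler_pM => //.
  have -> : expR ((2 + `|v'|) * gS w) = expR (2 * gS w) * expR (`|v'| * gS w).
    by rewrite -expRD mulrDl.
  rewrite mulrA; apply: ler_pM => //.
    have -> : expR (2 * gS w) = expR (gS w) * expR (gS w).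
      by rewrite -expRD -mulr2n mulr_natl.
    have e1 := one_le_exp w.
    have e0 : 0 <= expR (gS w) by exact: expR_ge0.
    apply: (le_trans (ler_normD _ _)); rewrite normrN [leRHS]mulrDl; apply: lerD.
      by rewrite -[leLHS]mulr1 ler_wpM2l// -[leLHS]mulr1 ler_pM.
    rewrite normrM (_ : A1 * _ * _ = (A1 * expR (gS w)) * ((`|v'| + 2 * ka) * expR (gS w))); last
      by ring.
    apply: ler_pM => //; first exact: baf.
    apply: (le_trans (ler_normB _ _)); rewrite [leRHS]mulrDl; apply: lerD.
      by rewrite (le_trans (bsi w))// ler_wpM2l// gS_le_exp.
    rewrite normrM (ger0_norm ka0) normrM (@ger0_norm _ 2)//.
    have h : 2 * `|a| * ka <= 2 * ka by rewrite -mulrA ler_wpM2l// ler_piMl// ltW.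
    by rewrite (le_trans h)// ler_peMr// mulr_ge0.
  exact: bE.
have dkd a w : is_derive a (1 : R) (k^~ w) (dk a w).
  rewrite /k /dk; apply: is_derive_mulc.
  have := is_derive_mulc (f (x + s *: Z w)) (is_derive_affexp (al w) be (si w) ka a).
  rewrite (mulrC (f _)) (_ : (fun z => _ * f _) = (fun b : R => f (x + s *: Z w) *
     ((al w - b * be) * expR (b * si w - b * b * ka))))//.
  by apply/funext => b; rewrite mulrC.
have Hd := @dominated_is_derive0 R _ _ m setT k dk
  (fun w => C2 * (expR ((2 + `|v'|) * gS w) * rho w)) measurableT ik.
apply/is_derive_line.
have E1 (a : R) : `|a| < 1 -> Eg (qa c0 c1 j) f s (a *: v + x) = \int[m]_w k a w.
  move=> a1; pose F (z : V) := f (x + s *: z) * (c0 + c1 * (z 0 j - a * v' 0 j)).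
  transitivity (\int[m]_w (F (Z w + a *: v') * rho w)).
    apply: eq_Rintegral => w _; rewrite /F /qa mulrA !mxE addrK; congr (f _ * _ * _).
    have -> : s *: (Z w + a *: v') = s *: Z w + a *: v.
      by rewrite scalerDr /v' !scalerA; congr (_ + _ *: _); field.
    by rewrite (addrC (a *: v)) -addrA (addrC (a *: v)).
  rewrite (@gauss_shift F (M * A1) 1).
  - apply: eq_Rintegral => w _; rewrite /F /k /al /be /si /ka -!mulrA; congr (_ * _).
    rewrite !mulrA; congr (_ * expR _ * _); first by ring.
    congr (_ - _).
      by rewrite mulr_sumr; apply: eq_bigr => i _; rewrite mxE mulrA.
    by rewrite mulr_sumr; congr (_ / _); apply: eq_bigr => i _; rewrite mxE exprMn expr2.
  - apply: contM.
      apply: cont_comp cf; apply: contD; first exact: cont_cst.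
      by apply: contZ; [exact: cont_cst|exact: cont_id].
    apply: contD; first exact: cont_cst.
    apply: contM; first exact: cont_cst.
    by apply: contB; [exact: continuous_coord|exact: cont_cst].
  - by [].
  - move=> z; rewrite /F normrM mul1r -mulrA; apply: ler_pM => //.
    have S0 : 0 <= \sum_i `|z 0 i| by exact: sumr_ge0.
    have zj : `|z 0 j| <= \sum_i `|z 0 i| by rewrite (bigD1 j)//= lerDl sumr_ge0.
    have e1 : 1 + \sum_i `|z 0 i| <= expR (\sum_i `|z 0 i|) by exact: expR_ge1Dx.
    move: (expR _) e1 => E e1.
    rewrite (_ : _ + _ = c0 + c1 * z 0 j - a * be); last by rewrite /be; ring.
    rewrite (le_trans (ler_normB _ _))// /A1 mulrDl; apply: lerD.
      rewrite (le_trans (ler_normD _ _))// mulrDl; apply: lerD.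
        by rewrite ler_peMr//; lra.
      by rewrite normrM ler_wpM2l//; lra.
    rewrite normrM (@le_trans _ _ `|be|)// ?ler_piMl// ?(ltW a1)// ler_peMr//; lra.
have dk0 w : dk 0 w = s^-1 * (f (x + s *: Z w) *
    (((c0 + c1 * Z w 0 j) * (\sum_i v 0 i * Z w 0 i) - c1 * v 0 j) * rho w)).
  rewrite /dk (_ : 0 * si w - 0 * 0 * ka = 0); last by ring.
  have -> : si w = s^-1 * (\sum_i v 0 i * Z w 0 i).
    by rewrite /si mulr_sumr; apply: eq_bigr => i _; rewrite mxE mulrA.
  by rewrite expR0 /be /al mxE; ring.
have E2 : \int[m]_w dk 0 w =
    s^-1 * Eg (fun w => ((c0 + c1 * Z w 0 j) * (\sum_i v 0 i * Z w 0 i) - c1 * v 0 j) * rho w) f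
      s x.
  rewrite /Eg -RintegralZl//.
    by apply: eq_Rintegral => w _; exact: dk0.
  apply: (@dominated_integrableR _ _ _ m _ measurableT _
    (fun w => `|s| * (C2 * (expR ((2 + `|v'|) * gS w) * rho w)))).
  - apply: measurable_funM; first exact: measurable_avg.
    apply: measurable_funM; last exact: gv_rho_meas.
    apply: measurable_funB => //; apply: measurable_funM => //.
    by apply: measurable_sum => i; apply: measurable_funM => //; exact: gv_Z_meas.
  - rewrite /comp; under eq_fun do rewrite EFinM.
    apply: integrableZl => //; under eq_fun do rewrite EFinM.
    by apply: integrableZl => //; exact: gv_exp.
  - move=> w _; have /(_ w) := bdk 0 _ _; rewrite normr0 => /(_ ltr01) h.
    apply: le_trans (ler_wpM2l (normr_ge0 s) h).
    by rewrite -[leRHS]normrM dk0 mulVKf.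
rewrite -E2.
have Hk : is_derive (0 : R) (1 : R) (fun a => \int[m]_w k a w) (\int[m]_w dk 0 w).
  apply: Hd => //.
  - rewrite /comp; under eq_fun do rewrite EFinM.
    by apply: integrableZl => //; exact: gv_exp.
  - by move=> a w a1 _; exact: bdk.
have NE : \forall a \near (0 : R), \int[m]_w k a w = Eg (qa c0 c1 j) f s (a *: v + x).
  near=> a; rewrite E1//.
exact: (near_eq_is_derive NE Hk).
Unshelve. all: by end_near. Qed.

Lemma ebaseE (i j : 'I_n) : ebase R i 0 j = (i == j)%:R.
Proof. by rewrite /ebase mxE eqxx/= eq_sym. Qed.

Lemma dot_ebase (i : 'I_n) (z : V) : \sum_k ebase R i 0 k * z 0 k = z 0 i.
Proof.
rewrite (bigD1 i)//= ebaseE eqxx mul1r big1 ?addr0// => k ki.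
by rewrite ebaseE eq_sym (negbTE ki) mul0r.
Qed.

Lemma Eg_q0_derive f (M s : R) (x v : V) : continuous f -> (forall z, `|f z| <= M) -> s != 0 ->
  is_derive x v (Eg q0 f s)
    (s^-1 * Eg (fun w => (\sum_i v 0 i * Z w 0 i) * rho w) f s x).
Proof.
(* The weight [qa] needs some coordinate [j]; if there is none, the dimension is 0 and the direction
   [v] vanishes. *)
move=> cf fM s0; case: (pickP (fun _ : 'I_n => true)) => [j _|no].
  have H := @Eg_gauss_derive f M s x v 1 0 j cf fM s0.
  have E : Eg (qa 1 0 j) f s = Eg q0 f s.
    apply/funext => y; apply: eq_Rintegral => w _.
    by rewrite /qa /q0 mul0r addr0 mul1r.
  rewrite E in H; apply: (isd_eq H); congr (_ * _).
  by apply: eq_Rintegral => w _; rewrite !mul0r addr0 mul1r subr0.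
have -> : v = 0 by apply/rowP => i; have := no i.
apply: (isd_eq (is_derive0 _ _)).
rewrite (_ : Eg _ f s x = 0) ?mulr0//.
rewrite /Eg (_ : (fun w => _) = (fun=> 0)).
  by rewrite Rintegral_cst// mul0r.
by apply/funext => w; rewrite big1 ?mul0r ?mulr0// => i; have := no i.
Qed.

Lemma Eg_q0_derive_e f (M s : R) (x : V) i : continuous f -> (forall z, `|f z| <= M) -> s != 0 ->
  is_derive x (ebase R i) (Eg q0 f s) (s^-1 * Eg (q1 i) f s x).
Proof.
move=> cf fM s0; apply: (isd_eq (Eg_q0_derive x (ebase R i) cf fM s0)).
by congr (_ * _); apply: eq_Rintegral => w _; rewrite dot_ebase.
Qed.

Lemma Eg_q1_derive f (M s : R) (x : V) i j :
  continuous f -> (forall z, `|f z| <= M) -> s != 0 ->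
  is_derive x (ebase R i) (Eg (q1 j) f s) (s^-1 * Eg (q2 i j) f s x).
Proof.
move=> cf fM s0; have H := @Eg_gauss_derive f M s x (ebase R i) 0 1 j cf fM s0.
have E : Eg (qa 0 1 j) f s = Eg (q1 j) f s.
  by apply/funext => y; apply: eq_Rintegral => w _; rewrite /qa /q1 mul1r add0r.
rewrite E in H; apply: (isd_eq H); congr (_ * _).
by apply: eq_Rintegral => w _; rewrite dot_ebase ebaseE !mul1r add0r (mulrC (Z w 0 j)).
Qed.

(** For [f = 1] the function [Eg (q1 j) f 1] does not depend on the point, and its derivative is the
    mean of [q2 i j]. *)
Lemma q2_mean0 i j : \int[m]_w q2 i j w = 0.
Proof.
have c1 : continuous (fun _ : V => 1 : R) by exact: cont_cst.
have b1 (z : V) : `|1 : R| <= 1 by rewrite normr1.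
have H := @Eg_q1_derive (fun _ => 1) 1 1 0 i j c1 b1 (oner_neq0 _).
have H2 : is_derive (0 : V) (ebase R i) (Eg (q1 j) (fun _ => 1) 1) 0.
  rewrite (_ : Eg _ _ _ = fun _ => \int[m]_w (1 * q1 j w)); last exact/funext.
  exact: is_derive_cst.
have : 1^-1 * Eg (q2 i j) (fun _ => 1) 1 0 = 0.
  by have [_ <-] := H; have [_ ->] := H2.
rewrite invr1 mul1r => <-.
by apply: eq_Rintegral => w _; rewrite mul1r.
Qed.

Definition gm2 (i j : 'I_n) : R := \int[m]_w (gS w * `|q2 i j w|).

Lemma gm2_ge0 i j : 0 <= gm2 i j.
Proof. by apply: Rintegral_ge0 => w _; rewrite mulr_ge0// gS_ge0. Qed.

(** Since [q2] has mean zero, [f x] may be subtracted from [f], and the increment gains a factor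
    [|s|]. That factor compensates one of the two powers of [1/s] in a second derivative. *)
Lemma Eg_q2_lip f (M L s : R) (x : V) i j : continuous f -> (forall z, `|f z| <= M) ->
  0 <= L -> (forall y z, `|f (y + z) - f y| <= L * `|z|) ->
  `|Eg (q2 i j) f s x| <= L * `|s| * gm2 i j.
Proof.
move=> cf fM L0 fL.
have i2 := q2_integrable i j.
have -> : Eg (q2 i j) f s x = \int[m]_w ((f (x + s *: Z w) - f x) * q2 i j w).
  rewrite -[LHS]subr0 -[X in _ - X](mulr0 (f x)) -(q2_mean0 i j) -RintegralZl//.
  rewrite /Eg -RintegralB//; first by apply: eq_Rintegral => w _; rewrite mulrBl.
    exact: (Eg_integrable i2 s x cf fM).
  rewrite /comp; under eq_fun do rewrite EFinM.
  exact: integrableZl.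
have iL : m.-integrable setT (EFin \o (fun w => L * `|s| * (gS w * `|q2 i j w|))).
  rewrite /comp; under eq_fun do rewrite EFinM.
  by apply: integrableZl => //; exact: gS_q2_integrable.
have bd w : `|(f (x + s *: Z w) - f x) * q2 i j w| <= L * `|s| * (gS w * `|q2 i j w|).
  rewrite normrM mulrA; apply: ler_wpM2r => //.
  by rewrite (le_trans (fL _ _))// normrZ -mulrA ler_wpM2l// ler_wpM2l// norm_Z_le_gS.
have i1 : m.-integrable setT (EFin \o (fun w => (f (x + s *: Z w) - f x) * q2 i j w)).
  apply: (@dominated_integrableR _ _ _ m _ measurableT _ _ _ iL) => //.
  apply: measurable_funM; last exact: measurable_q2.
  by apply: measurable_funB => //; exact: measurable_avg.
apply: (le_trans (le_normr_Rintegral measurableT i1)).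
rewrite /gm2 -RintegralZl//; last exact: gS_q2_integrable.
by apply: le_Rintegral => //; exact: (integrable_norm i1).
Qed.

(** A derivative of the average may fall on [f] or on the Gaussian weight. Uniqueness of derivatives
    equates the two expressions, once for each order. *)
Lemma Eg_D2 (f f1 f2 : V -> R) (M : R) i (s : R) (x : V) : s != 0 ->
  continuous f -> (forall z, `|f z| <= M) -> continuous f1 -> (forall z, `|f1 z| <= M) ->
  continuous f2 -> (forall z, `|f2 z| <= M) ->
  (forall z, is_derive z (ebase R i) f (f1 z)) -> (forall z, is_derive z (ebase R i) f1 (f2 z)) ->
  Eg q0 f2 s x = s^-1 * (s^-1 * Eg (q2 i i) f s x).
Proof.
move=> s0 cf fM cf1 f1M cf2 f2M d1 d2.
have A y : Eg q0 f1 s y = s^-1 * Eg (q1 i) f s y.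
  have [_ <-] := Eg_derive q0_integrable s y cf cf1 fM f1M d1.
  by have [_ ->] := Eg_q0_derive_e y i cf fM s0.
have [_ <-] := Eg_derive q0_integrable s x cf1 cf2 f1M f2M d2.
have -> : Eg q0 f1 s = (fun y => Eg (q1 i) f s y * s^-1).
  by apply/funext => y; rewrite A mulrC.
have [_ ->] := is_derive_mulc s^-1 (Eg_q1_derive x i i cf fM s0).
by rewrite mulrC.
Qed.

Lemma Eg_cvg q (k_ : nat -> V -> R) (k : V -> R) (N s : R) x : m.-integrable setT (EFin \o q) ->
  (forall l, continuous (k_ l)) -> (forall l z, `|k_ l z| <= N) ->
  (forall z, k_ l z @[l --> \oo] --> k z) ->
  Eg q (k_ l) s x @[l --> \oo] --> Eg q k s x.
Proof.
move=> iq ck kN kk.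
have mq : measurable_fun setT q by have /integrableP[/measurable_EFinP] := iq.
apply: (@Rintegral_dominated_cvg _ _ _ m setT measurableT _ _ (fun w => N * `|q w|)).
- by move=> l; apply: measurable_funM => //; exact: measurable_avg.
- by apply: integrable_scale => //; exact: (integrable_norm iq).
- by move=> l w _; rewrite normrM; apply: ler_wpM2r.
- by move=> w _; apply: cvgM; [exact: kk|exact: cvg_cst].
Qed.

Section Heat.
Variables (f : V -> R) (D1 : 'I_n -> V -> R) (D2 : 'I_n -> 'I_n -> V -> R) (M : R).
Hypotheses (cf : continuous f) (fM : forall z, `|f z| <= M).
Hypotheses (cD1 : forall i, continuous (D1 i)) (D1M : forall i z, `|D1 i z| <= M).
Hypotheses (cD2 : forall i j, continuous (D2 i j)) (D2M : forall i j z, `|D2 i j z| <= M).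
Hypothesis (fD1 : forall z v, is_derive z v f (\sum_i v 0 i * D1 i z)).
Hypothesis (fD2 : forall i j z, is_derive z (ebase R i) (D1 j) (D2 i j z)).

(** Differentiating in [s] gives the average of [Z] against the gradient at [x + s Z]; integration
    by parts in each coordinate turns a factor [Z_i] into [s] times a further derivative in
    direction [i]. *)
Lemma Eg_heat s x : s != 0 ->
  is_derive s (1 : R) (fun b : R => Eg q0 f b x) (s * \sum_i Eg q0 (D2 i i) s x).
Proof.
move=> s0.
have M0 : 0 <= M by rewrite (le_trans _ (fM 0)).
pose df (b : R) w := (\sum_i Z w 0 i * D1 i (x + b *: Z w)) * q0 w.
have H : is_derive s (1 : R) (fun b : R => Eg q0 f b x) (\int[m]_w df s w).
  apply: (@dominated_is_derive R _ _ m setT R (fun b w => f (x + b *: Z w) * q0 w)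
    df (fun w => M * (gS w * rho w)) s 1 measurableT).
  - by move=> b; exact: (Eg_integrable q0_integrable b x cf fM).
  - apply: (@exp_integrable _ M 1).
      apply: measurable_funM => //; apply: measurable_funM; first exact: measurable_gS.
      exact: gv_rho_meas.
    move=> w; rewrite mul1r !normrM (ger0_norm M0) (ger0_norm (gS_ge0 _)).
    rewrite (ger0_norm (gv_rho_ge0 _ _)) mulrA; apply: ler_wpM2r; first exact: gv_rho_ge0.
    by apply: ler_wpM2l => //; exact: gS_le_exp.
  - move=> b w _; apply: is_derive_mulc.
    rewrite (_ : (fun z => _) = (fun b : R => f (b *: Z w + x))); last first.
      by apply/funext => c; rewrite addrC.
    apply: is_derive_line_at; rewrite addrC; exact: fD1.
  - move=> b w _; rewrite /df normrM /q0 (ger0_norm (gv_rho_ge0 _ _)) mulrA.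
    apply: ler_wpM2r; first exact: gv_rho_ge0.
    rewrite (le_trans (ler_norm_sum _ _ _))// /gS mulr_sumr; apply: ler_sum => i _.
    by rewrite normrM mulrC; apply: ler_wpM2r.
apply: (isd_eq H); rewrite mulr_sumr.
transitivity (\sum_i Eg (q1 i) (D1 i) s x).
  rewrite /Eg -(@Rintegral_sum_ord _ _ _ _ _ _ (fun i w => D1 i (x + s *: Z w) * q1 i w))//.
    by apply: eq_Rintegral => w _; rewrite /df mulr_suml; apply: eq_bigr => i _; rewrite /q0 /q1;
      ring.
  by move=> i; exact: (Eg_integrable (q1_integrable i) s x (@cD1 i) (D1M i)).
apply: eq_bigr => i _.
have [_ <-] := Eg_derive q0_integrable s x (@cD1 i) (@cD2 i i) (D1M i) (D2M i i) (fD2 i i).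
have [_ ->] := Eg_q0_derive_e x i (@cD1 i) (D1M i) s0.
by rewrite mulrA mulfV// mul1r.
Qed.

End Heat.

End GaussianAverage.

(** * Duhamel operators *)

Section FTC.
Context (R : realType).
Local Notation leb := (@lebesgue_measure R).
Local Notation I01 := (`](0 : R), (1 : R)]%classic : set R).

Lemma I01_subset : I01 `<=` (`[(0 : R), (1 : R)]%classic : set R).
Proof. by move=> u /=; rewrite !in_itv/= => /andP[/ltW -> ->]. Qed.

Lemma FTC_Rintegral (F f : R -> R) (a b : R) : a <= b ->
  (forall u, a <= u <= b -> {for u, continuous F}) ->
  (forall u, a <= u <= b -> {for u, continuous f}) ->
  (forall u, a < u < b -> is_derive u (1 : R) F (f u)) ->
  \int[leb]_(u in `[a, b]) f u = F b - F a.
Proof.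
rewrite le_eqVlt => /predU1P[->|ab] cF cf dF.
  by rewrite set_itv1 Rintegral_set1 subrr.
rewrite /Rintegral (@continuous_FTC2 R f F a b)//.
- apply: continuous_in_subspaceT => u; rewrite inE/= in_itv/=; exact: cf.
- split.
  + by move=> u; rewrite in_itv/= => /dF[].
  + by apply: cvg_at_right_filter; apply: cF; rewrite lexx ltW.
  + by apply: cvg_at_left_filter; apply: cF; rewrite lexx ltW.
- by move=> u; rewrite in_itv/= => /dF[_ <-]; rewrite derive1E.
Qed.

Lemma continuous_itv_integrable (f : R -> R) (a b : R) :
  (forall u, a <= u <= b -> {for u, continuous f}) ->
  leb.-integrable `[a, b] (EFin \o f).
Proof.
move=> cf; apply: continuous_compact_integrable; first exact: segment_compact.
by apply: continuous_in_subspaceT => u; rewrite inE/= in_itv/=; exact: cf.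
Qed.

Lemma cst01_integrable (c : R) : leb.-integrable `]0, 1] (EFin \o (fun _ : R => c)).
Proof.
apply: (@integrableS _ _ _ leb `[0%R, 1%R]) => //.
  exact: I01_subset.
by apply: continuous_itv_integrable => u _; exact: cvg_cst.
Qed.

Lemma bounded01_integrable (f : R -> R) (C : R) : measurable_fun I01 f ->
  (forall u, 0 < u <= 1 -> `|f u| <= C) -> leb.-integrable `]0, 1] (EFin \o f).
Proof.
move=> mf fC; apply: (@dominated_integrableR R _ _ leb _ _ f (fun _ => C)) => //.
  exact: cst01_integrable.
Qed.

Lemma bounded01_Rintegral (f : R -> R) (C : R) : measurable_fun I01 f ->
  (forall u, 0 < u <= 1 -> `|f u| <= C) -> `|\int[leb]_(u in `]0, 1]) f u| <= C.
Proof.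
move=> mf fC; have fi := bounded01_integrable mf fC.
apply: (le_trans (le_normr_Rintegral _ fi)) => //.
have -> : C = \int[leb]_(u in `]0, 1]) C.
  by rewrite Rintegral_cst//= lebesgue_measure_itv/= lte_fin ltr01 oppr0 adde0 mulr1.
apply: le_Rintegral => //.
- exact: (integrable_norm fi).
- exact: cst01_integrable.
Qed.

(** What is left of the time weight [expR (la * s)], relative to [expR (la * t)], after the
    substitution [s = t (1 - u^2)]. *)
Definition expw (la t : R) : R := \int[leb]_(u in `]0, 1]) expR (- (la * t * u ^+ 2)).

Lemma cont_expw_int (la t : R) : continuous (fun u : R => expR (- (la * t * u ^+ 2))).
Proof.
apply: cont_exp; apply: contN; apply: contM; first exact: cont_cst.
by apply: contM; exact: cont_id.
Qed.

(** With [c = Num.sqrt (la * t)], one has [exp(-c^2 u^2) <= 1/(1 + c^2 u^2) <= 2/(1 + c u)^2], and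
    the last function has the primitive [2 u / (1 + c u)]. The decay in [la] obtained here is the
    source of the contraction. *)
Lemma expw_bound (la t : R) : 0 < la -> 0 <= t -> Num.sqrt t * expw la t <= 2 / Num.sqrt la.
Proof.
move=> la0 t0; pose c : R := Num.sqrt (la * t).
have c0 : 0 <= c by exact: sqrtr_ge0.
have cc : c ^+ 2 = la * t by rewrite sqr_sqrtr// mulr_ge0// ltW.
pose F (u : R) : R := (2 * u) * (1 + c * u)^-1.
pose f (u : R) : R := 2 * (1 + c * u)^-1 * (1 + c * u)^-1.
have p0 u : 0 <= u -> 0 < 1 + c * u by move=> u0; have := mulr_ge0 c0 u0; lra.
have ci (u : R) : 0 <= u -> {for u, continuous (fun u : R => (1 + c * u)^-1)}.
  move=> u0; apply: cvgV; first by rewrite gt_eqF// p0.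
  by apply: contD; [exact: cont_cst|apply: contM; [exact: cont_cst|exact: cont_id]].
have cf (u : R) : 0 <= u <= 1 -> {for u, continuous f}.
  move=> /andP[u0 _]; apply: cvgM; last exact: ci.
  by apply: cvgM; [exact: cvg_cst|exact: ci].
have c2 : continuous (fun u : R => 2 * u) by apply: contM; [exact: cont_cst|exact: cont_id].
have cF (u : R) : 0 <= u <= 1 -> {for u, continuous F}.
  move=> /andP[u0 _]; apply: cvgM; last exact: ci.
  exact: c2.
have dF (u : R) : 0 < u < 1 -> is_derive u (1 : R) F (f u).
  move=> /andP[u0 _]; have pu := p0 u (ltW u0).
  have d1 : is_derive u (1 : R) (fun u : R => 1 + c * u) c.
    rewrite (_ : (fun u : R => 1 + c * u) = (fun z : R => 1 + z * c)); last first.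
      by apply/funext => z; rewrite mulrC.
    have H := isd_add (isd_cst 1 u (1 : R)) (is_derive_mulc c (isd_id u)).
    by apply: (isd_eq H); ring.
  have d2 : is_derive u (1 : R) (fun u : R => (1 + c * u)^-1) (- (1 + c * u) ^- 2 *: c).
    by apply: is_deriveV => //; rewrite gt_eqF.
  have d3 : is_derive u (1 : R) (fun u : R => 2 * u) 2.
    rewrite (_ : (fun u : R => 2 * u) = (fun z : R => z * 2)); last first.
      by apply/funext => z; rewrite mulrC.
    by apply: (isd_eq (is_derive_mulc 2 (isd_id u))); ring.
  apply: (isd_eq (isd_mul d3 d2)); rewrite /f /GRing.scale/=.
  by field; rewrite gt_eqF.
have H := FTC_Rintegral ler01 cF cf dF.
have if_ := continuous_itv_integrable cf.
have sub : `]0%R, 1%R]%classic `<=` (`[0%R, 1%R]%classic : set R) by exact: I01_subset.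
have if2 : leb.-integrable `]0, 1] (EFin \o f) by apply: (@integrableS _ _ _ leb `[0%R, 1%R]).
have le1 : expw la t <= F 1.
  have -> : F 1 = \int[leb]_(u in `]0, 1]) f u.
    by rewrite Rintegral_itv_obnd_cbnd// H /F mulr0 mul0r subr0.
  apply: le_Rintegral => //.
    apply: (@integrableS _ _ _ leb `[0%R, 1%R]) => //.
    by apply: continuous_itv_integrable => u _; exact: cont_expw_int.
  move=> u /=; rewrite in_itv/= => /andP[u0 _]; have pu := p0 u (ltW u0).
  rewrite expRN -cc /f -mulrA -invfM.
  rewrite -[leLHS]mul1r ler_pdivrMr ?expR_gt0// mulrAC ler_pdivlMr ?mulr_gt0// mul1r.
  have := expR_ge1Dx (c ^+ 2 * u ^+ 2); have := sqr_ge0 (1 - c * u).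
  move: (expR _) => E; nra.
apply: (@le_trans _ _ (Num.sqrt t * F 1)); first by rewrite ler_wpM2l ?sqrtr_ge0.
have cE : c = Num.sqrt la * Num.sqrt t by rewrite /c sqrtrM// ltW.
have sl : 0 < Num.sqrt la by rewrite sqrtr_gt0.
have st : 0 <= Num.sqrt t by exact: sqrtr_ge0.
rewrite /F !mulr1 cE ler_pdivlMr// mulrAC mulrA ler_pdivrMr; nra.
Qed.

End FTC.

Section Duhamel.
Context (R : realType) (n : nat) (G : gaussian_vector R n) (nu : R).
Hypothesis nu0 : 0 < nu.
Local Notation V := 'rV[R]_n.
Local Notation leb := (@lebesgue_measure R).
Local Notation I01 := (`](0 : R), (1 : R)]%classic : set R).
Local Notation m := (gv_mu G).

(* The Duhamel integral [int_0^t S(t - s) g(s) ds] after the substitution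
   [s = t (1 - u^2)]: the factor [u] cancels the singularity [(t - s)^(-1/2)] of
   each spatial derivative, so [Dj] and, for Lipschitz [g], [Dij] have bounded
   integrands. *)
Definition sg (t : R) : R := Num.sqrt (2 * nu * t).
Definition Sop (f : V -> R) (t : R) (x : V) : R := Eg (@q0 R n G) f (sg t) x.
Definition Dw (a : R -> R) (q : gv_type G -> R) (g : R -> V -> R) (t : R) (x : V) : R :=
  \int[leb]_(u in `]0, 1]) (a u * Eg q (g (t * (1 - u ^+ 2))) (u * sg t) x).
Definition Dop (g : R -> V -> R) (t : R) (x : V) : R :=
  t * Dw (fun u => 2 * u) (@q0 R n G) g t x.
Definition Dj (j : 'I_n) (g : R -> V -> R) (t : R) (x : V) : R :=
  Num.sqrt (t / (2 * nu)) * Dw (fun _ => 2) (@q1 R n G j) g t x.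
Definition Dij (i j : 'I_n) (g : R -> V -> R) (t : R) (x : V) : R :=
  Dw (fun u => (nu * u)^-1) (@q2 R n G i j) g t x.

Lemma sg_ge0 t : 0 <= sg t. Proof. exact: sqrtr_ge0. Qed.

Lemma sg_gt0 t : 0 < t -> 0 < sg t.
Proof. by move=> t0; rewrite sqrtr_gt0 !mulr_gt0. Qed.

Lemma sg0 : sg 0 = 0. Proof. by rewrite /sg mulr0 sqrtr0. Qed.

Lemma sg_le s t : s <= t -> sg s <= sg t.
Proof. by move=> st; apply: ler_wsqrtr; rewrite ler_wpM2l// mulr_ge0// ltW. Qed.

Lemma sg_sqr t : 0 <= t -> sg t ^+ 2 = 2 * nu * t.
Proof. by move=> t0; rewrite sqr_sqrtr// !mulr_ge0// ltW. Qed.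

Lemma cont_sg (X : topologicalType) (t : X -> R) : continuous t -> continuous (fun p => sg (t p)).
Proof. by move=> ct; apply: cont_sqrt; apply: contM => //; exact: cont_cst. Qed.

Lemma cont_time (X : topologicalType) (t u : X -> R) : continuous t -> continuous u ->
  continuous (fun p => t p * (1 - u p ^+ 2)).
Proof.
move=> ct cu; apply: contM => //; apply: contB; first exact: cont_cst.
by apply: contM.
Qed.

Section Integrand.
Variables (q : gv_type G -> R) (g : R -> V -> R) (M : R).
Hypothesis iq : m.-integrable setT (EFin \o q).
Hypothesis cg : continuous (fun p : R * V => g p.1 p.2).
Hypothesis gM : forall t z, `|g t z| <= M.

Lemma cont_slice t : continuous (g t).
Proof. by apply: (cont_uncurry cg); [exact: cont_cst|exact: cont_id]. Qed.

Lemma Dw_cont_u t x : continuous (fun u : R => Eg q (g (t * (1 - u ^+ 2))) (u * sg t) x).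
Proof.
apply: (Eg_continuous iq cg gM).
- by apply: cont_time; [exact: cont_cst|exact: cont_id].
- by apply: contM; [exact: cont_id|exact: cont_cst].
- exact: cont_cst.
Qed.

Lemma Dw_measurable_u (a : R -> R) t x : measurable_fun I01 a ->
  measurable_fun I01 (fun u : R => a u * Eg q (g (t * (1 - u ^+ 2))) (u * sg t) x).
Proof.
move=> ma; apply: measurable_funM => //; apply: measurable_funTS.
by apply: continuous_measurable_fun; exact: Dw_cont_u.
Qed.

Lemma Dw_continuous (X : pseudoMetricType R) (a : R -> R) (C : R) (t : X -> R) (y : X -> V) :
  measurable_fun I01 a -> continuous t -> continuous y ->
  (forall p u, 0 < u <= 1 ->
     `|a u * Eg q (g (t p * (1 - u ^+ 2))) (u * sg (t p)) (y p)| <= C) ->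
  continuous (fun p => Dw a q g (t p) (y p)).
Proof.
move=> ma ct cy bd p0.
apply: (@dominated_continuous_at R _ _ leb _ _ X
  (fun p u => a u * Eg q (g (t p * (1 - u ^+ 2))) (u * sg (t p)) (y p)) (fun _ => C) p0) => //.
- by move=> p; exact: Dw_measurable_u.
- exact: cst01_integrable.
- move=> u _; move: p0; apply: contM; first exact: cont_cst.
  apply: (Eg_continuous iq cg gM) => //.
  + by apply: cont_time => //; exact: cont_cst.
  + by apply: contM; [exact: cont_cst|exact: cont_sg].
Qed.

Lemma Dw_weighted (a : R -> R) (A B la t : R) x : measurable_fun I01 a ->
  (forall u, 0 < u <= 1 -> `|a u| <= A) -> 0 <= t -> 0 <= A ->
  (forall s z, 0 <= s <= t -> `|g s z| <= B * expR (la * s)) ->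
  `|Dw a q g t x| <= A * B * (\int[m]_w `|q w|) * expR (la * t) * expw la t.
Proof.
move=> ma aA t0 A0 gB; set Q := \int[m]_w `|q w|.
have bd u : 0 < u <= 1 -> `|a u * Eg q (g (t * (1 - u ^+ 2))) (u * sg t) x| <=
    (A * B * Q * expR (la * t)) * expR (- (la * t * u ^+ 2)).
  move=> u01; have /andP[u0 u1] := u01.
  have st : 0 <= t * (1 - u ^+ 2) <= t.
    have u2 : u ^+ 2 <= 1 by rewrite expr_le1// ltW.
    have := sqr_ge0 u => u2'.
    by apply/andP; split; [rewrite mulr_ge0// subr_ge0|rewrite ler_piMr// gerBl].
  have -> : A * B * Q * expR (la * t) * expR (- (la * t * u ^+ 2)) =
      A * (B * expR (la * (t * (1 - u ^+ 2))) * Q).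
    rewrite -[LHS]mulrA -expRD (_ : la * t + _ = la * (t * (1 - u ^+ 2))); last by ring.
    by move: (expR _) => E; ring.
  rewrite normrM; apply: ler_pM => //; first exact: aA.
  by apply: (Eg_bound iq); [exact: cont_slice|move=> z; exact: gB].
have mI := Dw_measurable_u t x ma.
have iE : leb.-integrable `]0, 1] (EFin \o (fun u => expR (- (la * t * u ^+ 2)))).
  apply: (@integrableS _ _ _ leb `[0%R, 1%R]) => //.
    exact: I01_subset.
  by apply: continuous_itv_integrable => u _; exact: cont_expw_int.
have iE2 : leb.-integrable `]0, 1]
    (EFin \o (fun u => (A * B * Q * expR (la * t)) * expR (- (la * t * u ^+ 2)))).
  exact: integrable_scale.
have iI := @dominated_integrableR R _ _ leb _ _ _ _ mI iE2.
rewrite /expw -RintegralZl//.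
have {}iI : leb.-integrable `]0, 1]
    (EFin \o (fun u => a u * Eg q (g (t * (1 - u ^+ 2))) (u * sg t) x)).
  by apply: iI => // u /=; rewrite in_itv/=; exact: bd.
apply: (le_trans (le_normr_Rintegral _ iI)) => //.
apply: le_Rintegral => //.
- exact: (integrable_norm iI).
Qed.

(** The derivative turns [q] into [q'] and costs [1/(u * sg t)], which is absorbed in [a']. As [a']
    may be singular at [u = 0], the domination is asked of the whole product and not of [a']. *)
Lemma Dw_derive (a a' : R -> R) (q' : gv_type G -> R) (A C t : R) (x : V) (i : 'I_n) :
  measurable_fun I01 a -> (forall u, 0 < u <= 1 -> `|a u| <= A) -> 0 < t ->
  (forall f s y, continuous f -> (forall z, `|f z| <= M) -> s != 0 ->
     is_derive y (ebase R i) (Eg q f s) (s^-1 * Eg q' f s y)) ->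
  (forall u, 0 < u <= 1 -> a u / (u * sg t) = a' u) ->
  (forall y u, 0 < u <= 1 -> `|a' u * Eg q' (g (t * (1 - u ^+ 2))) (u * sg t) y| <= C) ->
  is_derive x (ebase R i) (Dw a q g t) (Dw a' q' g t x).
Proof.
move=> ma aA t0 dq aa' bd.
have M0 : 0 <= M by rewrite (le_trans _ (gM 0 0)).
have A0 : 0 <= A by rewrite (le_trans _ (aA 1 _))// ltr01 lexx.
apply: (@dominated_is_derive R _ _ leb I01 V
  (fun z u => a u * Eg q (g (t * (1 - u ^+ 2))) (u * sg t) z)
  (fun z u => a' u * Eg q' (g (t * (1 - u ^+ 2))) (u * sg t) z) (fun _ => C) x) => //.
- move=> z; apply: (bounded01_integrable (C := A * (M * \int[m]_w `|q w|))).
    exact: Dw_measurable_u.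
  move=> u u01; rewrite normrM; apply: ler_pM => //; first exact: aA.
  by apply: (Eg_bound iq) => //; exact: cont_slice.
- exact: cst01_integrable.
- move=> z u /=; rewrite in_itv/= => u01; have /andP[u0 u1] := u01.
  have su : u * sg t != 0 by rewrite gt_eqF// mulr_gt0// sg_gt0.
  have H := dq (g (t * (1 - u ^+ 2))) (u * sg t) z (@cont_slice _) (gM _) su.
  rewrite (_ : (fun z => _) = (fun z => Eg q (g (t * (1 - u ^+ 2))) (u * sg t) z * a u)); last
    first.
    by apply/funext => y; rewrite mulrC.
  apply: (isd_eq (is_derive_mulc (a u) H)); rewrite -aa'//.
  by rewrite mulrC mulrA.
Qed.

End Integrand.

Section Operators.
Variables (g : R -> V -> R) (M : R).
Hypothesis cg : continuous (fun p : R * V => g p.1 p.2).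
Hypothesis gM : forall t z, `|g t z| <= M.
Local Notation q0 := (@q0 R n G).
Local Notation q1 := (@q1 R n G).
Local Notation q2 := (@q2 R n G).

Let M0 : 0 <= M. Proof. by rewrite (le_trans _ (gM 0 0)). Qed.

Lemma measurable_lin : measurable_fun I01 (fun u : R => 2 * u).
Proof. by apply: measurable_funTS; exact: measurable_funM. Qed.

Lemma measurable_nuinv : measurable_fun I01 (fun u : R => (nu * u)^-1).
Proof.
apply: (@measurable_funS _ _ _ _ (`](0 : R), +oo[%classic : set R)) => //.
  by move=> u /=; rewrite !in_itv/= andbT => /andP[].
apply: open_continuous_measurable_fun; first exact: interval_open.
move=> u; rewrite inE/= in_itv/= andbT => u0.
apply: cvgV; first by rewrite mulf_neq0 ?gt_eqF.
have c : continuous (fun u : R => nu * u) by apply: contM; [exact: cont_cst|exact: cont_id].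
exact: c.
Qed.

Lemma lin_le (u : R) : 0 < u <= 1 -> `|2 * u| <= (2 : R).
Proof. by move=> /andP[u0 u1]; rewrite ger0_norm; [lra|rewrite mulr_ge0// ltW]. Qed.

Let bd (a : R -> R) (A : R) (q : gv_type G -> R) t (x : V) u :
  m.-integrable setT (EFin \o q) ->
  `|a u| <= A -> `|a u * Eg q (g (t * (1 - u ^+ 2))) (u * sg t) x| <=
     A * (M * \int[m]_w `|q w|).
Proof.
move=> iq aA; rewrite normrM; apply: ler_pM => //.
by apply: (Eg_bound iq) => //; exact: (cont_slice cg).
Qed.

Lemma Dop_continuous (X : pseudoMetricType R) (t : X -> R) (y : X -> V) :
  continuous t -> continuous y -> continuous (fun p => Dop g (t p) (y p)).
Proof.
move=> ct cy; apply: contM => //.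
apply: (Dw_continuous (q0_integrable G) cg gM measurable_lin ct cy) => p u u01.
exact: bd (q0_integrable G) (lin_le u01).
Qed.

Lemma Dj_continuous (X : pseudoMetricType R) j (t : X -> R) (y : X -> V) :
  continuous t -> continuous y -> continuous (fun p => Dj j g (t p) (y p)).
Proof.
move=> ct cy; apply: contM.
  by apply: cont_sqrt; apply: contM => //; exact: cont_cst.
apply: (Dw_continuous (q1_integrable G j) cg gM _ ct cy) => [|p u u01].
  exact: measurable_cst.
by apply: (@bd (fun _ => 2) 2 _ _ _ _ (q1_integrable G j)); rewrite ger0_norm.
Qed.

Lemma Dop_derive j (t : R) (x : V) : 0 <= t -> is_derive x (ebase R j) (Dop g t) (Dj j g t x).
Proof.
rewrite le_eqVlt => /predU1P[<-|t0].
  rewrite /Dj mul0r sqrtr0 mul0r (_ : Dop g 0 = (fun _ => 0)); first exact: isd_cst.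
  by apply/funext => y; rewrite /Dop mul0r.
have s0 := sg_gt0 t0.
pose C := 2 * (sg t)^-1 * (M * \int[m]_w `|q1 j w|).
have H := @Dw_derive q0 g M (q0_integrable G) cg gM (fun u => 2 * u) (fun _ => 2 * (sg t)^-1)
  (q1 j) 2 C t x j measurable_lin lin_le t0.
have {}H : is_derive x (ebase R j) (Dw (fun u => 2 * u) q0 g t)
    (Dw (fun _ => 2 * (sg t)^-1) (q1 j) g t x).
  apply: H.
  - by move=> f s y cf fM s1; exact: Eg_q0_derive_e cf fM s1.
  - by move=> u /andP[u0 _]; field; rewrite !gt_eqF.
  - move=> y u u01; apply: (@bd (fun _ => 2 * (sg t)^-1) _ _ _ _ _ (q1_integrable G j)).
    by rewrite ger0_norm// mulr_ge0// invr_ge0 ltW.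
rewrite (_ : Dop g t = (fun y => Dw (fun u => 2 * u) q0 g t y * t)); last first.
  by apply/funext => y; rewrite /Dop mulrC.
apply: (isd_eq (is_derive_mulc t H)).
have E : Dw (fun _ => 2 * (sg t)^-1) (q1 j) g t x = (sg t)^-1 * Dw (fun _ => 2) (q1 j) g t x.
  rewrite /Dw -RintegralZl//; first by apply: eq_Rintegral => u _; ring.
  apply: (bounded01_integrable (C := 2 * (M * \int[m]_w `|q1 j w|))).
    by apply: (Dw_measurable_u (q1_integrable G j) cg gM); exact: measurable_cst.
  by move=> u u01; apply: (@bd (fun _ => 2) 2 _ _ _ _ (q1_integrable G j)); rewrite ger0_norm.
rewrite E /Dj mulrC mulrA; congr (_ * _).
have n0 : 0 < 2 * nu by rewrite mulr_gt0.
(* The factor [2 u] of the substitution cancels the [u] in [1/(u * sg t)], leaving [t / sg t], which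
   is the prefactor [Num.sqrt (t / (2 * nu))] of [Dj]. *)
have -> : Num.sqrt (t / (2 * nu)) = sg t / (2 * nu).
  apply/eqP; rewrite -(@eqrXn2 _ 2)// ?sqrtr_ge0 ?divr_ge0 ?sg_ge0 ?(ltW n0)//.
  rewrite sqr_sqrtr ?divr_ge0 ?(ltW t0) ?(ltW n0)// expr_div_n sg_sqr ?(ltW t0)//.
  by apply/eqP; field; rewrite !gt_eqF.
have := sg_sqr (ltW t0); rewrite expr2 => E2.
apply: (mulIf (x := sg t)); first by rewrite gt_eqF.
rewrite mulfVK ?gt_eqF// mulrAC E2.
by field; rewrite gt_eqF.
Qed.

(** Of the prefactor [t], one square root is spent on [expw_bound] and the other is bounded by
    [Num.sqrt T1]. Hence [Dop] gains the same [1 / Num.sqrt la] as [Dj], and one weight serves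
    both. *)
Lemma Dop_weighted (B la t T1 : R) x : 0 < la -> 0 <= t <= T1 ->
  (forall s z, 0 <= s <= t -> `|g s z| <= B * expR (la * s)) ->
  `|Dop g t x| <= 4 * Num.sqrt T1 / Num.sqrt la * (B * expR (la * t)).
Proof.
move=> la0 /andP[t0 tT] gB.
have B0 : 0 <= B.
  have := gB 0 0; rewrite lexx t0 mulr0 expR0 mulr1 => /(_ isT); exact: le_trans.
have H := Dw_weighted (q0_integrable G) cg gM x measurable_lin lin_le t0 (ler0n _ 2) gB.
rewrite q0_mass mulr1 in H.
rewrite /Dop normrM (ger0_norm t0).
have st : 0 <= Num.sqrt t by exact: sqrtr_ge0.
have sT : Num.sqrt t <= Num.sqrt T1 by exact: ler_wsqrtr.
have eb := expw_bound la0 t0.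
have e0 : 0 < expR (la * t) by exact: expR_gt0.
have w0 : 0 <= expw la t by apply: Rintegral_ge0 => u _; exact: expR_ge0.
have E : Num.sqrt t * Num.sqrt t = t by rewrite -expr2 sqr_sqrtr.
apply: (@le_trans _ _ (t * (2 * B * expR (la * t) * expw la t))); first by rewrite ler_wpM2l.
have -> : t * (2 * B * expR (la * t) * expw la t) =
  (Num.sqrt t * (Num.sqrt t * expw la t)) * (2 * (B * expR (la * t))).
  transitivity ((Num.sqrt t * Num.sqrt t) * (2 * B * expR (la * t) * expw la t)).
    by rewrite E.
  by ring.
have -> : 4 * Num.sqrt T1 / Num.sqrt la * (B * expR (la * t)) =
  (Num.sqrt T1 * (2 / Num.sqrt la)) * (2 * (B * expR (la * t))) by ring.
apply: ler_wpM2r; first by rewrite !mulr_ge0// ltW.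
by apply: ler_pM => //; rewrite mulr_ge0.
Qed.

Lemma Dj_weighted (B la t : R) x j : 0 < la -> 0 <= t ->
  (forall s z, 0 <= s <= t -> `|g s z| <= B * expR (la * s)) ->
  `|Dj j g t x| <= 4 * (\int[m]_w `|q1 j w|) / Num.sqrt (2 * nu) / Num.sqrt la *
     (B * expR (la * t)).
Proof.
move=> la0 t0 gB.
have B0 : 0 <= B.
  have := gB 0 0; rewrite lexx t0 mulr0 expR0 mulr1 => /(_ isT); exact: le_trans.
have m2 : measurable_fun I01 (fun _ : R => 2 : R) by exact: measurable_cst.
have b2 (u : R) : 0 < u <= 1 -> `|2 : R| <= 2 by move=> _; rewrite ger0_norm.
have H := Dw_weighted (q1_integrable G j) cg gM x m2 b2 t0 (ler0n _ 2) gB.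
rewrite /Dj normrM (ger0_norm (sqrtr_ge0 _)) sqrtrM// sqrtrV ?mulr_ge0 ?(ltW nu0)//.
have Q0 : 0 <= \int[m]_w `|q1 j w| by apply: Rintegral_ge0.
set Q := \int[m]_w `|q1 j w| in H Q0 *.
have st : 0 <= Num.sqrt t by exact: sqrtr_ge0.
have eb := expw_bound la0 t0.
have e0 : 0 < expR (la * t) by exact: expR_gt0.
have sn : 0 <= (Num.sqrt (2 * nu))^-1 by rewrite invr_ge0 sqrtr_ge0.
apply: (@le_trans _ _ (Num.sqrt t / Num.sqrt (2 * nu) * (2 * B * Q * expR (la * t) * expw la t))).
  by apply: ler_wpM2l => //; rewrite mulr_ge0.
have -> : Num.sqrt t / Num.sqrt (2 * nu) * (2 * B * Q * expR (la * t) * expw la t) =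
  (Num.sqrt t * expw la t) * (2 * B * Q * expR (la * t) / Num.sqrt (2 * nu)) by ring.
have -> : 4 * Q / Num.sqrt (2 * nu) / Num.sqrt la * (B * expR (la * t)) =
  (2 / Num.sqrt la) * (2 * B * Q * expR (la * t) / Num.sqrt (2 * nu)) by ring.
by apply: ler_wpM2r => //; rewrite !mulr_ge0// ltW.
Qed.

Section Lipschitz.
Variable L : R.
Hypothesis L0 : 0 <= L.
Hypothesis gL : forall t y z, `|g t (y + z) - g t y| <= L * `|z|.

(** By [Eg_q2_lip] the average is of order [u * sg t], which cancels the [1/u] in front; a bound on
    [g] alone would leave a divergent [1/u]. *)
Lemma Dij_integrand_bound i j (t T1 : R) x (u : R) : t <= T1 -> 0 < u <= 1 ->
  `|(nu * u)^-1 * Eg (q2 i j) (g (t * (1 - u ^+ 2))) (u * sg t) x| <=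
    nu^-1 * L * sg T1 * gm2 G i j.
Proof.
move=> tT /andP[u0 u1].
rewrite normrM ger0_norm; last by rewrite invr_ge0 mulr_ge0 ?ltW.
have cs : continuous (g (t * (1 - u ^+ 2))) by exact: (cont_slice cg).
have H := @Eg_q2_lip R n G (g (t * (1 - u ^+ 2))) M L (u * sg t) x i j cs (gM _) L0 (gL _).
have p0 : 0 < nu * u by rewrite mulr_gt0.
rewrite mulrC ler_pdivrMr//; apply: (le_trans H).
rewrite ger0_norm; last by rewrite mulr_ge0 ?sg_ge0 ?ltW.
rewrite (_ : nu^-1 * L * sg T1 * gm2 G i j * (nu * u) = L * (u * sg T1) * gm2 G i j); last first.
  by field; rewrite gt_eqF.
apply: ler_wpM2r; first exact: gm2_ge0.
by apply: ler_wpM2l => //; apply: ler_wpM2l; [exact: ltW|exact: sg_le].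
Qed.

Lemma Dij_bound i j (t T1 : R) x : t <= T1 -> `|Dij i j g t x| <= nu^-1 * L * sg T1 * gm2 G i j.
Proof.
move=> tT; apply: bounded01_Rintegral.
  by apply: (Dw_measurable_u (q2_integrable G i j) cg gM); exact: measurable_nuinv.
by move=> u u01; exact: Dij_integrand_bound.
Qed.

Lemma Dij_continuous (X : pseudoMetricType R) i j (t : X -> R) (T1 : R) (y : X -> V) :
  continuous t -> continuous y -> (forall p, t p <= T1) ->
  continuous (fun p => Dij i j g (t p) (y p)).
Proof.
move=> ct cy tT.
apply: (Dw_continuous (q2_integrable G i j) cg gM measurable_nuinv ct cy) => p u u01.
exact: Dij_integrand_bound.
Qed.

Lemma Dij0 i j x : Dij i j g 0 x = 0.
Proof.
rewrite /Dij /Dw (_ : (fun u => _) = (fun=> 0)) ?Rintegral_cst ?mul0r//.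
apply/funext => u; rewrite mul0r sg0 mulr0.
rewrite (_ : Eg _ _ _ _ = 0) ?mulr0// /Eg.
under eq_Rintegral do rewrite scale0r addr0.
by rewrite RintegralZl ?q2_mean0 ?mulr0//; exact: q2_integrable.
Qed.

Lemma Dj_derive i j (t : R) (x : V) : 0 <= t -> is_derive x (ebase R i) (Dj j g t) (Dij i j g t x).
Proof.
rewrite le_eqVlt => /predU1P[<-|t0].
  rewrite Dij0 (_ : Dj j g 0 = (fun _ => 0)); first exact: isd_cst.
  by apply/funext => y; rewrite /Dj mul0r sqrtr0 mul0r.
have s0 := sg_gt0 t0.
have n0 : 0 < 2 * nu by rewrite mulr_gt0.
have st : 0 < Num.sqrt (t / (2 * nu)) by rewrite sqrtr_gt0 divr_gt0.
have sE : sg t = 2 * nu * Num.sqrt (t / (2 * nu)).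
  apply/eqP; rewrite -(@eqrXn2 _ 2)// ?sg_ge0 ?mulr_ge0 ?(ltW st) ?(ltW nu0)//.
  rewrite sg_sqr ?(ltW t0)// exprMn sqr_sqrtr ?divr_ge0 ?(ltW t0) ?(ltW n0)//.
  by apply/eqP; field; rewrite !gt_eqF.
set r : R := Num.sqrt (t / (2 * nu)) in st sE *.
have m2 : measurable_fun I01 (fun _ : R => 2 : R) by exact: measurable_cst.
have b2 (u : R) : 0 < u <= 1 -> `|2 : R| <= 2 by move=> _; rewrite ger0_norm.
have H := @Dw_derive (q1 j) g M (q1_integrable G j) cg gM (fun _ => 2)
  (fun u => r^-1 * (nu * u)^-1) (q2 i j) 2 (r^-1 * (nu^-1 * L * sg t * gm2 G i j)) t x i m2 b2 t0.
have {}H : is_derive x (ebase R i) (Dw (fun _ => 2) (q1 j) g t)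
    (Dw (fun u => r^-1 * (nu * u)^-1) (q2 i j) g t x).
  apply: H.
  - by move=> f s y cf fM s1; exact: Eg_q1_derive cf fM s1.
  - by move=> u /andP[u0 _]; rewrite sE; field; rewrite !gt_eqF.
  - move=> y u u01; rewrite -(mulrA r^-1) normrM (@ger0_norm _ r^-1) ?invr_ge0 ?(ltW st)//.
    by apply: ler_wpM2l; [rewrite invr_ge0 ltW|exact: Dij_integrand_bound].
rewrite (_ : Dj j g t = (fun y => Dw (fun _ => 2) (q1 j) g t y * r)); last first.
  by apply/funext => y; rewrite /Dj mulrC.
apply: (isd_eq (is_derive_mulc r H)).
rewrite /Dij /Dw (_ : \int[leb]_(u in _) _ = r^-1 *
  \int[leb]_(u in `]0, 1]) ((nu * u)^-1 * Eg (q2 i j) (g (t * (1 - u ^+ 2))) (u * sg t) x)).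
  by rewrite mulrAC mulVf ?mul1r// gt_eqF.
rewrite -RintegralZl//; first by apply: eq_Rintegral => u _; rewrite mulrA.
apply: (bounded01_integrable (C := nu^-1 * L * sg t * gm2 G i j)).
  by apply: (Dw_measurable_u (q2_integrable G i j) cg gM); exact: measurable_nuinv.
by move=> u u01; exact: Dij_integrand_bound.
Qed.

End Lipschitz.

End Operators.

End Duhamel.

(** * The heat equation for Duhamel integrals *)

Section TriangleFubini.
Context (R : realType).
Local Notation leb := (@lebesgue_measure R).

Lemma measurable_continuous2 (k : R -> R -> R) : continuous (fun p : R * R => k p.1 p.2) ->
  measurable_fun setT (fun p : measurableTypeR R * measurableTypeR R => k p.1 p.2).
Proof.
move=> ck.
have H := @measurable_caratheodory_comp R _ (measurableTypeR R * measurableTypeR R)%type 1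
  (fun p => \row_(_ < 1) (p.1 : R)) (fun y p => k (y 0 0) p.2).
rewrite (_ : (fun p => _) = (fun p : measurableTypeR R * measurableTypeR R =>
   k ((\row_(_ < 1) (p.1 : R)) 0 0) p.2)); last by apply/funext => p; rewrite mxE.
apply: H.
- move=> i; rewrite (_ : (fun t => _) = (fun p : measurableTypeR R * measurableTypeR R => p.1)).
    exact: measurable_fst.
  by apply/funext => p; rewrite mxE.
- move=> y; have c : continuous (k (y 0 0)).
    by apply: (cont_uncurry ck); [exact: cont_cst|exact: cont_id].
  exact: (measurableT_comp (continuous_measurable_fun c) measurable_snd).
- move=> p; apply: (cont_uncurry ck); last exact: cont_cst.
  by apply: cont_coord; exact: cont_id.
Qed.

(** Fubini for [k] times the indicator of the triangle [0 <= s <= r <= t]; it is integrable because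
    [k] is bounded and the triangle lies in a square. *)
Lemma triangle_fubini (k : R -> R -> R) (t M : R) : 0 <= t ->
  continuous (fun p : R * R => k p.1 p.2) -> (forall a b, `|k a b| <= M) ->
  \int[leb]_(s in `[0, t]) (\int[leb]_(r in `[s, t]) k s r) =
  \int[leb]_(r in `[0, t]) (\int[leb]_(s in `[0, r]) k s r).
Proof.
move=> t0 ck kM.
pose D := [set p : measurableTypeR R * measurableTypeR R | 0 <= p.1 <= p.2 /\ p.2 <= t].
pose f (p : measurableTypeR R * measurableTypeR R) : R := k p.1 p.2 * \1_D p.
have mle (a b : measurableTypeR R * measurableTypeR R -> R) :
    measurable_fun setT a -> measurable_fun setT b -> measurable [set p | a p <= b p].
  move=> ma mb; have := measurable_fun_le measurableT ma mb.
  by rewrite setTI.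
have mD : measurable D.
  rewrite (_ : D = [set p | (0 : R) <= p.1] `&` [set p | (p.1 : R) <= p.2] `&` [set p | (p.2 : R)
    <= t]).
    apply: measurableI; first apply: measurableI.
    - by apply: mle => //; exact: measurable_fst.
    - by apply: mle; [exact: measurable_fst|exact: measurable_snd].
    - by apply: mle => //; exact: measurable_snd.
  apply/seteqP; split => p /=; first by case=> /andP[].
  by case=> -[a b] c; split => //; apply/andP.
have mf : measurable_fun setT f.
  by apply: measurable_funM; [exact: measurable_continuous2|exact: measurable_indic].
have M0 : 0 <= M by rewrite (le_trans _ (kM 0 0)).
have slice1 s : \int[leb]_r (f (s, r)) = (\int[leb]_(r in `[s, t]) k s r) * \1_`[0, t] s.
  rewrite /f; have [s0|s0] := boolP (s \in `[0, t]); last first.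
    rewrite indicE (_ : _ \in _ = false) ?mulr0; last first.
      by apply/negP; rewrite inE/=; exact/negP.
    rewrite (_ : (fun r => _) = fun=> 0) ?Rintegral_cst ?mul0r//.
    apply/funext => r; rewrite indicE (_ : _ \in _ = false) ?mulr0//.
    apply/negP; rewrite inE/= => -[/andP[h1 h2] h3]; move: s0.
    by rewrite in_itv/= h1 (le_trans h2 h3).
  rewrite [X in _ = _ * X](_ : _ = 1) ?mulr1; last by rewrite indicE mem_set.
  rewrite [RHS]Rintegral_mkcond; apply: eq_Rintegral => r _.
  move: s0; rewrite in_itv/= => /andP[s0 st].
  rewrite patchE indicE; case: ifPn; rewrite ?inE ?notin_setE/= in_itv/=.
    by move=> /andP[h1 h2]; rewrite mem_set ?mulr1//= /D/= s0 h1.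
  move=> nr; rewrite (_ : _ \in _ = false) ?mulr0//.
  by apply/negP; rewrite inE/= => -[/andP[_ h1] h2]; apply: nr; rewrite h1.
have slice2 r : \int[leb]_s (f (s, r)) = (\int[leb]_(s in `[0, r]) k s r) * \1_`[0, t] r.
  rewrite /f; have [r0|r0] := boolP (r \in `[0, t]); last first.
    rewrite indicE (_ : _ \in _ = false) ?mulr0; last first.
      by apply/negP; rewrite inE/=; exact/negP.
    rewrite (_ : (fun r => _) = fun=> 0) ?Rintegral_cst ?mul0r//.
    apply/funext => s; rewrite indicE (_ : _ \in _ = false) ?mulr0//.
    apply/negP; rewrite inE/= => -[/andP[h1 h2] h3]; move: r0.
    by rewrite in_itv/= h3 (le_trans h1 h2).
  rewrite [X in _ = _ * X](_ : _ = 1) ?mulr1; last by rewrite indicE mem_set.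
  rewrite [RHS]Rintegral_mkcond; apply: eq_Rintegral => s _.
  move: r0; rewrite in_itv/= => /andP[r0 rt].
  rewrite patchE indicE; case: ifPn; rewrite ?inE ?notin_setE/= in_itv/=.
    by move=> h1; rewrite mem_set ?mulr1.
  move=> nr; rewrite (_ : _ \in _ = false) ?mulr0//.
  by apply/negP; rewrite inE/= => -[h1 h2]; exact: nr.
have mu0t : leb (`[0, t]%classic : set R) = t%:E.
  rewrite lebesgue_measure_itv/= lte_fin; case: ltP => h; first by rewrite oppr0 adde0.
  by congr EFin; apply/eqP; rewrite eq_le h t0.
have intc : (\int[leb]_x (\1_(`[0, t]%classic : set R) x)%:E = t%:E)%E.
  by rewrite integral_indic//= setIT; exact: mu0t.
have i1 s : leb.-integrable setT (EFin \o (fun r => f (s, r))).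
  apply/integrableP; split.
    apply/measurable_EFinP.
    exact: (measurableT_comp mf (measurable_pair1 s)).
  apply: (@le_lt_trans _ _ (\int[leb]_r (M * \1_(`[0, t]%classic : set R) r)%:E)%E).
    apply: ge0_le_integral => //.
    - apply/measurableT_comp/measurable_EFinP => //.
      exact: (measurableT_comp mf (measurable_pair1 s)).
    - by apply/measurable_EFinP/measurable_funM => //; exact: measurable_indic.
    move=> r _ /=; rewrite lee_fin /f normrM; apply: ler_pM => //.
    rewrite !indicE; case: (boolP (_ \in D)) => [|_]; last by rewrite normr0.
    rewrite inE/= => -[/andP[h1 h2] h3].
    by rewrite normr1 mem_set//= in_itv/= h3 (le_trans h1).
  under eq_integral do rewrite EFinM.
  rewrite ge0_integralZl//.
  - by rewrite [X in (_ * X)%E]intc -EFinM ltry.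
  - exact/measurable_EFinP/measurable_indic.
have i2 r : leb.-integrable setT (EFin \o (fun s => f (s, r))).
  apply/integrableP; split.
    apply/measurable_EFinP.
    exact: (measurableT_comp mf (measurable_pair2 r)).
  apply: (@le_lt_trans _ _ (\int[leb]_s (M * \1_(`[0, t]%classic : set R) s)%:E)%E).
    apply: ge0_le_integral => //.
    - apply/measurableT_comp/measurable_EFinP => //.
      exact: (measurableT_comp mf (measurable_pair2 r)).
    - by apply/measurable_EFinP/measurable_funM => //; exact: measurable_indic.
    move=> s _ /=; rewrite lee_fin /f normrM; apply: ler_pM => //.
    rewrite !indicE; case: (boolP (_ \in D)) => [|_]; last by rewrite normr0.
    rewrite inE/= => -[/andP[h1 h2] h3].
    by rewrite normr1 mem_set//= in_itv/= h1 (le_trans h2).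
  under eq_integral do rewrite EFinM.
  rewrite ge0_integralZl//.
  - by rewrite [X in (_ * X)%E]intc -EFinM ltry.
  - exact/measurable_EFinP/measurable_indic.
have fint : (leb \x leb)%E.-integrable setT (EFin \o f).
  apply/integrable12ltyP; first exact/measurable_EFinP.
  pose c (s : R) : R := \1_(`[0, t]%classic : set R) s.
  have fb s r : `|f (s, r)| <= M * (c s * c r).
    rewrite /f normrM; apply: ler_pM => //.
    rewrite /c !indicE; case: (boolP (_ \in D)) => [|_]; last by rewrite normr0 mulr_ge0.
    rewrite inE/= => -[/andP[h1 h2] h3].
    by rewrite normr1 !mem_set ?mulr1//= in_itv/= ?h1 ?h3 ?(le_trans h1)// (le_trans h2).
  apply: (@le_lt_trans _ _ (\int[leb]_s (M * t * c s)%:E)%E).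
    apply: ge0_le_integral => //.
    - by move=> s _; exact: integral_ge0.
    - apply: (measurable_fun_fubini_tonelli_F (m2 := leb) (fun p => `|(EFin \o f) p|%E)) => //.
      exact/measurableT_comp/measurable_EFinP.
    - by apply/measurable_EFinP/measurable_funM => //; exact: measurable_indic.
    move=> s _; apply: (@le_trans _ _ (\int[leb]_r ((M * c s) * c r)%:E)%E).
      apply: ge0_le_integral => //.
      - apply/measurableT_comp/measurable_EFinP => //.
        exact: (measurableT_comp mf (measurable_pair1 s)).
      - by apply/measurable_EFinP/measurable_funM => //; exact: measurable_indic.
      - by move=> r _ /=; rewrite lee_fin -mulrA; exact: fb.
    under eq_integral do rewrite EFinM.
    rewrite ge0_integralZl//.
    - by rewrite [X in (_ * X)%E]intc -EFinM mulrAC.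
    - exact/measurable_EFinP/measurable_indic.
    - by move=> r _; rewrite lee_fin.
    - by rewrite lee_fin mulr_ge0.
  under eq_integral do rewrite EFinM.
  rewrite ge0_integralZl//.
  - by rewrite [X in (_ * X)%E]intc -EFinM ltry.
  - exact/measurable_EFinP/measurable_indic.
  - by move=> r _; rewrite lee_fin.
  - by rewrite lee_fin mulr_ge0.
have F := Fubini fint.
transitivity (\int[leb]_s (\int[leb]_r (f (s, r)))).
  rewrite Rintegral_mkcond; apply: eq_Rintegral => s _.
  by rewrite slice1 patchE indicE; case: ifP; rewrite ?mulr1 ?mulr0.
transitivity (\int[leb]_r (\int[leb]_s (f (s, r)))); last first.
  rewrite [RHS]Rintegral_mkcond; apply: eq_Rintegral => r _.
  by rewrite slice2 patchE indicE; case: ifP; rewrite ?mulr1 ?mulr0.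
rewrite /Rintegral; congr fine.
transitivity (\int[leb]_s \int[leb]_r (f (s, r))%:E)%E.
  by apply: eq_integral => s _; rewrite fineK//; apply: integrable_fin_num => //; exact: i1.
rewrite [LHS]F.
by apply: eq_integral => s _; rewrite fineK//; apply: integrable_fin_num => //; exact: i2.
Qed.

End TriangleFubini.

Lemma isd_comp (R : realType) (f g : R -> R) (x a b : R) :
  is_derive (g x) (1 : R) f a -> is_derive x (1 : R) g b ->
  is_derive x (1 : R) (fun y => f (g y)) (a * b).
Proof. by move=> H1 H2; exact: (@is_derive1_comp R f g x a b H1 H2). Qed.

(** * Time dependence of the heat semigroup on smooth data, and the usual form of the Duhamel
    integral *)

Section HeatTime.
Context (R : realType) (n : nat) (G : gaussian_vector R n) (nu : R).
Hypothesis nu0 : 0 < nu.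
Local Notation V := 'rV[R]_n.
Local Notation leb := (@lebesgue_measure R).
Local Notation I01 := (`](0 : R), (1 : R)]%classic : set R).
Local Notation Sop := (Sop G nu).
Local Notation sg := (sg nu).
Local Notation Dop := (@Dop R n G nu).
Local Notation q0 := (@q0 R n G).

Lemma Sop0 (f : V -> R) x : Sop f 0 x = f x.
Proof. by rewrite /Sop sg0 Eg0. Qed.

Section Smooth.
Variables (f : V -> R) (D1 : 'I_n -> V -> R) (D2 : 'I_n -> 'I_n -> V -> R) (M : R).
Hypotheses (cf : continuous f) (fM : forall z, `|f z| <= M).
Hypotheses (cD1 : forall i, continuous (D1 i)) (D1M : forall i z, `|D1 i z| <= M).
Hypotheses (cD2 : forall i j, continuous (D2 i j)) (D2M : forall i j z, `|D2 i j z| <= M).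
Hypothesis (fD1 : forall z v, is_derive z v f (\sum_i v 0 i * D1 i z)).
Hypothesis (fD2 : forall i j z, is_derive z (ebase R i) (D1 j) (D2 i j z)).

Lemma cont_Sop_time (k : V -> R) (N s : R) x : continuous k -> (forall z, `|k z| <= N) ->
  continuous (fun t : R => Sop k (t - s) x).
Proof.
move=> ck kN.
apply: (@Eg_continuous R n G q0 (q0_integrable G) R (fun _ => k) N (fun=> 0)
  (fun t => sg (t - s)) (fun=> x)) => //.
- by apply: (cont_comp (f := snd)) ck; exact: cont_snd.
- exact: cont_cst.
- by apply: cont_sg; apply: contB; [exact: cont_id|exact: cont_cst].
- exact: cont_cst.
Qed.

(** The derivative of [sg] is [nu / sg], and [Eg_heat] supplies a factor [sg], so [nu] remains. The
    square root is singular at [r = s], but the fundamental theorem asks for the derivative only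
    inside the interval. *)
Lemma heat_shift (s t : R) x : s <= t ->
  Sop f (t - s) x - f x =
  \int[leb]_(r in `[s, t]) (nu * \sum_i Sop (D2 i i) (r - s) x).
Proof.
move=> st.
transitivity ((fun r => Sop f (r - s) x) t - (fun r => Sop f (r - s) x) s).
  by rewrite /= subrr Sop0.
apply/esym; apply: (@FTC_Rintegral R (fun r => Sop f (r - s) x)
  (fun r => nu * \sum_i Sop (D2 i i) (r - s) x) s t st).
- by move=> u _; exact: (cont_Sop_time cf fM).
- move=> u _; apply: contM; first exact: cont_cst.
  by apply: cont_sum => i; exact: (cont_Sop_time (@cD2 i i) (D2M i i)).
move=> r /andP[sr _].
have rs : 0 < r - s by rewrite subr_gt0.
have p0 : 0 < 2 * nu * (r - s) by rewrite !mulr_gt0.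
have g0 : 0 < sg (r - s) by exact: sg_gt0.
have d1 : is_derive r (1 : R) (fun r : R => 2 * nu * (r - s)) (2 * nu).
  rewrite (_ : (fun r : R => _) = (fun z : R => (z - s) * (2 * nu))); last first.
    by apply/funext => z; rewrite mulrC.
  apply: (isd_eq (is_derive_mulc (2 * nu) (isd_sub (isd_id r) (isd_cst s r (1 : R))))).
  by ring.
have d2 := @isd_comp R Num.sqrt _ r _ _ (is_derive1_sqrt p0) d1.
have d3 := @isd_comp R (fun b => Eg q0 f b x) _ r _ _
  (Eg_heat G cf fM cD1 D1M cD2 D2M fD1 fD2 x (lt0r_neq0 g0)) d2.
apply: (isd_eq d3); rewrite -/(sg (r - s)).
set S := \sum_i _; rewrite -[X in _ = nu * X]/S.
by field; rewrite gt_eqF.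
Qed.

End Smooth.

(** Undoes the substitution [s = t (1 - u^2)]: the Jacobian is [2 t u], and [t - s = t u^2] gives
    [sg (t - s) = u * sg t]. *)
Lemma Dop_time (g : R -> V -> R) (M t : R) x : continuous (fun p : R * V => g p.1 p.2) ->
  (forall t z, `|g t z| <= M) -> 0 <= t ->
  Dop g t x = \int[leb]_(s in `[0, t]) Sop (g s) (t - s) x.
Proof.
move=> cg gM; rewrite le_eqVlt => /predU1P[<-|t0].
  by rewrite /Dop mul0r set_itv1 Rintegral_set1.
pose k s := Sop (g s) (t - s) x.
have ck : continuous k.
  apply: (Eg_continuous (q0_integrable G) cg gM); first exact: cont_id.
    by apply: cont_sg; apply: contB; [exact: cont_cst|exact: cont_id].
  exact: cont_cst.
pose F (u : R) : R := t * (1 - u ^+ 2).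
have dF (u : R) : is_derive u (1 : R) F (- (2 * t * u)).
  rewrite /F (_ : (fun u : R => _) = (fun z : R => (1 - z * z) * t)); last first.
    by apply/funext => z; rewrite mulrC expr2.
  apply: (isd_eq (is_derive_mulc t (isd_sub (isd_cst 1 u (1 : R)) (isd_mul (isd_id u) (isd_id
    u))))).
  by ring.
have F' : F^`()%classic = (fun u : R => - (2 * t * u)).
  by apply/funext => u; rewrite derive1E; have [_ ->] := dF u.
have cF' : continuous (F^`()%classic).
  rewrite F'; apply: contN; apply: contM; [exact: cont_cst|exact: cont_id].
have cF : continuous F.
  apply: contM; first exact: cont_cst.
  apply: contB; first exact: cont_cst.
  by apply: contM; exact: cont_id.
have H : (\int[leb]_(s in `[0%R, t]) (k s)%:E =
    \int[leb]_(u in `[0%R, 1%R]) (((k \o F) * - (F^`()%classic))%R u)%:E)%E.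
  have F1 : F 1 = 0 by rewrite /F expr1n subrr mulr0.
  have F0 : F 0 = t by rewrite /F expr0n subr0 mulr1.
  have := @integration_by_substitution_decreasing R F k 0 1 ler01.
  rewrite F1 F0; apply.
  - move=> u v; rewrite !in_itv/= => /andP[u0 _] /andP[v0 _] uv.
    rewrite /F ltr_pM2l// ltrD2l ltrN2 ltr_pXn2r//.
  - by move=> u _; exact: cF'.
  - by apply/cvg_ex; exists (F^`()%classic 0); apply: cvg_at_right_filter; exact: cF'.
  - by apply/cvg_ex; exists (F^`()%classic 1); apply: cvg_at_left_filter; exact: cF'.
  - split; first by move=> u _; have [] := dF u.
      by apply: cvg_at_right_filter; exact: cF.
    by apply: cvg_at_left_filter; exact: cF.
  - by apply: continuous_subspaceT => u; exact: ck.
rewrite /Rintegral H -/(Rintegral leb `[0%R, 1%R] _) -Rintegral_itv_obnd_cbnd; last first.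
  apply: (@integrableS _ _ _ leb `[0%R, 1%R]) => //; first exact: I01_subset.
  apply: continuous_itv_integrable => u _.
  apply: cvgM; first by apply: (cont_comp cF ck).
  by apply: cvgN; exact: cF'.
rewrite /Dop /Dw -RintegralZl//; last first.
  apply: (bounded01_integrable (C := 2 * (M * \int[gv_mu G]_w `|q0 w|))).
    exact: (@Dw_measurable_u R n G nu q0 g M (q0_integrable G) cg gM _ t x (@measurable_lin R)).
  move=> u u01; rewrite normrM; apply: ler_pM => //; first exact: lin_le.
  by apply: (Eg_bound (q0_integrable G)) => //; exact: (cont_slice cg).
apply: eq_Rintegral => u; rewrite inE/= in_itv/= => /andP[u0 _].
rewrite [RHS](_ : _ = k (F u) * - (F^`()%classic u))// F' opprK /k /F /Sop.
have -> : sg (t - t * (1 - u ^+ 2)) = u * sg t.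
  rewrite /sg (_ : 2 * nu * _ = u ^+ 2 * (2 * nu * t)); last by ring.
  by rewrite sqrtrM ?sqr_ge0// sqrtr_sqr ger0_norm// ltW.
by ring.
Qed.

End HeatTime.

(** * Gaussian mollification of the source at a fixed scale *)

Section Mollification.
Context (R : realType) (n : nat) (G : gaussian_vector R n) (nu : R).
Hypothesis nu0 : 0 < nu.
Local Notation V := 'rV[R]_n.
Local Notation leb := (@lebesgue_measure R).
Local Notation Sop := (Sop G nu).
Local Notation sg := (sg nu).
Local Notation Dop := (@Dop R n G nu).
Local Notation q0 := (@q0 R n G).
Local Notation q1 := (@q1 R n G).
Local Notation q2 := (@q2 R n G).
Local Notation m := (gv_mu G).
Local Notation Dij := (@Dij R n G nu).

(* First and second partial derivatives of the mollification [Eg q0 k e]. *)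
Definition sm1 (k : V -> R) (e : R) (i : 'I_n) (x : V) : R := Eg (q1 i) k e x * e^-1.
Definition sm2 (k : V -> R) (e : R) (i j : 'I_n) (x : V) : R := Eg (q2 i j) k e x * e^-1 * e^-1.
(** One crude constant for the mollified function and its derivatives of both orders. It degenerates
    as [e] tends to 0, so it serves only as a qualitative bound at fixed [e]. *)
Definition smB (e N : R) : R := N + \sum_i (N * (\int[m]_w `|q1 i w|) * `|e^-1|) +
  \sum_i \sum_j (N * (\int[m]_w `|q2 i j w|) * `|e^-1| * `|e^-1|).

Lemma cont_Eg q (k : V -> R) (N e : R) : m.-integrable setT (EFin \o q) ->
  continuous k -> (forall z, `|k z| <= N) -> continuous (Eg q k e).
Proof.
move=> iq ck kN.
apply: (@Eg_continuous R n G q iq V (fun _ => k) N (fun=> 0) (fun=> e) id) => //.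
- by apply: (cont_comp (f := snd)) ck; exact: cont_snd.
- exact: cont_cst.
- exact: cont_cst.
- exact: cont_id.
Qed.

Section Smoothing.
Variables (k : V -> R) (N e : R).
Hypotheses (ck : continuous k) (kN : forall z, `|k z| <= N) (e0 : e != 0).

Let N0 : 0 <= N. Proof. by rewrite (le_trans _ (kN 0)). Qed.
Let Q1 i : 0 <= \int[m]_w `|q1 i w|. Proof. exact: Rintegral_ge0. Qed.
Let Q2 i j : 0 <= \int[m]_w `|q2 i j w|. Proof. exact: Rintegral_ge0. Qed.
Let S1 : 0 <= \sum_i (N * (\int[m]_w `|q1 i w|) * `|e^-1|).
Proof. by apply: sumr_ge0 => i _; rewrite !mulr_ge0. Qed.
Let S2 : 0 <= \sum_i \sum_j (N * (\int[m]_w `|q2 i j w|) * `|e^-1| * `|e^-1|).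
Proof. by apply: sumr_ge0 => i _; apply: sumr_ge0 => j _; rewrite !mulr_ge0. Qed.

Lemma sm0_le z : `|Eg q0 k e z| <= N.
Proof. by have := Eg_bound (q0_integrable G) e z ck kN; rewrite q0_mass mulr1. Qed.

Lemma sm0_bound z : `|Eg q0 k e z| <= smB e N.
Proof. by rewrite (le_trans (sm0_le z))// /smB -addrA lerDl addr_ge0. Qed.

Lemma sm1_bound i z : `|sm1 k e i z| <= smB e N.
Proof.
apply: (@le_trans _ _ (N * (\int[m]_w `|q1 i w|) * `|e^-1|)).
  by rewrite /sm1 normrM ler_wpM2r// (Eg_bound (q1_integrable G i)).
rewrite /smB (bigD1 i)//= -!addrA addrCA lerDl !addr_ge0//.
by apply: sumr_ge0 => j _; rewrite !mulr_ge0.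
Qed.

Lemma sm2_bound i j z : `|sm2 k e i j z| <= smB e N.
Proof.
apply: (@le_trans _ _ (N * (\int[m]_w `|q2 i j w|) * `|e^-1| * `|e^-1|)).
  by rewrite /sm2 !normrM !ler_wpM2r// (Eg_bound (q2_integrable G i j)).
apply: (@le_trans _ _ (\sum_i \sum_j (N * (\int[m]_w `|q2 i j w|) * `|e^-1| * `|e^-1|))).
  rewrite (bigD1 i)//= (bigD1 j)//= -!addrA lerDl addr_ge0//.
    by apply: sumr_ge0 => l _; rewrite !mulr_ge0.
  by apply: sumr_ge0 => l _; apply: sumr_ge0 => l' _; rewrite !mulr_ge0.
by rewrite /smB lerDr addr_ge0.
Qed.

Lemma sm1_cont i : continuous (sm1 k e i).
Proof.
apply: contM; last exact: cont_cst.
exact: cont_Eg (q1_integrable G i) ck kN.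
Qed.

Lemma sm2_cont i j : continuous (sm2 k e i j).
Proof.
apply: contM; last exact: cont_cst; apply: contM; last exact: cont_cst.
exact: cont_Eg (q2_integrable G i j) ck kN.
Qed.

Lemma sm_derive1 z v : is_derive z v (Eg q0 k e) (\sum_i v 0 i * sm1 k e i z).
Proof.
apply: (isd_eq (Eg_q0_derive G z v ck kN e0)).
rewrite (_ : Eg _ k e z = \sum_i v 0 i * Eg (q1 i) k e z).
  by rewrite mulr_sumr; apply: eq_bigr => i _; rewrite /sm1; ring.
transitivity (\sum_i \int[m]_w (v 0 i * (k (z + e *: gv_Z w) * q1 i w))); last first.
  apply: eq_bigr => i _; rewrite RintegralZl//.
  exact: (Eg_integrable (q1_integrable G i) e z ck kN).
rewrite -Rintegral_sum_ord//.
  apply: eq_Rintegral => w _; rewrite mulr_suml mulr_sumr; apply: eq_bigr => i _.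
  by rewrite /q1; ring.
move=> i; apply: integrable_scale => //.
exact: (Eg_integrable (q1_integrable G i) e z ck kN).
Qed.

Lemma sm_derive1_e i z : is_derive z (ebase R i) (Eg q0 k e) (sm1 k e i z).
Proof. by apply: (isd_eq (Eg_q0_derive_e G z i ck kN e0)); rewrite mulrC. Qed.

Lemma sm_derive2 i j z : is_derive z (ebase R i) (sm1 k e j) (sm2 k e i j z).
Proof.
apply: (isd_eq (is_derive_mulc e^-1 (Eg_q1_derive G z i j ck kN e0))).
by rewrite /sm2; ring.
Qed.

Lemma heat_sm (s t : R) x : s <= t ->
  Sop (Eg q0 k e) (t - s) x - Eg q0 k e x =
  \int[leb]_(r in `[s, t]) (nu * \sum_i Sop (sm2 k e i i) (r - s) x).
Proof.
move=> st; apply: (@heat_shift R n G nu nu0 (Eg q0 k e) (sm1 k e) (sm2 k e) (smB e N)) => //.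
- exact: cont_Eg (q0_integrable G) ck kN.
- exact: sm0_bound.
- exact: sm1_cont.
- exact: sm1_bound.
- exact: sm2_cont.
- exact: sm2_bound.
- exact: sm_derive1.
- exact: sm_derive2.
Qed.

Lemma sm0_lip (L : R) : (forall y z : V, `|k (y + z) - k y| <= L * `|z|) ->
  forall y z : V, `|Eg q0 k e (y + z) - Eg q0 k e y| <= L * `|z|.
Proof.
move=> kL y z; rewrite -Eg_translate.
have ct : continuous (fun x : V => k (x + z)).
  by apply: cont_comp ck; apply: contD; [exact: cont_id|exact: cont_cst].
rewrite -(EgB (q0_integrable G) e y ct (fun x : V => kN (x + z)) ck kN).
have := @Eg_bound R n G q0 (q0_integrable G) (fun x : V => k (x + z) - k x) (L * `|z|) e y.
rewrite q0_mass mulr1; apply; last by move=> x; exact: kL.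
exact: contB.
Qed.

End Smoothing.

Section TimeSmoothing.
Variables (g : R -> V -> R) (M e : R).
Hypotheses (cg : continuous (fun p : R * V => g p.1 p.2)) (gM : forall t z, `|g t z| <= M).
Hypothesis (e0 : e != 0).

Let cgs s : continuous (g s). Proof. exact: (cont_slice cg). Qed.

Lemma cont_Eg2 q : m.-integrable setT (EFin \o q) ->
  continuous (fun p : R * V => Eg q (g p.1) e p.2).
Proof.
move=> iq; apply: (Eg_continuous iq cg gM); [exact: cont_fst|exact: cont_cst|exact: cont_snd].
Qed.

Lemma cont_sm2_2 i j : continuous (fun p : R * V => sm2 (g p.1) e i j p.2).
Proof.
apply: contM; last exact: cont_cst; apply: contM; last exact: cont_cst.
exact: cont_Eg2 (q2_integrable G i j).
Qed.

(** Moves two derivatives from the mollified source to the kernel. The right-hand side is the form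
    that survives the removal of the mollification, since it is controlled by the Lipschitz constant
    alone. *)
Lemma Dop_sm2 i (r : R) x : 0 <= r ->
  Dop (fun s => sm2 (g s) e i i) r x = Dij i i (fun s => Eg q0 (g s) e) r x.
Proof.
rewrite le_eqVlt => /predU1P[<-|r0]; first by rewrite Dij0 /Dop mul0r.
rewrite /Dop /Dij /Dw -RintegralZl//; last first.
  apply: (bounded01_integrable (C := 2 * (smB e M * \int[m]_w `|q0 w|))).
    exact: (@Dw_measurable_u R n G nu q0 (fun s => sm2 (g s) e i i) (smB e M) (q0_integrable G)
      (@cont_sm2_2 i i) (fun s => sm2_bound e (@cgs s) (gM s) i i) _ r x (@measurable_lin R)).
  move=> u u01; rewrite normrM; apply: ler_pM => //; first exact: lin_le.
  apply: (Eg_bound (q0_integrable G)); first exact: (@sm2_cont _ _ e (@cgs _) (gM _) i i).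
  by move=> z; exact: (sm2_bound e (@cgs _) (gM _)).
apply: eq_Rintegral => u; rewrite inE/= in_itv/= => /andP[u0 _].
have s0 := sg_gt0 nu0 r0.
have us : u * sg r != 0 by rewrite mulf_neq0 ?gt_eqF.
set t := r * (1 - u ^+ 2).
have cE : continuous (Eg q0 (g t) e) by exact: cont_Eg (q0_integrable G) (@cgs _) (gM t).
have -> : Eg q0 (sm2 (g t) e i i) (u * sg r) x =
    (u * sg r)^-1 * ((u * sg r)^-1 * Eg (q2 i i) (Eg q0 (g t) e) (u * sg r) x).
  apply: (@Eg_D2 R n G (Eg q0 (g t) e) (sm1 (g t) e i) (sm2 (g t) e i i) (smB e M) i (u * sg r) x
    us).
  - exact: cE.
  - by move=> z; exact: (sm0_bound e (@cgs _) (gM t)).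
  - exact: (@sm1_cont _ _ e (@cgs _) (gM t) i).
  - by move=> z; exact: (sm1_bound e (@cgs _) (gM t)).
  - exact: (@sm2_cont _ _ e (@cgs _) (gM t) i i).
  - by move=> z; exact: (sm2_bound e (@cgs _) (gM t)).
  - by move=> z; exact: (sm_derive1_e (@cgs _) (gM t) e0).
  - by move=> z; exact: (sm_derive2 (@cgs _) (gM t) e0).
have E : sg r * sg r = 2 * nu * r by rewrite -expr2 sg_sqr// ltW.
move: (Eg _ _ _ _) => W; move: E s0; move: (sg r) => S E s0.
have -> : r = S * S / (2 * nu) by rewrite E; field; rewrite gt_eqF.
by field; rewrite !gt_eqF.
Qed.

(** For a mollified source, [heat_sm] writes [S(t - s) g(s) - g(s)] as an integral over [r] in
    [[s, t]]. Integrating in [s] and exchanging the order on the triangle makes the inner integral a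
    Duhamel integral up to time [r]. *)
Lemma Dop_smooth (t : R) x : 0 <= t ->
  Dop (fun s => Eg q0 (g s) e) t x =
  \int[leb]_(s in `[0, t]) Eg q0 (g s) e x +
  \int[leb]_(r in `[0, t]) (nu * \sum_i Dij i i (fun s => Eg q0 (g s) e) r x).
Proof.
move=> t0.
pose kap (s r : R) := nu * \sum_i Sop (sm2 (g s) e i i) (r - s) x.
have b2 i (s : R) z : `|sm2 (g s) e i i z| <= smB e M by exact: (sm2_bound e (@cgs _) (gM s)).
have ckap : continuous (fun p : R * R => kap p.1 p.2).
  apply: contM; first exact: cont_cst; apply: cont_sum => i.
  apply: (@Eg_continuous R n G q0 (q0_integrable G) (R * R)%type (fun s => sm2 (g s) e i i)
    (smB e M) fst (fun p => sg (p.2 - p.1)) (fun=> x) (@cont_sm2_2 i i) (b2 i)).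
  - exact: cont_fst.
  - by apply: cont_sg; apply: contB; [exact: cont_snd|exact: cont_fst].
  - exact: cont_cst.
have bS i s r : `|Sop (sm2 (g s) e i i) r x| <= smB e M.
  have := @Eg_bound R n G q0 (q0_integrable G) (sm2 (g s) e i i) (smB e M) (sg r) x.
  by rewrite q0_mass mulr1; apply; [exact: (@sm2_cont _ _ e (@cgs _) (gM s) i i)|exact: b2].
have bkap s r : `|kap s r| <= nu * (\sum_(i < n) smB e M).
  rewrite /kap normrM (ger0_norm (ltW nu0)) ler_wpM2l ?(ltW nu0)//.
  by rewrite (le_trans (ler_norm_sum _ _ _))// ler_sum.
have cS : continuous (fun s : R => Eg q0 (g s) e x).
  apply: (Eg_continuous (q0_integrable G) cg gM); [exact: cont_id|exact: cont_cst|exact: cont_cst].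
have cD : continuous (fun s : R => Sop (Eg q0 (g s) e) (t - s) x).
  apply: (@Eg_continuous R n G q0 (q0_integrable G) R (fun s => Eg q0 (g s) e) M id
    (fun s => sg (t - s)) (fun=> x)).
  - exact: cont_Eg2 (q0_integrable G).
  - by move=> s z; exact: (sm0_le e (@cgs _) (gM s)).
  - exact: cont_id.
  - by apply: cont_sg; apply: contB; [exact: cont_cst|exact: cont_id].
  - exact: cont_cst.
have iS : leb.-integrable `[0, t] (EFin \o (fun s : R => Eg q0 (g s) e x)).
  by apply: continuous_itv_integrable => u _; exact: cS.
have iD : leb.-integrable `[0, t] (EFin \o (fun s : R => Sop (Eg q0 (g s) e) (t - s) x)).
  by apply: continuous_itv_integrable => u _; exact: cD.
rewrite (@Dop_time R n G nu _ M t x)//; last 2 first.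
- exact: cont_Eg2 (q0_integrable G).
- by move=> s z; exact: (sm0_le e (@cgs _) (gM s)).
apply/eqP; rewrite addrC -subr_eq; apply/eqP.
rewrite -RintegralB//.
transitivity (\int[leb]_(s in `[0, t]) \int[leb]_(r in `[s, t]) kap s r).
  apply: eq_Rintegral => s; rewrite inE/= in_itv/= => /andP[_ st].
  exact: (heat_sm (@cgs _) (gM s) e0 x st).
rewrite (triangle_fubini t0 ckap bkap).
apply: eq_Rintegral => r; rewrite inE/= in_itv/= => /andP[r0 _].
have ci i : continuous (fun s : R => Sop (sm2 (g s) e i i) (r - s) x).
  apply: (@Eg_continuous R n G q0 (q0_integrable G) R (fun s => sm2 (g s) e i i)
    (smB e M) id (fun s => sg (r - s)) (fun=> x) (@cont_sm2_2 i i) (b2 i)).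
  - exact: cont_id.
  - by apply: cont_sg; apply: contB; [exact: cont_cst|exact: cont_id].
  - exact: cont_cst.
have ii i : leb.-integrable `[0, r] (EFin \o (fun s : R => Sop (sm2 (g s) e i i) (r - s) x)).
  by apply: continuous_itv_integrable => u _; exact: ci.
rewrite /kap RintegralZl//; last first.
  have cs : continuous (fun s : R => \sum_i Sop (sm2 (g s) e i i) (r - s) x).
    by apply: cont_sum => i; exact: ci.
  by apply: continuous_itv_integrable => u _; exact: cs.
congr (_ * _); rewrite Rintegral_sum_ord//.
apply: eq_bigr => i _; rewrite -Dop_sm2// (@Dop_time R n G nu _ (smB e M) r x)//.
exact: cont_sm2_2.
Qed.

End TimeSmoothing.

End Mollification.

Lemma cvg_inv_nat (R : realType) : (m.+1%:R^-1 : R) @[m --> \oo] --> (0 : R).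
Proof. exact: (@cvg_harmonic R). Qed.

Lemma cvg_uniqueR (R : realType) (u : nat -> R) (a b : R) :
  u m @[m --> \oo] --> a -> u m @[m --> \oo] --> b -> a = b.
Proof. by move=> ua ub; apply: (@cvg_unique _ (@norm_hausdorff _ R) _ _ a b ua ub). Qed.

Lemma cvg_sumR (R : realType) (n : nat) (f : nat -> 'I_n -> R) (a : 'I_n -> R) :
  (forall i, f m i @[m --> \oo] --> a i) -> \sum_i f m i @[m --> \oo] --> \sum_i a i.
Proof.
move=> fa; elim: (index_enum _) => [|i r IH].
  by rewrite big_nil; under eq_fun do rewrite big_nil; exact: cvg_cst.
by rewrite big_cons; under eq_fun do rewrite big_cons; apply: cvgD.
Qed.

Lemma isd_near (R : realType) (f g : R -> R) (t l e : R) : 0 < e ->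
  (forall s, `|t - s| < e -> f s = g s) -> is_derive t (1 : R) f l -> is_derive t (1 : R) g l.
Proof.
move=> e0 fg; apply: near_eq_is_derive; rewrite ?oner_eq0//.
by apply/nbhs_ballP; exists e => //= s; rewrite /ball/= => /fg ->.
Qed.

Lemma isd_integral (R : realType) (F f : R -> R) (c t : R) : 0 < t ->
  continuous f ->
  (forall s, 0 <= s <= t + 1 -> F s = c + \int[@lebesgue_measure R]_(r in `[0, s]) f r) ->
  is_derive t (1 : R) F (f t).
Proof.
move=> t0 cf FE.
have i1 : (@lebesgue_measure R).-integrable `[0, t + 1] (EFin \o f).
  by apply: continuous_itv_integrable => u _; exact: cf.
have t1 : t < t + 1 by rewrite ltrDl.
have [d1 d2] := continuous_FTC1_closed t1 i1 t0 (cf t).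
have H : is_derive t (1 : R) (fun s => \int[@lebesgue_measure R]_(r in `[0, s]) f r) (f t).
  by split; [exact: d1|rewrite -derive1E; exact: d2].
have H2 := isd_add (isd_cst c t (1 : R)) H.
apply: (@isd_near R _ F t _ (Num.min t 1) _ _ (isd_eq H2 (add0r _))).
  by rewrite lt_min t0 ltr01.
move=> s; rewrite lt_min => /andP[]; rewrite !ltr_norml => /andP[h1 h2] /andP[h3 h4].
rewrite FE//; apply/andP; split; lra.
Qed.

(** * Removing the mollification: the heat equation for initial data and source *)

Section PDE.
Context (R : realType) (n : nat) (G : gaussian_vector R n) (nu : R).
Hypothesis nu0 : 0 < nu.
Local Notation V := 'rV[R]_n.
Local Notation leb := (@lebesgue_measure R).
Local Notation I01 := (`](0 : R), (1 : R)]%classic : set R).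
Local Notation Sop := (Sop G nu).
Local Notation sg := (sg nu).
Local Notation Dop := (@Dop R n G nu).
Local Notation Dij := (@Dij R n G nu).
Local Notation Dw := (@Dw R n G nu).
Local Notation q0 := (@q0 R n G).
Local Notation q2 := (@q2 R n G).
Local Notation m := (gv_mu G).

Definition mesh (k : nat) : R := k.+1%:R^-1.

Lemma mesh_neq0 k : mesh k != 0. Proof. by rewrite invr_neq0// pnatr_eq0. Qed.

Lemma Eg_mesh_cvg (k : V -> R) (N : R) x : continuous k -> (forall z, `|k z| <= N) ->
  Eg q0 k (mesh l) x @[l --> \oo] --> k x.
Proof.
move=> ck kN.
have c : continuous (fun e : R => Eg q0 k e x).
  apply: (@Eg_continuous R n G q0 (q0_integrable G) R (fun _ => k) N (fun=> 0) id (fun=> x)) => //.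
  - by apply: (cont_comp (f := snd)) ck; exact: cont_snd.
  - exact: cont_cst.
  - exact: cont_id.
  - exact: cont_cst.
rewrite -[X in _ --> X](Eg0 G k x).
apply: (@cvg_comp _ _ _ mesh (fun e : R => Eg q0 k e x) \oo (nbhs (0 : R))); last exact: c.
exact: cvg_inv_nat.
Qed.

Lemma Sop_bound (k : V -> R) (N t : R) x : continuous k -> (forall z, `|k z| <= N) ->
  `|Sop k t x| <= N.
Proof.
move=> ck kN; have := Eg_bound (q0_integrable G) (sg t) x ck kN.
by rewrite q0_mass mulr1.
Qed.

Lemma cst_integrable (c t : R) : leb.-integrable `[0, t] (EFin \o (fun _ : R => c)).
Proof. by apply: continuous_itv_integrable => u _; exact: cvg_cst. Qed.

Lemma cont_Sop_t (k : V -> R) (N : R) x : continuous k -> (forall z, `|k z| <= N) ->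
  continuous (fun t : R => Sop k t x).
Proof.
move=> ck kN; have H := @cont_Sop_time R n G nu k N 0 x ck kN.
have -> : (fun t : R => Sop k t x) = (fun t : R => Sop k (t - 0) x).
  by apply/funext => t; rewrite subr0.
exact: H.
Qed.

Section Data.
Variables (h : V -> R) (dh : 'I_n -> V -> R) (d2h : 'I_n -> 'I_n -> V -> R) (M : R).
Hypotheses (ch : continuous h) (hM : forall z, `|h z| <= M).
Hypotheses (cdh : forall i, continuous (dh i)) (dhM : forall i z, `|dh i z| <= M).
Hypotheses (cd2h : forall i j, continuous (d2h i j)) (d2hM : forall i j z, `|d2h i j z| <= M).
Hypothesis (hD1 : forall i z, is_derive z (ebase R i) h (dh i z)).
Hypothesis (hD2 : forall i j z, is_derive z (ebase R i) (dh j) (d2h i j z)).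

(** The data are known through partial derivatives along the basis, whereas [heat_shift] wants the
    derivative in every direction. Mollified data have it; [Eg_D2] identifies their second
    derivatives with averages of [d2h], whose uniform bound allows the passage to the limit. *)
Lemma Sop_integral (t : R) x : 0 <= t ->
  Sop h t x = h x + \int[leb]_(r in `[0, t]) (nu * \sum_i Sop (d2h i i) r x).
Proof.
move=> t0; apply/eqP; rewrite addrC -subr_eq; apply/eqP.
pose he l := Eg q0 h (mesh l); pose ke l i := Eg q0 (d2h i i) (mesh l).
have che l : continuous (he l) by exact: cont_Eg (q0_integrable G) ch hM.
have cke l i : continuous (ke l i) by exact: cont_Eg (q0_integrable G) (@cd2h i i) (d2hM i i).
have bhe l z : `|he l z| <= M by exact: sm0_le.
have bke l i z : `|ke l i z| <= M by exact: (sm0_le G _ (@cd2h i i) (d2hM i i)).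
have E l : Sop (he l) t x - he l x = \int[leb]_(r in `[0, t]) (nu * \sum_i Sop (ke l i) r x).
  have := heat_sm G nu0 ch hM (mesh_neq0 l) x t0; rewrite subr0 => ->.
  apply: eq_Rintegral => r _; rewrite subr0; congr (_ * _); apply: eq_bigr => i _.
  congr (Sop _ _ _); apply/funext => z; rewrite /sm2 /ke.
  rewrite (@Eg_D2 R n G h (dh i) (d2h i i) M i (mesh l) z (mesh_neq0 l))//; first by ring.
have L1 : Sop (he l) t x - he l x @[l --> \oo] --> Sop h t x - h x.
  apply: cvgB; last exact: Eg_mesh_cvg ch hM.
  exact: (@Eg_cvg R n G q0 he h M (sg t) x (q0_integrable G) che bhe (fun z => @Eg_mesh_cvg h M z
    ch hM)).
apply: (cvg_uniqueR L1).
rewrite (_ : (fun l => _) = (fun l => \int[leb]_(r in `[0, t]) (nu * \sum_i Sop (ke l i) r x)));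
  last by apply/funext => l; exact: E.
apply: (@Rintegral_dominated_cvg R _ _ leb _ _ (fun l r => nu * \sum_i Sop (ke l i) r x)
  (fun r => nu * \sum_i Sop (d2h i i) r x) (fun=> nu * \sum_(i < n) M)) => //.
- move=> l; apply: measurable_funTS; apply: continuous_measurable_fun.
  apply: contM; first exact: cont_cst.
  by apply: cont_sum => i; exact: cont_Sop_t (cke l i) (bke l i).
- exact: cst_integrable.
- move=> l r _; rewrite normrM (gtr0_norm nu0) ler_wpM2l ?(ltW nu0)//.
  by rewrite (le_trans (ler_norm_sum _ _ _))// ler_sum// => i _; exact: Sop_bound.
- move=> r _; apply: cvgM; first exact: cvg_cst.
  apply: cvg_sumR => i.
  exact: (@Eg_cvg R n G q0 (fun l => ke l i) (d2h i i) M (sg r) x (q0_integrable G)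
    (fun l => cke l i) (fun l => bke l i) (fun z => @Eg_mesh_cvg (d2h i i) M z (@cd2h i i) (d2hM
      i i))).
Qed.

Lemma Sop_time_derive (t : R) x : 0 < t ->
  is_derive t (1 : R) (fun s => Sop h s x) (nu * \sum_i Sop (d2h i i) t x).
Proof.
move=> t0.
apply: (@isd_integral R (fun s => Sop h s x) (fun r => nu * \sum_i Sop (d2h i i) r x) (h x)) => //.
  apply: contM; first exact: cont_cst.
  by apply: cont_sum => i; exact: cont_Sop_t (@cd2h i i) (d2hM i i).
by move=> s /andP[s0 _]; exact: Sop_integral.
Qed.

End Data.

Section Source.
Variables (g : R -> V -> R) (M L : R).
Hypotheses (cg : continuous (fun p : R * V => g p.1 p.2)) (gM : forall t z, `|g t z| <= M).
Hypothesis L0 : 0 <= L.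
Hypothesis gL : forall t (y z : V), `|g t (y + z) - g t y| <= L * `|z|.

Let ge (l : nat) (s : R) (x : V) := Eg q0 (g s) (mesh l) x.
Let cgs s : continuous (g s). Proof. exact: (cont_slice cg). Qed.
Let cge l : continuous (fun p : R * V => ge l p.1 p.2).
Proof. exact: (cont_Eg2 cg gM (q0_integrable G)). Qed.
Let geM l s z : `|ge l s z| <= M. Proof. exact: (sm0_le G _ (@cgs s) (gM s)). Qed.
Let geL l s (y z : V) : `|ge l s (y + z) - ge l s y| <= L * `|z|.
Proof. exact: (sm0_lip G _ (@cgs s) (gM s) (gL s)). Qed.
Let ge_cvg s z : ge l s z @[l --> \oo] --> g s z.
Proof. exact: Eg_mesh_cvg (@cgs s) (gM s). Qed.

Lemma Dw_cvg (a : R -> R) q (C t : R) x : m.-integrable setT (EFin \o q) -> measurable_fun I01 a ->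
  (forall l u, 0 < u <= 1 -> `|a u * Eg q (ge l (t * (1 - u ^+ 2))) (u * sg t) x| <= C) ->
  Dw a q (ge l) t x @[l --> \oo] --> Dw a q g t x.
Proof.
move=> iq ma aC.
apply: (@Rintegral_dominated_cvg R _ _ leb _ _
  (fun l u => a u * Eg q (ge l (t * (1 - u ^+ 2))) (u * sg t) x)
  (fun u => a u * Eg q (g (t * (1 - u ^+ 2))) (u * sg t) x) (fun=> C)) => //.
- by move=> l; exact: (Dw_measurable_u nu iq (@cge l) (geM l) t x ma).
- exact: cst01_integrable.
- move=> u _; apply: cvgM; first exact: cvg_cst.
  apply: (@Eg_cvg R n G q (fun l => ge l (t * (1 - u ^+ 2))) _ M) => //.
  by move=> l; exact: (cont_slice (@cge l)).
Qed.

Lemma Dop_cvg (t : R) x : Dop (ge l) t x @[l --> \oo] --> Dop g t x.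
Proof.
apply: cvgM; first exact: cvg_cst.
apply: (Dw_cvg (C := 2 * (M * \int[m]_w `|q0 w|)) (q0_integrable G) (@measurable_lin R)).
move=> l u u01; rewrite normrM; apply: ler_pM => //; first exact: lin_le.
by apply: (Eg_bound (q0_integrable G)) => //; exact: (cont_slice (@cge l)).
Qed.

Lemma Dij_cvg i (t : R) x : Dij i i (ge l) t x @[l --> \oo] --> Dij i i g t x.
Proof.
apply: (@Dw_cvg (fun u => (nu * u)^-1) (q2 i i) (nu^-1 * L * sg t * gm2 G i i) t x
  (q2_integrable G i i) (measurable_nuinv nu0)).
move=> l u u01.
exact: (@Dij_integrand_bound R n G nu nu0 (ge l) M (@cge l) (geM l) L L0 (geL l) i i t t x u
  (lexx t) u01).
Qed.

(** Limit of [Dop_smooth] along the scales [mesh l]. Mollification preserves both the bound [M] and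
    the Lipschitz constant [L], so the second derivatives [Dij] are dominated uniformly in [l]. *)
Lemma Dop_integral (t : R) x : 0 <= t ->
  Dop g t x = \int[leb]_(r in `[0, t]) (g r x) +
              \int[leb]_(r in `[0, t]) (nu * \sum_i Dij i i g r x).
Proof.
move=> t0; apply: (cvg_uniqueR (@Dop_cvg t x)).
rewrite (_ : (fun l => _) = (fun l => \int[leb]_(s in `[0, t]) ge l s x +
    \int[leb]_(r in `[0, t]) (nu * \sum_i Dij i i (ge l) r x))); last first.
  by apply/funext => l; exact: (Dop_smooth G nu0 cg gM (mesh_neq0 l) x t0).
apply: cvgD.
  apply: (@Rintegral_dominated_cvg R _ _ leb _ _ (fun l s => ge l s x) (fun s => g s x)
    (fun=> M)) => //.
  - move=> l; apply: measurable_funTS; apply: continuous_measurable_fun.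
    by apply: (cont_uncurry (@cge l)); [exact: cont_id|exact: cont_cst].
  - exact: cst_integrable.
apply: (@Rintegral_dominated_cvg R _ _ leb _ _ (fun l r => nu * \sum_i Dij i i (ge l) r x)
  (fun r => nu * \sum_i Dij i i g r x) (fun=> nu * \sum_(i < n) (nu^-1 * L * sg t * gm2 G i i)))
    => //.
- move=> l.
  (* The bound behind the continuity of [Dij] holds for times below a fixed level, so time is capped
     at [t]; this changes nothing on [[0, t]]. *)
  suff H : measurable_fun (`[0, t]%classic : set R)
      (fun r : R => nu * \sum_i Dij i i (ge l) (Num.min r t) x).
    move: H; apply: eq_measurable_fun => r; rewrite inE/= in_itv/= => /andP[_ rt].
    by rewrite min_l.
  apply: measurable_funTS; apply: continuous_measurable_fun.
  apply: contM; first exact: cont_cst.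
  apply: cont_sum => i.
  apply: (@Dij_continuous R n G nu nu0 (ge l) M (@cge l) (geM l) L L0 (geL l) R i i
    (fun r => Num.min r t) t (fun=> x)).
  - by apply: cont_min; [exact: cont_id|exact: cont_cst].
  - exact: cont_cst.
  - by move=> r; rewrite ge_min lexx orbT.
- exact: cst_integrable.
- move=> l r; rewrite /= in_itv/= => /andP[_ rt].
  rewrite normrM (gtr0_norm nu0) ler_wpM2l ?(ltW nu0)//.
  rewrite (le_trans (ler_norm_sum _ _ _))// ler_sum// => i _.
  exact: (@Dij_bound R n G nu nu0 (ge l) M (@cge l) (geM l) L L0 (geL l)).
- move=> r _; apply: cvgM; first exact: cvg_cst.
  by apply: cvg_sumR => i; exact: Dij_cvg.
Qed.

Lemma Dop_time_derive (t : R) x : 0 < t ->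
  is_derive t (1 : R) (fun s => Dop g s x) (g t x + nu * \sum_i Dij i i g t x).
Proof.
move=> t0.
pose f (r : R) := g r x + nu * \sum_i Dij i i g (Num.min r (t + 1)) x.
have c1 : continuous (fun r : R => g r x).
  by apply: (cont_uncurry cg); [exact: cont_id|exact: cont_cst].
have c2 : continuous (fun r : R => nu * \sum_i Dij i i g (Num.min r (t + 1)) x).
  apply: contM; first exact: cont_cst.
  apply: cont_sum => i.
  apply: (@Dij_continuous R n G nu nu0 g M cg gM L L0 gL R i i
    (fun r => Num.min r (t + 1)) (t + 1) (fun=> x)).
  - by apply: cont_min; [exact: cont_id|exact: cont_cst].
  - exact: cont_cst.
  - by move=> r; rewrite ge_min lexx orbT.
have cf : continuous f by apply: contD.
have H : is_derive t (1 : R) (fun s => Dop g s x) (f t).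
  apply: (@isd_integral R _ f 0 t t0 cf) => s /andP[s0 st].
  rewrite add0r (Dop_integral x s0).
  have i1 : leb.-integrable `[0, s] (EFin \o (fun r : R => g r x)).
    by apply: continuous_itv_integrable => u _; exact: c1.
  have i2 : leb.-integrable `[0, s]
      (EFin \o (fun r : R => nu * \sum_i Dij i i g (Num.min r (t + 1)) x)).
    by apply: continuous_itv_integrable => u _; exact: c2.
  have ms : measurable (`[0, s]%classic : set R) by [].
  have -> : \int[leb]_(r in `[0, s]) f r = \int[leb]_(r in `[0, s]) g r x +
      \int[leb]_(r in `[0, s]) (nu * \sum_i Dij i i g (Num.min r (t + 1)) x).
    by apply: RintegralD; [exact: ms|exact: i1|exact: i2].
  apply: (congr1 (fun z => _ + z)).
  apply: eq_Rintegral => r; rewrite inE/= in_itv/= => /andP[_ rs].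
  by rewrite min_l// (le_trans rs).
by apply: (isd_eq H); rewrite /f min_l// lerDl.
Qed.

End Source.
End PDE.

(** * Maximum principle for weakly coupled systems *)

Section OneSidedTests.
Context (R : realType).

(** Only the quotients from the left are compared. This is the test needed when a space-time maximum
    sits at the final time. *)
Lemma derive_left_max (f : R -> R) (t l : R) : 0 < t -> is_derive t (1 : R) f l ->
  (forall s, 0 <= s <= t -> f s <= f t) -> 0 <= l.
Proof.
move=> t0 [df dl] fm; rewrite leNgt; apply/negP => l0.
have lN : 0 < - l by rewrite oppr_gt0.
have c : h^-1 *: ((f \o shift t) (h *: (1 : R)) - f t) @[h --> (0 : R)^'] --> l.
  by rewrite -dl; exact: df.
have /cvgrPdist_lt /(_ _ lN) H0 := c.
have /nbhs_ballP[d /= d0 dP] : nbhs (0 : R) (fun h : R => h != 0 ->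
  `|l - h^-1 *: ((f \o shift t) (h *: (1 : R)) - f t)| < - l) := H0.
pose h := Num.min (d / 2) t.
have h0 : 0 < h by rewrite lt_min divr_gt0.
have := dP (- h); rewrite /ball/= sub0r opprK (gtr0_norm h0).
have hd : h < d by rewrite /h gt_min ltr_pdivrMr// ltr_pMr// ltr1n.
move=> /(_ hd); rewrite oppr_eq0 gt_eqF// => /(_ isT).
rewrite /GRing.scale/= mulr1 => H.
have ht : h <= t by rewrite /h ge_min lexx orbT.
have F : f (- h + t) <= f t.
  by apply: fm; rewrite addrC subr_ge0 ht gerBl ltW.
have q0 : 0 <= (- h)^-1 * (f (- h + t) - f t).
  by rewrite invrN mulNr -mulrN mulr_ge0// ?invr_ge0 ?(ltW h0)// oppr_ge0 subr_le0.
move: H q0; set Q := _^-1 * _; rewrite ltr_norml => /andP[H _] q0; move: H; lra.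
Qed.

(** The one-sided test applied to [f] and to its reflection forces [f1 0 = 0]. If [l2] were
    positive, [f1] would be positive just to the right of 0, and by the mean value theorem [f] would
    exceed [f 0] there. *)
Lemma derive_local_max (f f1 : R -> R) (d l2 : R) : 0 < d ->
  (forall a, is_derive a (1 : R) f (f1 a)) -> is_derive (0 : R) (1 : R) f1 l2 ->
  (forall a, `|a| < d -> f a <= f 0) -> f1 0 = 0 /\ l2 <= 0.
Proof.
move=> d0 df [df1 dl] fm.
have d20 : 0 < d / 2 by rewrite divr_gt0.
have d2d : d / 2 < d by lra.
have ge : 0 <= f1 0.
  have H : is_derive (d / 2) (1 : R) (fun a : R => f (a - d / 2)) (f1 0).
    have dd := isd_sub (isd_id (d / 2)) (isd_cst (d / 2) (d / 2) (1 : R)).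
    have df0 : is_derive (d / 2 - d / 2) (1 : R) f (f1 0) by rewrite subrr.
    by apply: (isd_eq (@isd_comp R f (fun a => a - d / 2) _ _ _ df0 dd)); rewrite subr0 mulr1.
  apply: (derive_left_max d20 H) => s /andP[s0 s1].
  rewrite subrr; apply: fm; rewrite ler0_norm ?subr_le0//; lra.
have le : f1 0 <= 0.
  have H : is_derive (d / 2) (1 : R) (fun a : R => f (d / 2 - a)) (- f1 0).
    have dd := isd_sub (isd_cst (d / 2) (d / 2) (1 : R)) (isd_id (d / 2)).
    have df0 : is_derive (d / 2 - d / 2) (1 : R) f (f1 0) by rewrite subrr.
    by apply: (isd_eq (@isd_comp R f (fun a => d / 2 - a) _ _ _ df0 dd)); rewrite sub0r mulrN1.
  rewrite -oppr_ge0; apply: (derive_left_max d20 H) => s /andP[s0 s1].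
  rewrite subrr; apply: fm; rewrite ger0_norm ?subr_ge0//; lra.
have E : f1 0 = 0 by apply/eqP; rewrite eq_le ge le.
split => //; rewrite leNgt; apply/negP => l0.
have c : h^-1 *: ((f1 \o shift 0) (h *: (1 : R)) - f1 0) @[h --> (0 : R)^'] --> l2.
  by rewrite -dl; exact: df1.
have /cvgrPdist_lt /(_ _ l0) H0 := c.
have /nbhs_ballP[r /= r0 rP] : nbhs (0 : R) (fun h : R => h != 0 ->
  `|l2 - h^-1 *: ((f1 \o shift 0) (h *: (1 : R)) - f1 0)| < l2) := H0.
pose b := Num.min (d / 2) (r / 2).
have b0 : 0 < b by rewrite lt_min d20 divr_gt0.
have bd : b < d by rewrite (le_lt_trans _ d2d)// /b ge_min lexx.
have br : b < r.
  by rewrite (@le_lt_trans _ _ (r / 2))//; [rewrite /b ge_min lexx orbT|lra].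
have cf : {within `[0, b], continuous f}.
  apply: derivable_within_continuous => a _; have [] := df a; by [].
have [a ab fE] := @MVT _ f f1 0 b b0 (fun a _ => df a) cf.
move: ab; rewrite in_itv/= => /andP[a0 ab].
have := rP a; rewrite /ball/= sub0r normrN (gtr0_norm a0) (lt_trans ab br) => /(_ isT).
rewrite gt_eqF// => /(_ isT); rewrite E subr0 /GRing.scale/= mulr1 addr0.
rewrite ltr_norml => /andP[_ H].
have f1a : 0 < f1 a.
  have h : 0 < a^-1 * f1 a by lra.
  by move: h; rewrite pmulr_rgt0// invr_gt0.
have := fm b; rewrite (gtr0_norm b0) => /(_ bd).
have : 0 < f1 a * (b - 0) by rewrite subr0 mulr_gt0.
rewrite -fE; lra.
Qed.

End OneSidedTests.

Lemma derive_local_max_dir (R : realType) (V : normedModType R) (f f1 : V -> R) (x v : V)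
    (d l2 : R) : 0 < d ->
  (forall z, is_derive z v f (f1 z)) -> is_derive x v f1 l2 ->
  (forall a : R, `|a| < d -> f (a *: v + x) <= f x) -> f1 x = 0 /\ l2 <= 0.
Proof.
move=> d0 df /is_derive_line df1 fm.
have := @derive_local_max R (fun a => f (a *: v + x)) (fun a => f1 (a *: v + x)) d l2 d0 _ df1.
rewrite scale0r add0r; apply => // a.
by apply: is_derive_line_at; exact: df.
Qed.

Lemma cont_bigmax (R : realType) (X : topologicalType) (p : nat) (f : 'I_p -> X -> R) :
  (forall k, continuous (f k)) -> continuous (fun x => \big[Num.max/0]_(k < p) f k x).
Proof.
move=> cf; elim: p f cf => [|p IH] f cf.
  rewrite (_ : (fun x => _) = (fun=> 0)); first exact: cont_cst.
  by apply/funext => x; rewrite big_ord0.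
rewrite (_ : (fun x => _) =
  (fun x => Num.max (f ord0 x) (\big[Num.max/0]_(k < p) f (lift ord0 k) x))).
  by apply: cont_max => //; apply: IH.
by apply/funext => x; rewrite big_ord_recl.
Qed.

Lemma isd_coord (R : realType) (n : nat) (x v : 'rV[R]_n) (i : 'I_n) :
  is_derive x v (fun z : 'rV[R]_n => z 0 i) (v 0 i).
Proof.
apply/is_derive_line.
rewrite (_ : (fun a : R => _) = (fun a : R => a * v 0 i + x 0 i)); last first.
  by apply/funext => a; rewrite !mxE.
have H := isd_add (is_derive_mulc (v 0 i) (isd_id (0 : R))) (isd_cst (x 0 i) (0 : R) (1 : R)).
by apply: (isd_eq H); rewrite mul1r addr0.
Qed.

Section MaxPrinciple.
Context (R : realType) (n p : nat) (nu : R).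
Hypothesis nu0 : 0 < nu.
Local Notation V := 'rV[R]_n.
Variables (v vt : 'I_p -> R -> V -> R) (v1 v2 : 'I_p -> 'I_n -> R -> V -> R).
Variables (M B al be N tau : R).
Hypotheses (B0 : 0 <= B) (al0 : 0 <= al) (be0 : 0 <= be) (N0 : 0 < N) (tau0 : 0 <= tau).
Hypothesis cv : forall k, continuous (fun q : R * V => v k q.1 q.2).
Hypothesis vM : forall k t x, `|v k t x| <= M.
Hypothesis dvt : forall k t x, 0 < t <= tau -> is_derive t (1 : R) (fun s => v k s x) (vt k t x).
Hypothesis dv1 : forall k j t x, 0 < t <= tau -> is_derive x (ebase R j) (v k t) (v1 k j t x).
Hypothesis dv2 : forall k j t x, 0 < t <= tau ->
  is_derive x (ebase R j) (v1 k j t) (v2 k j t x).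
Hypothesis eqv : forall k t x b, 0 < t <= tau -> (forall l, `|v l t x| <= b) ->
  `|vt k t x - nu * \sum_j v2 k j t x| <= B * (\sum_j `|v1 k j t x|) + al + be * b.
Hypothesis v0 : forall k x, `|v k 0 x| <= N.

(** Exponential rate of the comparison function: [be] absorbs the zero-order term, [al / N] the
    constant term once the solution exceeds [N], and the final 1 makes the inequality strict. *)
Let la := be + al / N + 1.
(** Chosen from the penalty [w]: its Laplacian is [2 n], and the absolute values of its partial
    derivatives add up to at most [2 (n + 1) w]. *)
Let mu := 2 * nu * n%:R + 2 * B * (n%:R + 1).
Let w (x : V) : R := 1 + \sum_j x 0 j ^+ 2.

Let w1 x : 1 <= w x.
Proof. by rewrite /w lerDl sumr_ge0// => j _; exact: sqr_ge0. Qed.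

Let la0 : 0 <= la.
Proof. by rewrite /la !addr_ge0// divr_ge0// ltW. Qed.

Let mu0 : 0 <= mu.
Proof.
rewrite /mu addr_ge0//; first by rewrite !mulr_ge0// ltW.
by rewrite !mulr_ge0// addr_ge0.
Qed.

Let wgrad (x : V) : \sum_j `|2 * x 0 j| <= 2 * (n%:R + 1) * w x.
Proof.
apply: (@le_trans _ _ (\sum_j (1 + x 0 j ^+ 2))).
  apply: ler_sum => j _; rewrite ler_norml; apply/andP; split.
    by have := sqr_ge0 (1 + x 0 j); nra.
  by have := sqr_ge0 (1 - x 0 j); nra.
rewrite big_split/= sumr_const card_ord -[X in X + _]mulr1 mulr1.
have := w1 x; rewrite /w.
have : 0 <= \sum_j x 0 j ^+ 2 by rewrite sumr_ge0// => j _; exact: sqr_ge0.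
have : 0 <= (n%:R : R) by [].
move: (\sum_j _) (n%:R : R) => S m m0 S0 S1; nra.
Qed.

(** The quadratic growth of [w] confines the maximum of bounded functions to a compact set; [kap] is
    eventually sent to 0. *)
Let barrier (kap t : R) (x : V) : R := N + kap * expR (mu * t) * w x.
Let mx (t : R) (x : V) : R := \big[Num.max/0]_(k < p) `|v k t x|.
Let W (kap : R) (q : R * V) : R := mx q.1 q.2 * expR (- (la * q.1)) - barrier kap q.1 q.2.

Let mx_ge k t x : `|v k t x| <= mx t x.
Proof. exact: (le_bigmax (0 : R) (fun k => `|v k t x|) k). Qed.

Let mx_leM t x : mx t x <= Num.max 0 M.
Proof.
apply/bigmax_leP; split; first by rewrite le_max lexx.
by move=> k _; rewrite le_max vM orbT.
Qed.

Let cW kap : continuous (W kap).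
Proof.
have c1 : continuous (fun q : R * V => q.1) by exact: cont_fst.
have c2 : continuous (fun q : R * V => q.2) by exact: cont_snd.
apply: contB.
  apply: contM; first by apply: cont_bigmax => k; apply: cont_norm; exact: cv.
  by apply: cont_exp; apply: contN; apply: contM => //; exact: cont_cst.
apply: contD; first exact: cont_cst.
apply: contM.
  apply: contM; first exact: cont_cst.
  by apply: cont_exp; apply: contM => //; exact: cont_cst.
apply: contD; first exact: cont_cst.
by apply: cont_sum => j; apply: contM; exact: cont_coord.
Qed.

(** The maximum over components is not differentiable. At a positive space-time maximum of [W] it is
    replaced by [phi], the signed component that realises it: [phi] lies below [W], touches it
    there, and so satisfies the first and second order conditions. Inserting them in [eqv] gives a
    contradiction. *)
Lemma barrier_bound (kap t : R) (x : V) : 0 < kap -> 0 <= t <= tau -> W kap (t, x) <= 0.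
Proof.
move=> kap0 tt; rewrite leNgt; apply/negP => W0.
(* Once some coordinate reaches [rho], the penalty is at least [kap * rho], which exceeds every
   possible value of [mx]; the maximum is therefore interior in space. *)
pose rho := 1 + (Num.max 0 M) / kap.
have M0 : 0 <= Num.max 0 M by rewrite le_max lexx.
have rho1 : 1 <= rho by rewrite /rho lerDl divr_ge0// ltW.
have kr : Num.max 0 M <= kap * rho.
  by rewrite /rho mulrDr mulr1 mulrC divfK ?gt_eqF// lerDr ltW.
have E1 (s : R) : 0 <= s -> 1 <= expR (mu * s) by move=> s0; rewrite -expR0 ler_expR mulr_ge0.
have E2 (s : R) : 0 <= s -> expR (- (la * s)) <= 1.
  by move=> s0; rewrite -[leRHS]expR0 ler_expR oppr_le0 mulr_ge0.
have far (s : R) (y : V) j : 0 <= s -> rho <= `|y 0 j| -> W kap (s, y) < 0.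
  move=> s0 ry.
  have wy : rho <= w y.
    rewrite /w (bigD1 j)//= (@le_trans _ _ (y 0 j ^+ 2))//.
      rewrite -(@real_normK _ (y 0 j)) ?num_real//.
      by rewrite expr2 (le_trans ry)// ler_peMr// (le_trans rho1).
    by rewrite addrCA lerDl addr_ge0// sumr_ge0// => l _; exact: sqr_ge0.
  have h1 : mx s y * expR (- (la * s)) <= Num.max 0 M.
    rewrite -[leRHS]mulr1; apply: ler_pM => //; last exact: E2.
    exact: bigmax_ge_id.
  have h2 : kap * rho <= kap * expR (mu * s) * w y.
    rewrite -mulrA ler_wpM2l ?(ltW kap0)// -[leLHS]mul1r; apply: ler_pM => //.
      by rewrite (le_trans _ rho1).
    exact: E1.
  rewrite /W/= /barrier subr_lt0 (le_lt_trans h1)// (le_lt_trans kr)// (le_lt_trans h2)//.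
  by rewrite ltrDr.
pose K : set (R * V) := `[0, tau] `*` [set y : V | forall j, `[- rho, rho]%classic (y 0 j)].
have cK : compact K.
  apply: compact_setX; first exact: segment_compact.
  by apply: (@rV_compact R n (fun _ => `[- rho, rho]%classic)) => j; exact: segment_compact.
have Kx : K (t, x).
  split => //=.
  move=> j; rewrite in_itv/= -ler_norml leNgt; apply/negP => h.
  have /andP[t0 _] := tt.
  by have := far t x j t0 (ltW h); rewrite ltNge (ltW W0).
have [[t0 x0] /set_mem [/= Kt0 Kx0] maxW] :=
  @compact_EVT_max _ R (W kap) K (ex_intro _ _ Kx) cK (continuous_subspaceT (@cW kap)).
have W00 : 0 < W kap (t0, x0).
  by rewrite (lt_le_trans W0)//; apply: maxW; rewrite inE.
move: Kt0; rewrite in_itv/= => /andP[t00 t0tau].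
have t0p : 0 < t0.
  rewrite lt_neqAle t00 andbT; apply/eqP => E; move: W00.
  rewrite -E /W/= /barrier !mulr0 oppr0 expR0 !mulr1 subr_gt0 ltNge => /negP; apply.
  apply: (@le_trans _ _ N); first by apply/bigmax_leP; split => //; exact: ltW.
  by rewrite lerDl mulr_ge0 ?(ltW kap0)// (le_trans _ (w1 _)).
have t0T : 0 < t0 <= tau by rewrite t0p.
have mx0 : 0 < mx t0 x0.
  have b0 : 0 < barrier kap t0 x0.
    rewrite /barrier ltr_wpDr// !mulr_ge0 ?expR_ge0 ?(ltW kap0)//.
    exact: le_trans (w1 _).
  move: W00; rewrite /W/= subr_gt0 => /(lt_trans b0).
  by rewrite pmulr_lgt0// expR_gt0.
have [k mk] : exists k, mx t0 x0 = `|v k t0 x0|.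
  have [/existsP[k /eqP]|/existsPn no] := boolP [exists k, mx t0 x0 == `|v k t0 x0|].
    by move=> ?; exists k.
  have : mx t0 x0 < mx t0 x0; last by rewrite ltxx.
  rewrite {1}/mx; apply/bigmax_ltP; split => // l _.
  by rewrite lt_neqAle eq_sym no/= mx_ge.
(* The sign is frozen at the maximum point, so that [sn * v k] is differentiable while still bounded
   by [mx] everywhere. *)
pose sn : R := Num.sg (v k t0 x0).
have sv : sn * v k t0 x0 = `|v k t0 x0| by rewrite normrEsg.
have snle (s : R) (y : V) : sn * v k s y <= mx s y.
  apply: le_trans (mx_ge k s y); apply: (le_trans (ler_norm _)).
  rewrite normrM /sn normr_sg ler_piMl//.
  by case: (_ != 0).
have sn1 : `|sn| = 1.
  by rewrite /sn normr_sg; move: mx0; rewrite mk normr_gt0 => ->.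
pose phi (s : R) (y : V) := sn * v k s y * expR (- (la * s)) - barrier kap s y.
have phiW s y : phi s y <= W kap (s, y).
  by rewrite /phi /W/= lerD2r ler_wpM2r ?expR_ge0.
have phi0 : phi t0 x0 = W kap (t0, x0) by rewrite /phi sv -mk.
have phimax s y : K (s, y) -> phi s y <= phi t0 x0.
  by move=> Ksy; rewrite phi0 (le_trans (phiW s y))//; apply: maxW; rewrite inE.
set E := expR (- (la * t0)); have Ep : 0 < E by exact: expR_gt0.
set Em := kap * expR (mu * t0); have Emp : 0 < Em by rewrite mulr_gt0// expR_gt0.
have inter j : `|x0 0 j| < rho.
  rewrite ltNge; apply/negP => h; have := far t0 x0 j t00 h.
  by rewrite ltNge (ltW W00).
pose V0 := `|v k t0 x0| * E.
have V0N : N < V0.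
  have := W00; rewrite /W/= subr_gt0 mk -/E -/V0; apply: le_lt_trans.
  by rewrite /barrier -/Em lerDl mulr_ge0 ?(ltW Emp)// (le_trans _ (w1 _)).
have time : 0 <= sn * vt k t0 x0 * E - la * V0 - Em * mu * w x0.
  have d1 := isd_exp (is_derive_mulc (- la) (isd_id t0)).
  have d2 := is_derive_mulc sn (dvt k x0 t0T).
  have d3 := isd_mul d2 d1.
  have d4 := is_derive_mulc (kap * w x0) (isd_exp (is_derive_mulc mu (isd_id t0))).
  have d5 := isd_sub d3 (isd_add (isd_cst N t0 (1 : R)) d4).
  have H : 0 <= sn * vt k t0 x0 * E - la * V0 - Em * mu * w x0; last by [].
  apply: (derive_left_max t0p (isd_eq d5 _)).
    rewrite /V0 -sv /E /Em !mulrN (mulrC t0 la) (mulrC t0 mu).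
    by move: (expR _) (expR _) => e1 e2; ring.
  move=> s /andP[s0 st].
  have P (r : R) : v k r x0 * sn * expR (r * - la) - (N + expR (r * mu) * (kap * w x0)) = phi r x0.
    rewrite /phi /barrier mulrN (mulrC r la) (mulrC r mu).
    by move: (expR _) (expR _) => e1 e2; ring.
  rewrite /= !P; apply: phimax; split => //=.
  by rewrite in_itv/= s0 (le_trans st).
have space j : sn * v1 k j t0 x0 * E = Em * (2 * x0 0 j) /\ sn * v2 k j t0 x0 * E <= Em * 2.
  pose f z := phi t0 z.
  pose f1 z := v1 k j t0 z * (sn * E) - (2 * z 0 j) * Em.
  have wj z : is_derive z (ebase R j) w (2 * z 0 j).
    have S := @isd_sum R _ n (fun i (y : V) => y 0 i * y 0 i) z (ebase R j) _
      (fun i => isd_mul (isd_coord z (ebase R j) i) (isd_coord z (ebase R j) i)).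
    have H : is_derive z (ebase R j) w (0 + \sum_i (z 0 i * ebase R j 0 i + z 0 i * ebase R j 0
      i)) :=
      isd_add (isd_cst 1 z (ebase R j)) S.
    apply: (isd_eq H); rewrite add0r (bigD1 j)//= big1 ?addr0.
      by rewrite ebaseE eqxx mulr1 mulr_natl.
    by move=> i ij; rewrite ebaseE eq_sym (negbTE ij) mulr0 addr0.
  have df z : is_derive z (ebase R j) f (f1 z).
    have H := isd_sub (is_derive_mulc (sn * E) (dv1 k j z t0T))
      (isd_add (isd_cst N z (ebase R j)) (is_derive_mulc Em (wj z))).
    rewrite (_ : f = (fun z => v k t0 z * (sn * E) - (N + w z * Em))).
      by apply: (isd_eq H); rewrite add0r.
    by apply/funext => y; rewrite /f /phi /barrier -/E -/Em; ring.
  have df1 : is_derive x0 (ebase R j) f1 (v2 k j t0 x0 * (sn * E) - 2 * Em).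
    have c2 := is_derive_mulc (2 * Em) (isd_coord x0 (ebase R j) j).
    have H := isd_sub (is_derive_mulc (sn * E) (dv2 k j x0 t0T)) c2.
    rewrite (_ : f1 = (fun z => v1 k j t0 z * (sn * E) - z 0 j * (2 * Em))).
      by apply: (isd_eq H); rewrite ebaseE eqxx mul1r.
    by apply/funext => y; rewrite /f1; ring.
  pose dl := rho - `|x0 0 j|.
  have dl0 : 0 < dl by rewrite subr_gt0.
  have [h1 h2] : f1 x0 = 0 /\ v2 k j t0 x0 * (sn * E) - 2 * Em <= 0.
    apply: (derive_local_max_dir dl0 df df1) => a ad; apply: phimax; split => //=.
      by rewrite in_itv/= t00.
    move=> i; rewrite in_itv/= -ler_norml !mxE eqxx/=.
    case: (eqVneq i j) => [->|ij]; last by rewrite mulr0 add0r ltW.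
    rewrite mulr1 (le_trans (ler_normD _ _))//.
    by move: ad; rewrite /dl; lra.
  split; first by apply/eqP; rewrite -subr_eq0 -h1 /f1; apply/eqP; ring.
  by move: h2; rewrite subr_le0 mulrA (mulrC (v2 _ _ _ _) sn) (mulrC 2 Em).
(* The equation is used with [b] equal to [mx t0 x0], which is also [|v k t0 x0|]: the coupling of
   the components costs no more than a zero-order term in component [k]. *)
have H := eqv k t0T (fun l => le_trans (mx_ge l t0 x0) (lexx _)).
rewrite mk in H.
have H2 : sn * vt k t0 x0 * E <=
    (nu * \sum_j (sn * v2 k j t0 x0 * E)) + B * (\sum_j `|v1 k j t0 x0| * E) + al * E + be * V0.
  have h3 : sn * (vt k t0 x0 - nu * \sum_j v2 k j t0 x0) <=
      B * (\sum_j `|v1 k j t0 x0|) + al + be * `|v k t0 x0|.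
    by rewrite (le_trans (ler_norm _))// normrM sn1 mul1r.
  have h4 := ler_wpM2r (ltW Ep) h3.
  have s2 : \sum_j (sn * v2 k j t0 x0 * E) = sn * (\sum_j v2 k j t0 x0) * E.
    by rewrite mulr_sumr mulr_suml.
  have s1 : \sum_j `|v1 k j t0 x0| * E = (\sum_j `|v1 k j t0 x0|) * E by rewrite mulr_suml.
  rewrite s1 s2 /V0.
  move: h4; move: (\sum_j v2 k j t0 x0) (\sum_j `|v1 k j t0 x0|) => S2 S1; lra.
have H3 : \sum_j (sn * v2 k j t0 x0 * E) <= n%:R * (Em * 2).
  apply: (@le_trans _ _ (\sum_(j < n) (Em * 2))); first by apply: ler_sum => j _; have [] :=
    space j.
  by rewrite sumr_const card_ord mulr_natl.
have H4 : \sum_j `|v1 k j t0 x0| * E <= Em * (2 * (n%:R + 1) * w x0).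
  apply: (@le_trans _ _ (\sum_j Em * `|2 * x0 0 j|)).
    apply: ler_sum => j _; have [h _] := space j.
    rewrite -(ger0_norm (ltW Emp)) -normrM -h !normrM sn1 mul1r (ger0_norm (ltW Ep)).
    by [].
  by rewrite -mulr_sumr ler_wpM2l ?(ltW Emp).
have E1' : E <= 1 by exact: E2.
have H5 : al * E <= al by rewrite ler_piMr.
have H6 : (al / N + 1) * N = al + N by rewrite mulrDl divfK ?gt_eqF// mul1r.
have H7 : (al / N + 1) * N <= (al / N + 1) * V0.
  by rewrite ler_wpM2l ?(ltW V0N)// addr_ge0// divr_ge0// ltW.
have Q1 := ler_wpM2l (ltW nu0) H3.
have Q2 := ler_wpM2l B0 H4.
have Q3 : nu * (n%:R * (Em * 2)) <= Em * (2 * nu * n%:R) * w x0.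
  rewrite (_ : nu * _ = Em * (2 * nu * n%:R)); last by ring.
  by rewrite ler_peMr ?w1// mulr_ge0 ?(ltW Emp)// !mulr_ge0// ltW.
have Q4 : Em * mu * w x0 = Em * (2 * nu * n%:R) * w x0 + B * (Em * (2 * (n%:R + 1) * w x0)).
  by rewrite /mu; ring.
have Q5 : la * V0 = be * V0 + (al / N + 1) * V0 by rewrite /la -addrA mulrDl.
rewrite H6 in H7; rewrite Q4 Q5 in time.
(* Diffusion and drift contributions are exactly cancelled by the [mu] term, the zero-order one by
   [be]; what remains is [0 <= al - (al + N)]. *)
have fin (a b c d e f b' c' u : R) : a <= b + c + d + e -> b <= b' -> c <= c' -> b' <= u ->
    d <= al -> al + N <= f -> 0 <= a - (e + f) - (u + c') -> False by move: N0; lra.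
exact: (fin _ _ _ _ _ _ _ _ _ H2 Q1 Q2 Q3 H5 H7 time).
Qed.

(** At a fixed point the penalty is proportional to [kap], and [kap] is arbitrary. The coefficient
    [B] has gone into [mu], which disappears with the penalty, so the bound is independent of the
    drift. *)
Lemma max_principle k t x : 0 <= t <= tau ->
  `|v k t x| <= N * expR ((be + al / N + 1) * t).
Proof.
move=> tt; rewrite -/la.
have H (kap : R) : 0 < kap -> `|v k t x| * expR (- (la * t)) <= N + kap * (expR (mu * t) * w x).
  move=> kap0; have := barrier_bound x kap0 tt.
  rewrite /W/= /barrier subr_le0 mulrA; apply: le_trans.
  by rewrite ler_wpM2r ?expR_ge0// mx_ge.
have H2 : `|v k t x| * expR (- (la * t)) <= N.
  apply/ler_addgt0Pr => e e0.
  have c0 : 0 < expR (mu * t) * w x.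
    by rewrite mulr_gt0 ?expR_gt0// (lt_le_trans _ (w1 _)).
  have := H (e / (expR (mu * t) * w x)); rewrite divr_gt0// => /(_ isT).
  by rewrite divfK// gt_eqF.
have := ler_wpM2r (expR_ge0 (la * t)) H2.
by rewrite -mulrA -expRD addNr expR0 mulr1.
Qed.

End MaxPrinciple.

(** * Geometric convergence and clamped time *)

Lemma geo_small (R : realType) (c e : R) : 0 < e -> exists m, c * 2^-1 ^+ m < e.
Proof.
move=> e0.
have H : c * (2^-1 : R) ^+ m @[m --> \oo] --> c * 0.
  apply: cvgM; first exact: cvg_cst.
  by apply: cvg_expr; rewrite ger0_norm ?invr_ge0// invf_lt1// ltr1n.
rewrite mulr0 in H.
have /cvgrPdist_lt /(_ _ e0)[N _ NP] := H.
exists N; have := NP N (leqnn N); rewrite sub0r normrN; apply: le_lt_trans; exact: ler_norm.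
Qed.

Lemma geo_le (R : realType) (c a b : R) : (forall m, a <= b + c * 2^-1 ^+ m) -> a <= b.
Proof.
move=> H; apply/ler_addgt0Pr => e e0; have [m me] := geo_small c e0.
by rewrite (le_trans (H m))// lerD2l ltW.
Qed.

(** With [e m = 2 c 2^-m] one has [e m = e (m+1) + c 2^-m]. Hence [u - e] increases, [u + e]
    decreases, and the supremum of the former lies below every term of the latter. *)
Lemma geo_sup (R : realType) (u : nat -> R) (c : R) :
  (forall m, `|u m.+1 - u m| <= c * 2^-1 ^+ m) ->
  forall m, `|sup (range (fun m => u m - 2 * c * 2^-1 ^+ m)) - u m| <= 2 * c * 2^-1 ^+ m.
Proof.
move=> H.
pose e m : R := 2 * c * 2^-1 ^+ m.
have eS m : e m = e m.+1 + c * 2^-1 ^+ m by rewrite /e exprS; field.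
have c0 m : 0 <= c * 2^-1 ^+ m by rewrite (le_trans _ (H m)).
have e0 m : 0 <= e m by rewrite /e -mulrA mulr_ge0.
pose w m := u m - e m; pose v m := u m + e m.
have wS m : w m <= w m.+1.
  have := H m; rewrite ler_norml => /andP[h1 h2]; rewrite /w (eS m); lra.
have vS m : v m.+1 <= v m.
  have := H m; rewrite ler_norml => /andP[h1 h2]; rewrite /v (eS m); lra.
have wm i j : (i <= j)%N -> w i <= w j by move=> ij; exact: (homo_leq le_refl le_trans wS).
have vm i j : (i <= j)%N -> v j <= v i.
  by move=> ij; apply: (@homo_leq _ v (fun a b => b <= a)) => //; exact: ge_trans.
have wv i j : w i <= v j.
  apply: (le_trans (wm _ _ (leq_maxl i j))); apply: (le_trans _ (vm _ _ (leq_maxr i j))).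
  by rewrite /w /v lerD2l (le_trans _ (e0 _))// oppr_le0.
have nz : range w !=set0 by exists (w 0%N); exists 0%N.
have ub m : ubound (range w) (v m) by move=> _ [i _ <-]; exact: wv.
move=> m; rewrite -/(e m) -[X in sup X]/(range w) ler_norml; apply/andP; split.
  have : w m <= sup (range w).
    by apply: ub_le_sup; [exists (v 0%N); exact: ub|exists m].
  rewrite /w; lra.
have : sup (range w) <= v m by apply: ge_sup.
rewrite /v; lra.
Qed.

Lemma uniform_geo_continuous (R : realType) (X : topologicalType) (f_ : nat -> X -> R) (f : X ->
  R) (c : R) :
  (forall m, continuous (f_ m)) -> (forall m x, `|f x - f_ m x| <= c * 2^-1 ^+ m) -> continuous f.
Proof.
move=> cf H x; apply/cvgrPdist_lt => e e0.
have e3 : 0 < e / 3 by rewrite divr_gt0.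
have [m me] := geo_small c e3.
have /cvgrPdist_lt/(_ _ e3) := cf m x.
apply: filterS => y hy.
have -> : f x - f y = (f x - f_ m x) + (f_ m x - f_ m y) - (f y - f_ m y) by ring.
rewrite (le_lt_trans (ler_normB _ _))//.
have h1 := ler_normD (f x - f_ m x) (f_ m x - f_ m y).
have h2 := H m x; have h3 := H m y.
by move: h1 h2 h3 hy me; move: (c * _) => k; lra.
Qed.

(** Extends functions from [[0, T1]] to all times by constancy, so that ordinary continuity on the
    whole space can be used throughout. *)
Definition ctime (R : realType) (T1 t : R) : R := Num.max 0 (Num.min T1 t).

Lemma ctime_itv (R : realType) (T1 t : R) : 0 <= T1 -> 0 <= ctime T1 t <= T1.
Proof. by move=> T0; rewrite /ctime le_max lexx/= ge_max T0 ge_min lexx. Qed.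

Lemma ctime_id (R : realType) (T1 t : R) : 0 <= t <= T1 -> ctime T1 t = t.
Proof. by move=> /andP[t0 tT]; rewrite /ctime min_r// max_r. Qed.

Lemma cont_ctime (R : realType) (X : topologicalType) (T1 : R) (t : X -> R) :
  continuous t -> continuous (fun p => ctime T1 (t p)).
Proof.
move=> ct; apply: cont_max; first exact: cont_cst.
by apply: cont_min => //; exact: cont_cst.
Qed.

(** * Picard iteration in a weighted supremum norm *)

Section Picard.
Context (R : realType) (n p : nat) (I : finType).
Local Notation V := 'rV[R]_n.
Variables (T1 kap la : R) (A : I -> R -> V -> R) (Op : I -> (R -> V -> R) -> R -> V -> R).
Variables (c : I -> 'I_p) (Phi : 'I_p -> R -> V -> (I -> R) -> R) (M MA LA Lz Lx : R).
Hypotheses (T10 : 0 <= T1) (kap0 : 0 <= kap) (la0 : 0 <= la).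
Local Notation ct := (ctime T1).

Definition bounded_continuous (g : R -> V -> R) : Prop :=
  continuous (fun q : R * V => g q.1 q.2) /\ exists N : R, forall t z, `|g t z| <= N.

Hypothesis OpB : forall i g g' t x, bounded_continuous g -> bounded_continuous g' ->
  Op i (fun s z => g s z - g' s z) t x = Op i g t x - Op i g' t x.
Hypothesis OpT : forall i g t (x v : V), Op i (fun s z => g s (z + v)) t x = Op i g t (x + v).
Hypothesis OpC : forall i g, bounded_continuous g -> continuous (fun q : R * V => Op i g (ct q.1)
  q.2).
(** The estimate at time [t] uses the values of [g] on [[0, t]] only. This causality is what makes
    an exponential time weight effective. *)
Hypothesis OpW : forall i g (t B : R) x, bounded_continuous g -> 0 <= t <= T1 -> 0 <= B ->
  (forall s z, 0 <= s <= t -> `|g s z| <= B * expR (la * s)) ->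
  `|Op i g t x| <= kap * (B * expR (la * t)).
Hypothesis cA : forall i, continuous (fun q : R * V => A i q.1 q.2).
Hypothesis AM : forall i t x, `|A i t x| <= MA.
Hypothesis AL : forall i t (x v : V), `|A i t (x + v) - A i t x| <= LA * `|v|.
Hypothesis Act : forall i t x, A i (ct t) x = A i t x.
(** Continuity is asked along continuous families [Z], so that no topology on [I -> R] is
    involved. *)
Hypothesis PhiC : forall k (Z : I -> R -> V -> R),
  (forall i, continuous (fun q : R * V => Z i q.1 q.2)) ->
  continuous (fun q : R * V => Phi k q.1 q.2 (fun i => Z i q.1 q.2)).
Hypothesis PhiM : forall k t x z, `|Phi k t x z| <= M.
Hypotheses (Lz0 : 0 <= Lz) (Lx0 : 0 <= Lx) (LA0 : 0 <= LA) (M0 : 0 <= M) (MA0 : 0 <= MA).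
Hypothesis PhiZ : forall k t x z z', `|Phi k t x z - Phi k t x z'| <= Lz * \sum_i `|z i - z' i|.
Hypothesis PhiX : forall k t (x v : V) z, `|Phi k t (x + v) z - Phi k t x z| <= Lx * `|v|.
Hypothesis small : kap * (Lz * #|I|%:R) <= 2^-1.

Definition source_at (Z : I -> R -> V -> R) (k : 'I_p) (s : R) (x : V) : R :=
  Phi k s x (fun i => Z i s x).

Fixpoint picard_iter (m : nat) : I -> R -> V -> R :=
  if m is m'.+1 then fun i t x => A i t x + Op i (source_at (picard_iter m') (c i)) (ct t) x
  else fun _ _ _ => 0.

(** Weighted distance between the iterates 0 and 1; [picard_gap] is the same distance in the plain
    supremum norm. *)
Definition picard_step : R := MA + kap * M.
Definition picard_gap : R := picard_step * expR (la * T1).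
(* Subtracting the tail bound makes the sequence nondecreasing, so that its limit
   is a supremum. *)
Definition picard_lim (i : I) (t : R) (x : V) : R := sup (range (fun m => picard_iter m i t x - 2
  * picard_gap * 2^-1 ^+ m)).

Let ct_itv t : 0 <= ct t <= T1. Proof. exact: ctime_itv. Qed.
Let ctK t : ct (ct t) = ct t. Proof. exact: ctime_id. Qed.
Let exp1 s : 0 <= s -> 1 <= expR (la * s).
Proof. by move=> s0; rewrite -expR0 ler_expR mulr_ge0. Qed.
Let B00 : 0 <= picard_step. Proof. by rewrite addr_ge0// mulr_ge0. Qed.

Lemma source_at_bounded_continuous Z k : (forall i, continuous (fun q : R * V => Z i q.1 q.2)) ->
  bounded_continuous (source_at Z k).
Proof. by move=> picard_gap; split; [exact: PhiC|exists M => t z; exact: PhiM]. Qed.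

Lemma picard_iter_cont m i : continuous (fun q : R * V => picard_iter m i q.1 q.2).
Proof.
elim: m i => [|m IH] i /=; first exact: cont_cst.
by apply: contD => //; apply: OpC; exact: source_at_bounded_continuous.
Qed.

Lemma picard_iter_ct m i t x : picard_iter m i (ct t) x = picard_iter m i t x.
Proof. by case: m => //= m; rewrite Act ctK. Qed.

Lemma sum_bound (f : I -> R) (b : R) : (forall i, `|f i| <= b) -> \sum_i `|f i| <= #|I|%:R * b.
Proof.
move=> fb; apply: (@le_trans _ _ (\sum_(i : I) b)); first exact: ler_sum.
by rewrite sumr_const mulr_natl.
Qed.

(** The contraction estimate: the sources differ by at most [Lz] times the sum over [#|I|]
    components, [Op] contributes [kap], and [small] bounds the product by one half. *)
Lemma OpBW i Z Z' (t B : R) x : 0 <= t <= T1 -> 0 <= B ->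
  (forall j, continuous (fun q : R * V => Z j q.1 q.2)) ->
  (forall j, continuous (fun q : R * V => Z' j q.1 q.2)) ->
  (forall j s z, 0 <= s <= T1 -> `|Z j s z - Z' j s z| <= B * expR (la * s)) ->
  `|Op i (source_at Z (c i)) t x - Op i (source_at Z' (c i)) t x| <= 2^-1 * (B * expR (la * t)).
Proof.
move=> tT Bp picard_gap cZ' ZB.
have n1 := source_at_bounded_continuous (c i) picard_gap; have n2 := source_at_bounded_continuous
  (c i) cZ'.
rewrite -OpB//.
have H : `|Op i (fun s z => source_at Z (c i) s z - source_at Z' (c i) s z) t x| <=
    kap * ((Lz * #|I|%:R * B) * expR (la * t)).
  apply: OpW => //.
  - split; first exact: contB n1.1 n2.1.
    exists (M + M) => s z; rewrite (le_trans (ler_normB _ _))// lerD//; exact: PhiM.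
  - by rewrite !mulr_ge0.
  move=> s z /andP[s0 st]; rewrite (le_trans (PhiZ _ _ _ _ _))//.
  rewrite -!mulrA ler_wpM2l//; apply: sum_bound => j; apply: ZB.
  by rewrite s0 (le_trans st)//; have /andP[] := tT.
apply: (le_trans H).
rewrite (_ : kap * _ = kap * (Lz * #|I|%:R) * (B * expR (la * t))); last by ring.
by rewrite ler_wpM2r// mulr_ge0// expR_ge0.
Qed.

Lemma picard_iter_step m i (t : R) x : 0 <= t <= T1 ->
  `|picard_iter m.+1 i t x - picard_iter m i t x| <= picard_step * 2^-1 ^+ m * expR (la * t).
Proof.
elim: m i t x => [|m IH] i t x tT.
  rewrite /= subr0 expr0 mulr1 /picard_step mulrDl (le_trans (ler_normD _ _))// lerD//.
    by rewrite (le_trans (AM _ _ _))// ler_peMr// exp1//; have /andP[] := tT.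
  rewrite ctime_id// -mulrA; apply: OpW => //.
    by apply: source_at_bounded_continuous => j; exact: cont_cst.
  by move=> s z /andP[s0 _]; rewrite (le_trans (PhiM _ _ _ _))// ler_peMr// exp1.
have ZS l j s z : picard_iter l.+1 j s z = A j s z + Op j (source_at (picard_iter l) (c j)) (ct
  s) z by [].
rewrite (ZS m.+1) (ZS m) opprD addrACA subrr add0r ctime_id//.
rewrite (_ : picard_step * _ * _ = 2^-1 * (picard_step * 2^-1 ^+ m * expR (la * t))); last by
  rewrite exprS; ring.
apply: OpBW => //.
- by rewrite mulr_ge0// exprn_ge0// invr_ge0.
- exact: picard_iter_cont.
- exact: picard_iter_cont.
Qed.

Lemma picard_iter_step_unif m i t x : `|picard_iter m.+1 i t x - picard_iter m i t x| <=
  picard_gap * 2^-1 ^+ m.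
Proof.
rewrite -picard_iter_ct -(picard_iter_ct m) (le_trans (picard_iter_step _ _ _ (ct_itv t)))//.
rewrite /picard_gap mulrAC ler_wpM2r ?exprn_ge0 ?invr_ge0// ler_wpM2l// ler_expR ler_wpM2l//.
by have /andP[] := ct_itv t.
Qed.

Lemma picard_lim_approx m i t x : `|picard_lim i t x - picard_iter m i t x| <= 2 * picard_gap *
  2^-1 ^+ m.
Proof. exact: (geo_sup (fun m => picard_iter_step_unif m i t x)). Qed.

Lemma picard_lim_cont i : continuous (fun q : R * V => picard_lim i q.1 q.2).
Proof.
apply: (@uniform_geo_continuous R _ (fun m q => picard_iter m i q.1 q.2) _ (2 * picard_gap)).
- by move=> m; exact: picard_iter_cont.
- by move=> m q; exact: picard_lim_approx.
Qed.

Let cZ0 : 0 <= picard_gap. Proof. by rewrite mulr_ge0// expR_ge0. Qed.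

Lemma picard_lim_fix i t x : picard_lim i t x = A i t x + Op i (source_at picard_lim (c i)) (ct
  t) x.
Proof.
apply/eqP; rewrite -subr_eq0 -normr_eq0 eq_le normr_ge0 andbT.
apply: (@geo_le R (2 * picard_gap + picard_gap * expR (la * T1))) => m; rewrite add0r.
have h1 := picard_lim_approx m.+1 i t x.
have h2 : `|Op i (source_at (picard_iter m) (c i)) (ct t) x - Op i (source_at picard_lim (c i))
  (ct t) x| <=
    2^-1 * (2 * picard_gap * 2^-1 ^+ m * expR (la * ct t)).
  apply: OpBW => //.
  - by rewrite !mulr_ge0// exprn_ge0// invr_ge0.
  - exact: picard_iter_cont.
  - exact: picard_lim_cont.
  move=> j s z /andP[s0 _]; rewrite distrC (le_trans (picard_lim_approx _ _ _ _))// ler_peMr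
    ?exp1//.
  by rewrite !mulr_ge0// exprn_ge0// invr_ge0.
have -> : picard_lim i t x - (A i t x + Op i (source_at picard_lim (c i)) (ct t) x) =
  (picard_lim i t x - picard_iter m.+1 i t x) +
  (Op i (source_at (picard_iter m) (c i)) (ct t) x - Op i (source_at picard_lim (c i)) (ct t) x)
    by rewrite /=; ring.
rewrite (le_trans (ler_normD _ _))// mulrDl lerD//.
  rewrite (le_trans h1)// exprS mulrA; apply: ler_wpM2r; first by rewrite exprn_ge0// invr_ge0.
  by rewrite ler_piMr ?mulr_ge0// invf_le1// ler1n.
rewrite (le_trans h2)// (_ : 2^-1 * _ = picard_gap * 2^-1 ^+ m * expR (la * ct t)); last by field.
rewrite mulrAC; apply: ler_wpM2r; first by rewrite exprn_ge0// invr_ge0.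
by rewrite ler_wpM2l// ler_expR ler_wpM2l//; have /andP[] := ct_itv t.
Qed.

(** The solution [b] of [b = LA + kap * Lx + b / 2], hence a bound preserved by each iteration. *)
Definition picard_lip : R := 2 * (LA + kap * Lx).

Let B10 : 0 <= picard_lip. Proof. by rewrite mulr_ge0// addr_ge0// mulr_ge0. Qed.

(** [Op] commutes with translations, so the increment of an iterate is [Op] applied to the increment
    of the source, and the contraction argument repeats. The bound does not depend on [m] and so
    passes to the limit. *)
Lemma picard_iter_lip m i (t : R) (x v : V) : 0 <= t <= T1 ->
  `|picard_iter m i t (x + v) - picard_iter m i t x| <= picard_lip * `|v| * expR (la * t).
Proof.
elim: m i t x => [|m IH] i t x tT.
  rewrite /= subrr normr0; apply: mulr_ge0; last exact: expR_ge0.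
  by apply: mulr_ge0.
have et : 1 <= expR (la * t) by apply: exp1; have /andP[] := tT.
rewrite /= opprD addrACA ctime_id// (le_trans (ler_normD _ _))//.
have n1 := source_at_bounded_continuous (c i) (@picard_iter_cont m).
have n2 : bounded_continuous (fun s z => source_at (picard_iter m) (c i) s (z + v)).
  split; last by have [_ [N NP]] := n1; exists N.
  have cv : continuous (fun q : R * V => q.2 + v).
    by apply: contD; [exact: cont_snd|exact: cont_cst].
  by apply: (cont_uncurry n1.1) => //; exact: cont_fst.
have H : `|Op i (source_at (picard_iter m) (c i)) t (x + v) - Op i (source_at (picard_iter m) (c
  i)) t x| <=
    kap * ((Lx * `|v| + Lz * (#|I|%:R * (picard_lip * `|v|))) * expR (la * t)).
  rewrite -OpT -OpB//; apply: OpW => //.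
  - split; first exact: contB n2.1 n1.1.
    exists (M + M) => s z; rewrite (le_trans (ler_normB _ _))// lerD//; exact: PhiM.
  - by apply: addr_ge0; [exact: mulr_ge0|rewrite mulr_ge0// mulr_ge0//; exact: mulr_ge0].
  move=> s z /andP[s0 st]; rewrite /source_at.
  set zv := fun j => picard_iter m j s (z + v); set z0 := fun j => picard_iter m j s z.
  have -> : Phi (c i) s (z + v) zv - Phi (c i) s z z0 =
    (Phi (c i) s (z + v) zv - Phi (c i) s z zv) + (Phi (c i) s z zv - Phi (c i) s z z0) by ring.
  rewrite (le_trans (ler_normD _ _))// mulrDl lerD//.
    by rewrite (le_trans (PhiX _ _ _ _ _))// ler_peMr ?mulr_ge0// exp1.
  rewrite (le_trans (PhiZ _ _ _ _ _))// -mulrA ler_wpM2l// -mulrA.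
  apply: sum_bound => j; apply: IH.
  by rewrite s0 (le_trans st)//; have /andP[] := tT.
apply: (@le_trans _ _ (LA * `|v| * expR (la * t) + (kap * Lx * `|v| * expR (la * t) +
    2^-1 * (picard_lip * `|v| * expR (la * t))))).
  apply: lerD; first by rewrite (le_trans (AL _ _ _ _))// ler_peMr// mulr_ge0.
  apply: (le_trans H).
  rewrite (_ : kap * _ = kap * Lx * `|v| * expR (la * t) +
     kap * (Lz * #|I|%:R) * (picard_lip * `|v| * expR (la * t))); last by ring.
  rewrite lerD2l; apply: ler_wpM2r => //.
  by apply: mulr_ge0; [exact: mulr_ge0|exact: expR_ge0].
by rewrite le_eqVlt; apply/orP; left; apply/eqP; rewrite /picard_lip; field.
Qed.

Lemma picard_lim_lip i t (x v : V) : `|picard_lim i t (x + v) - picard_lim i t x| <= picard_lip *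
  expR (la * T1) * `|v|.
Proof.
apply: (@geo_le R (2 * (2 * picard_gap))) => m.
have h1 := picard_lim_approx m i t (x + v); have h2 := picard_lim_approx m i t x.
have h3 : `|picard_iter m i t (x + v) - picard_iter m i t x| <= picard_lip * expR (la * T1) * `|v|.
  rewrite -picard_iter_ct -[in X in _ - X]picard_iter_ct (le_trans (picard_iter_lip _ _ _ _
    (ct_itv t)))//.
  rewrite mulrAC ler_wpM2r// ler_wpM2l// ler_expR ler_wpM2l//.
  by have /andP[] := ct_itv t.
have -> : picard_lim i t (x + v) - picard_lim i t x = (picard_lim i t (x + v) - picard_iter m i t
  (x + v)) +
  (picard_iter m i t (x + v) - picard_iter m i t x) - (picard_lim i t x - picard_iter m i t x) by
    ring.
rewrite (le_trans (ler_normB _ _))//.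
have h4 := ler_normD (picard_lim i t (x + v) - picard_iter m i t (x + v)) (picard_iter m i t (x +
  v) - picard_iter m i t x).
rewrite (_ : 2 * (2 * picard_gap) * _ = 2 * picard_gap * 2^-1 ^+ m + 2 * picard_gap * 2^-1 ^+ m);
  last by ring.
by move: h1 h2 h3 h4; move: (2 * picard_gap * _) (picard_lip * _ * _) => e f; lra.
Qed.

Definition source_lip : R := Lx + Lz * (#|I|%:R * (picard_lip * expR (la * T1))).

Lemma source_lip_ge0 : 0 <= source_lip.
Proof.
rewrite addr_ge0// mulr_ge0// mulr_ge0//.
by apply: mulr_ge0; [exact: B10|exact: expR_ge0].
Qed.

Lemma source_at_Zl_lip k s (x v : V) : `|source_at picard_lim k s (x + v) - source_at picard_lim
  k s x| <= source_lip * `|v|.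
Proof.
rewrite /source_at; set zv := fun j => picard_lim j s (x + v); set z0 := fun j => picard_lim j s x.
have -> : Phi k s (x + v) zv - Phi k s x z0 =
  (Phi k s (x + v) zv - Phi k s x zv) + (Phi k s x zv - Phi k s x z0) by ring.
rewrite (le_trans (ler_normD _ _))// /source_lip mulrDl lerD//.
rewrite (le_trans (PhiZ _ _ _ _ _))// -mulrA ler_wpM2l// -mulrA.
by apply: sum_bound => j; exact: picard_lim_lip.
Qed.

End Picard.

(** * Truncation and auxiliary bounds *)

Section Clamp.
Context (R : realType).

Definition clamp (a b : R) : R := Num.max (- a) (Num.min a b).

Lemma clamp_le a b : 0 <= a -> `|clamp a b| <= a.
Proof.
move=> a0; rewrite ler_norml /clamp le_max lexx/= ge_max ge_min lexx/= andbT.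
by rewrite (le_trans _ a0)// oppr_le0.
Qed.

Lemma clamp_lip a b c : 0 <= a -> `|clamp a b - clamp a c| <= `|b - c|.
Proof.
move=> a0; have n0 := normr_ge0 (b - c); have n1 := ler_norm (b - c).
have n2 := ler_norm (c - b); rewrite distrC in n2.
rewrite /clamp ler_norml; move: n0 n1 n2; move: (`|b - c|) => N n0 n1 n2.
case: (leP a b) => h1; case: (leP a c) => h2; case: (leP (- a) a) => h3;
case: (leP (- a) b) => h4; case: (leP (- a) c) => h5; lra.
Qed.

Lemma clamp_id a b : `|b| <= a -> clamp a b = b.
Proof. by rewrite ler_norml /clamp => /andP[h1 h2]; rewrite min_r// max_r. Qed.

Lemma cont_clamp (X : topologicalType) a (f : X -> R) : continuous f -> continuous (fun x =>
  clamp a (f x)).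
Proof.
move=> cf; apply: cont_max; first exact: cont_cst.
by apply: cont_min => //; exact: cont_cst.
Qed.

End Clamp.

Lemma row_norm_le (R : realType) n (v : 'rV[R]_n) (b : R) : 0 <= b ->
  (forall j, `|v 0 j| <= b) -> `|v| <= b.
Proof.
move=> b0 H; rewrite [leLHS]mx_normrE; apply/bigmax_leP; split => // -[i j] _ /=.
by rewrite (ord1 i).
Qed.

Lemma derive_bound (R : realType) (V : normedModType R) (f : V -> R) (x v : V) (l B : R) :
  is_derive x v f l ->
  (forall e : R, e != 0 -> `|(f (x + e *: v) - f x) * e^-1| <= B) -> `|l| <= B.
Proof.
move=> [df dl] H.
have c : h^-1 *: ((f \o shift x) (h *: v) - f x) @[h --> (0 : R)^'] --> l by rewrite -dl; exact: df.
apply/ler_addgt0Pr => e e0.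
have /cvgrPdist_lt /(_ _ e0) H0 := c.
have /nbhs_ballP[d /= d0 dP] : nbhs (0 : R) (fun h : R => h != 0 ->
  `|l - h^-1 *: ((f \o shift x) (h *: v) - f x)| < e) := H0.
have d20 : 0 < d / 2 by rewrite divr_gt0.
have := dP (d / 2); rewrite /ball/= sub0r normrN gtr0_norm//.
have d2 : d / 2 < d by lra.
rewrite gt_eqF// => /(_ d2 isT).
pose q := (f (x + (d / 2) *: v) - f x) * (d / 2)^-1.
have -> : (d / 2)^-1 *: (f ((d / 2) *: v + x) - f x) = q by rewrite /q [RHS]mulrC (addrC x).
have h1 : `|q| <= B := H _ (lt0r_neq0 d20).
move=> h2.
have -> : l = q + (l - q) by ring.
by rewrite (le_trans (ler_normD _ _))// lerD// ltW.
Qed.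

Section DuhamelLinear.
Context (R : realType) (n : nat) (G : gaussian_vector R n) (nu : R).
Local Notation V := 'rV[R]_n.
Local Notation m := (gv_mu G).
Local Notation leb := (@lebesgue_measure R).
Local Notation I01 := (`](0 : R), (1 : R)]%classic : set R).

Lemma DwB (a : R -> R) (q : gv_type G -> R) (A : R) (g g' : R -> V -> R) t x :
  measurable_fun I01 a -> (forall u, 0 < u <= 1 -> `|a u| <= A) ->
  m.-integrable setT (EFin \o q) -> bounded_continuous g -> bounded_continuous g' ->
  Dw nu a q (fun s z => g s z - g' s z) t x = Dw nu a q g t x - Dw nu a q g' t x.
Proof.
move=> ma aA iq [cg [M gM]] [cg' [M' gM']].
have I (k : R -> V -> R) (N : R) : continuous (fun q : R * V => k q.1 q.2) -> (forall t z, `|k t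
  z| <= N) ->
  leb.-integrable `]0, 1] (EFin \o (fun u => a u * Eg q (k (t * (1 - u ^+ 2))) (u * sg nu t) x)).
  move=> ck kN; apply: (bounded01_integrable (C := A * (N * \int[m]_w `|q w|))).
    exact: (Dw_measurable_u nu iq ck kN t x ma).
  move=> u u01; rewrite normrM; apply: ler_pM => //; first exact: aA.
  by apply: (Eg_bound iq) => //; exact: (cont_slice ck).
rewrite /Dw -RintegralB//; [|exact: I cg gM|exact: I cg' gM'].
apply: eq_Rintegral => u _; rewrite -mulrBr; congr (_ * _).
apply: (EgB iq); [exact: (cont_slice cg)|exact: gM|exact: (cont_slice cg')|exact: gM'].
Qed.

Lemma DwT (a : R -> R) (q : gv_type G -> R) (g : R -> V -> R) t (x v : V) :
  Dw nu a q (fun s z => g s (z + v)) t x = Dw nu a q g t (x + v).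
Proof.
by apply: eq_Rintegral => u _; congr (_ * _); rewrite -Eg_translate.
Qed.

End DuhamelLinear.

(** Everything that the probabilistic part needs to know for one realisation: velocity [U], gradient
    [Q], source [g], Hessian [W]. The regularity holds up to [T1], the equation for [g] without
    truncation up to [tau] only. The Hessian is controlled for times up to [T1], hence the clamped
    time in its continuity. *)
Record solution (R : realType) (n : nat) (nu T1 tau C : R) (h : 'I_n -> 'rV[R]_n -> R)
  (eta : 'I_n -> R -> 'rV[R]_n -> R) (F : 'I_n -> R -> 'rV[R]_n -> 'rV[R]_n -> R)
  (U : 'I_n -> R -> 'rV[R]_n -> R) (Q : 'I_n -> 'I_n -> R -> 'rV[R]_n -> R)
  (g : 'I_n -> R -> 'rV[R]_n -> R) (W : 'I_n -> 'I_n -> 'I_n -> R -> 'rV[R]_n -> R) : Prop :=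
    Solution {
  sol_cU : forall k, continuous (fun q : R * 'rV[R]_n => U k q.1 q.2);
  sol_cQ : forall k j, continuous (fun q : R * 'rV[R]_n => Q k j q.1 q.2);
  sol_cg : forall k, continuous (fun q : R * 'rV[R]_n => g k q.1 q.2);
  sol_cW : forall k i j, continuous (fun q : R * 'rV[R]_n => W k i j (ctime T1 q.1) q.2);
  sol_U : forall k t x, `|U k t x| <= C;
  sol_Q : forall k j t x, `|Q k j t x| <= C;
  sol_g : forall k t x, `|g k t x| <= C;
  sol_W : forall k i j t x, t <= T1 -> `|W k i j t x| <= C;
  sol_0 : forall k x, U k 0 x = h k x;
  sol_d1 : forall k j t x, 0 <= t <= T1 -> is_derive x (ebase R j) (U k t) (Q k j t x);
  sol_d2 : forall k i j t x, 0 <= t <= T1 -> is_derive x (ebase R i) (Q k j t) (W k i j t x);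
  sol_t : forall k t x, 0 < t < T1 ->
    is_derive t (1 : R) (fun s => U k s x) (g k t x + nu * \sum_i W k i i t x);
  sol_eq : forall k t x, 0 <= t <= tau ->
    g k t x = F k t x (\row_j U j t x) - \sum_j (eta j t x + U j t x) * Q k j t x }.

(** * The truncated Burgers system *)

Section Burgers.
Context (R : realType) (n : nat) (G : gaussian_vector R n) (nu : R).
Hypothesis nu0 : 0 < nu.
Local Notation V := 'rV[R]_n.
Local Notation Sop := (Sop G nu).
Local Notation Dop := (@Dop R n G nu).
Local Notation Dj := (@Dj R n G nu).
Local Notation Dij := (@Dij R n G nu).
Variables (T1 M0 L M LA LF : R).
Hypotheses (T10 : 0 <= T1) (M00 : 0 <= M0) (L0 : 0 <= L) (Mp : 0 <= M) (LA0 : 0 <= LA) (LF0 : 0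
  <= LF).
Variables (h : 'I_n -> V -> R) (dh : 'I_n -> 'I_n -> V -> R) (d2h : 'I_n -> 'I_n -> 'I_n -> V -> R).
Variables (eta : 'I_n -> R -> V -> R) (F : 'I_n -> R -> V -> V -> R).
Hypotheses (ch : forall k, continuous (h k)) (hM : forall k z, `|h k z| <= M).
Hypotheses (cdh : forall k j, continuous (dh k j)) (dhM : forall k j z, `|dh k j z| <= M).
Hypotheses (cd2h : forall k i j, continuous (d2h k i j)) (d2hM : forall k i j z, `|d2h k i j z|
  <= M).
Hypothesis hD1 : forall k j z, is_derive z (ebase R j) (h k) (dh k j z).
Hypothesis hD2 : forall k i j z, is_derive z (ebase R i) (dh k j) (d2h k i j z).
Hypothesis hL : forall k (x v : V), `|h k (x + v) - h k x| <= LA * `|v|.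
Hypothesis dhL : forall k j (x v : V), `|dh k j (x + v) - dh k j x| <= LA * `|v|.
Hypothesis ceta : forall j, continuous (fun q : R * V => eta j q.1 q.2).
Hypothesis etaM : forall j t x, `|eta j t x| <= M.
Hypothesis etaL : forall j t (x v : V), `|eta j t (x + v) - eta j t x| <= LF * `|v|.
Hypothesis cF : forall k, continuous (fun q : R * (V * V) => F k q.1 q.2.1 q.2.2).
Hypothesis FM : forall k t x y, `|F k t x y| <= M.
Hypothesis FX : forall k t (x v y : V), `|F k t (x + v) y - F k t x y| <= LF * `|v|.
Hypothesis FY : forall k t (x y v : V), `|F k t x (y + v) - F k t x y| <= LF * `|v|.

(* The unknown is the pair of the velocity ([inl k]) and its Jacobian
   ([inr (k, j)], standing for the j-th derivative of the k-th component). *)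
Definition state_index : finType := ('I_n + 'I_n * 'I_n)%type.
Local Notation ct := (ctime T1).

(** Only the quadratic transport term is truncated. The argument of [F] is left free, as [F] is
    bounded and Lipschitz in it. *)
Definition burgers_source (k : 'I_n) (t : R) (x : V) (z : state_index -> R) : R :=
  F k t x (\row_j z (inl j)) -
  \sum_j (eta j t x + clamp M0 (z (inl j))) * clamp L (z (inr (k, j))).
Definition burgers_init (i : state_index) (t : R) (x : V) : R :=
  match i with inl k => Sop (h k) (ct t) x | inr p => Sop (dh p.1 p.2) (ct t) x end.
Definition burgers_duhamel (i : state_index) (g : R -> V -> R) (t : R) (x : V) : R :=
  match i with inl _ => Dop g t x | inr p => Dj p.2 g t x end.
Definition state_component (i : state_index) : 'I_n := match i with inl k => k | inr p => p.1 end.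

Definition source_bound : R := M + n%:R * ((M + M0) * L).
Definition source_lip_z : R := LF + n%:R * (M + M0 + L).
Definition source_lip_x : R := LF + n%:R * (LF * L).
(** Sum of the constants of [Dop_weighted] and of all the [Dj_weighted], so that one constant serves
    every component of the state. *)
Definition duhamel_const : R := 4 * Num.sqrt T1 +
  \sum_j (4 * (\int[gv_mu G]_w `|@q1 R n G j w|) / Num.sqrt (2 * nu)).
(** Its square root is [2 * duhamel_const * source_lip_z * #|state_index| + 1]: the factor 2 yields
    the contraction ratio one half, and the 1 keeps the weight positive. *)
Definition weight : R := (2 * duhamel_const * source_lip_z * #|state_index|%:R + 1) ^+ 2.
Definition contraction : R := duhamel_const / Num.sqrt weight.

Local Notation Zb := (picard_lim T1 contraction weight burgers_init burgers_duhamel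
  state_component burgers_source source_bound M).
Definition burgers_u (k : 'I_n) : R -> V -> R := Zb (inl k).
Definition burgers_grad (k j : 'I_n) : R -> V -> R := Zb (inr (k, j)).
Definition burgers_rhs (k : 'I_n) : R -> V -> R := source_at burgers_source Zb k.
Definition burgers_hess (k i j : 'I_n) (t : R) (x : V) : R := Sop (d2h k i j) t x + Dij i j
  (burgers_rhs k) t x.

Let ct_itv t : 0 <= ct t <= T1. Proof. exact: ctime_itv. Qed.
Let ct0 t : 0 <= ct t. Proof. by have /andP[] := ct_itv t. Qed.

Let term_ge0 j : 0 <= 4 * (\int[gv_mu G]_w `|@q1 R n G j w|) / Num.sqrt (2 * nu).
Proof. by rewrite divr_ge0 ?sqrtr_ge0// mulr_ge0// Rintegral_ge0. Qed.
Let Kq0 : 0 <= duhamel_const.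
Proof. by rewrite addr_ge0 ?mulr_ge0 ?sqrtr_ge0// sumr_ge0. Qed.
Let Lz0 : 0 <= source_lip_z. Proof. by rewrite addr_ge0// mulr_ge0// !addr_ge0. Qed.
Let Lx0 : 0 <= source_lip_x. Proof. by rewrite addr_ge0// !mulr_ge0. Qed.
Let MP0 : 0 <= source_bound. Proof. by rewrite addr_ge0// mulr_ge0// mulr_ge0// addr_ge0. Qed.
Let sla_gt0 : 0 < 2 * duhamel_const * source_lip_z * #|state_index|%:R + 1.
Proof. by rewrite ltr_wpDl// !mulr_ge0. Qed.
Let la_gt0 : 0 < weight. Proof. by rewrite exprn_gt0. Qed.
Let la_ge0 : 0 <= weight. Proof. exact: ltW. Qed.
Let sla : Num.sqrt weight = 2 * duhamel_const * source_lip_z * #|state_index|%:R + 1.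
Proof. by rewrite sqrtr_sqr gtr0_norm. Qed.
Let kap0 : 0 <= contraction. Proof. by rewrite divr_ge0// sqrtr_ge0. Qed.
Let smallN : contraction * (source_lip_z * #|state_index|%:R) <= 2^-1.
Proof.
rewrite /contraction sla mulrAC ler_pdivrMr//.
by rewrite mulrDr mulr1 !mulrA mulVf ?mul1r ?lerDl ?invr_ge0// pnatr_eq0.
Qed.

Let hOpB : forall i g g' t x, bounded_continuous g -> bounded_continuous g' ->
  burgers_duhamel i (fun s z => g s z - g' s z) t x = burgers_duhamel i g t x - burgers_duhamel i
    g' t x.
Proof.
move=> [k|[k j]] g g' t x ng ng' /=; rewrite /Dop /Dj -mulrBr; congr (_ * _).
  apply: (@DwB R n G nu (fun u => 2 * u) _ 2) => //.
  - exact: measurable_lin.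
  - by move=> u; exact: lin_le.
  - exact: q0_integrable.
apply: (@DwB R n G nu (fun=> 2) _ 2) => //; [by move=> u _; rewrite ger0_norm|exact: q1_integrable].
Qed.

Let hOpT : forall i g t (x v : V), burgers_duhamel i (fun s z => g s (z + v)) t x =
  burgers_duhamel i g t (x + v).
Proof.
by move=> [k|[k j]] g t x v /=; rewrite /Dop /Dj DwT.
Qed.

Let hOpC : forall i g, bounded_continuous g -> continuous (fun q : R * V => burgers_duhamel i g
  (ct q.1) q.2).
Proof.
have cc : continuous (fun q : R * V => ct q.1) by apply: cont_ctime; exact: cont_fst.
move=> [k|[k j]] g [cg [N gN]] /=.
  by apply: (@Dop_continuous R n G nu g N cg gN (R * V)%type (fun q => ct q.1) snd) => //; exact:
    cont_snd.
by apply: (@Dj_continuous R n G nu g N cg gN (R * V)%type j (fun q => ct q.1) snd) => //; exact: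
  cont_snd.
Qed.

Let hOpW : forall i g (t B : R) x, bounded_continuous g -> 0 <= t <= T1 -> 0 <= B ->
  (forall s z, 0 <= s <= t -> `|g s z| <= B * expR (weight * s)) ->
  `|burgers_duhamel i g t x| <= contraction * (B * expR (weight * t)).
Proof.
move=> i g t B x [cg [N gN]] tT Bp gB.
have Be : 0 <= B * expR (weight * t) by rewrite mulr_ge0// expR_ge0.
case: i => [k|[k j]] /=.
  apply: (le_trans (Dop_weighted G nu cg gN x la_gt0 tT gB)).
  rewrite ler_wpM2r// /contraction ler_wpM2r ?invr_ge0 ?sqrtr_ge0//.
  by rewrite /duhamel_const lerDl sumr_ge0.
have /andP[t0 _] := tT.
apply: (le_trans (Dj_weighted G nu0 cg gN x j la_gt0 t0 gB)).
rewrite ler_wpM2r// /contraction ler_wpM2r ?invr_ge0 ?sqrtr_ge0//.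
rewrite /duhamel_const (bigD1 j)//= addrCA lerDl addr_ge0 ?mulr_ge0 ?sqrtr_ge0//.
by rewrite sumr_ge0.
Qed.

Let cont_SN (k : V -> R) (N : R) : continuous k -> (forall z, `|k z| <= N) ->
  continuous (fun q : R * V => Sop k (ct q.1) q.2).
Proof.
move=> ck kN.
apply: (@Eg_continuous R n G _ (q0_integrable G) (R * V)%type (fun _ => k) N (fun=> 0)
  (fun q => sg nu (ct q.1)) snd) => //.
- by apply: (cont_comp (f := snd)) ck; exact: cont_snd.
- exact: cont_cst.
- by apply: cont_sg; apply: cont_ctime; exact: cont_fst.
- exact: cont_snd.
Qed.

Lemma Sop_lip (k : V -> R) (N l t : R) : continuous k -> (forall z, `|k z| <= N) ->
  (forall x v : V, `|k (x + v) - k x| <= l * `|v|) ->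
  forall x v : V, `|Sop k t (x + v) - Sop k t x| <= l * `|v|.
Proof. by move=> ck kN kl x v; exact: (sm0_lip G (sg nu t) ck kN kl). Qed.

Let cAN : forall i, continuous (fun q : R * V => burgers_init i q.1 q.2).
Proof.
move=> [k|[k j]]; first exact: cont_SN (@ch k) (@hM k).
exact: cont_SN (@cdh k j) (@dhM k j).
Qed.

Let ANM : forall i t x, `|burgers_init i t x| <= M.
Proof.
move=> [k|[k j]] t x; first exact: (Sop_bound G nu (ct t) x (@ch k) (@hM k)).
exact: (Sop_bound G nu (ct t) x (@cdh k j) (@dhM k j)).
Qed.

Let ANL : forall i t (x v : V), `|burgers_init i t (x + v) - burgers_init i t x| <= LA * `|v|.
Proof.
move=> [k|[k j]] t x v; first exact: (@Sop_lip (h k) M LA (ct t) (@ch k) (@hM k) (hL k)).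
exact: (@Sop_lip (dh k j) M LA (ct t) (@cdh k j) (@dhM k j) (dhL k j)).
Qed.

Let ANct : forall i t x, burgers_init i (ct t) x = burgers_init i t x.
Proof. by move=> [k|p] t x; rewrite /burgers_init ctime_id. Qed.

Let hPhiC : forall k (Z : state_index -> R -> V -> R),
  (forall i, continuous (fun q : R * V => Z i q.1 q.2)) ->
  continuous (fun q : R * V => burgers_source k q.1 q.2 (fun i => Z i q.1 q.2)).
Proof.
move=> k Z picard_gap; apply: contB.
  have cp : continuous (fun q : R * V => (q.1, (q.2, \row_j Z (inl j) q.1 q.2 : V))).
    apply: cont_pair; first exact: cont_fst.
    by apply: cont_pair; [exact: cont_snd|apply: cont_row => j; exact: picard_gap].
  exact: (cont_comp cp (@cF k)).
apply: cont_sum => j; apply: contM.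
  by apply: contD; [exact: ceta|apply: cont_clamp; exact: picard_gap].
by apply: cont_clamp; exact: picard_gap.
Qed.

Let hPhiM : forall k t x z, `|burgers_source k t x z| <= source_bound.
Proof.
move=> k t x z; rewrite (le_trans (ler_normB _ _))// lerD//.
rewrite (le_trans (ler_norm_sum _ _ _))//.
apply: (@le_trans _ _ (\sum_(j < n) ((M + M0) * L))).
  apply: ler_sum => j _; rewrite normrM; apply: ler_pM => //; last exact: clamp_le.
  by rewrite (le_trans (ler_normD _ _))// lerD// clamp_le.
by rewrite sumr_const card_ord mulr_natl.
Qed.

Let one_le (f : state_index -> R) i : `|f i| <= \sum_j `|f j|.
Proof. by rewrite (bigD1 i)//= lerDl sumr_ge0. Qed.

Let hPhiZ : forall k t x z z', `|burgers_source k t x z - burgers_source k t x z'| <=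
  source_lip_z * \sum_i `|z i - z' i|.
Proof.
move=> k t x z z'; set S := \sum_i _.
have S0 : 0 <= S by exact: sumr_ge0.
have H i : `|z i - z' i| <= S by exact: (one_le (fun i => z i - z' i)).
have dec (a b s s' : R) : a - s - (b - s') = (a - b) + (s' - s) by ring.
rewrite /burgers_source dec -sumrB.
rewrite (le_trans (ler_normD _ _))// /source_lip_z mulrDl lerD//.
  have -> : \row_j z (inl j) = \row_j z' (inl j) + (\row_j z (inl j) - \row_j z' (inl j)) :> V.
    by rewrite addrC subrK.
  rewrite (le_trans (FY _ _ _ _ _))// ler_wpM2l//; apply: row_norm_le => // j.
  by rewrite !mxE.
rewrite (le_trans (ler_norm_sum _ _ _))//.
apply: (@le_trans _ _ (\sum_(j < n) ((M + M0 + L) * S))); last first.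
  by rewrite sumr_const card_ord -mulrA mulr_natl.
apply: ler_sum => j _.
set a := clamp M0 (z _); set a' := clamp M0 (z' _); set b := clamp L (z _); set b' := clamp L (z'
  _).
have -> : (eta j t x + a') * b' - (eta j t x + a) * b =
  (eta j t x + a') * (b' - b) + (a' - a) * b by ring.
have h1 : `|a' - a| <= S by rewrite (le_trans (clamp_lip _ _ M00))// distrC.
have h2 : `|b' - b| <= S by rewrite (le_trans (clamp_lip _ _ L0))// distrC.
rewrite (le_trans (ler_normD _ _))// !normrM mulrDl lerD//.
  by apply: ler_pM => //; rewrite (le_trans (ler_normD _ _))// lerD// clamp_le.
by rewrite mulrC; apply: ler_pM => //; exact: clamp_le.
Qed.

Let hPhiX : forall k t (x v : V) z, `|burgers_source k t (x + v) z - burgers_source k t x z| <=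
  source_lip_x * `|v|.
Proof.
move=> k t x v z.
have dec (a b s s' : R) : a - s - (b - s') = (a - b) + (s' - s) by ring.
rewrite /burgers_source dec -sumrB.
rewrite (le_trans (ler_normD _ _))// /source_lip_x mulrDl lerD//.
rewrite (le_trans (ler_norm_sum _ _ _))//.
apply: (@le_trans _ _ (\sum_(j < n) (LF * L * `|v|))); last first.
  by rewrite sumr_const card_ord -(mulr_natl (LF * L * `|v|)) mulrA.
apply: ler_sum => j _; set b := clamp L _; set a := clamp M0 _.
have -> : (eta j t x + a) * b - (eta j t (x + v) + a) * b = (eta j t x - eta j t (x + v)) * b by
  ring.
rewrite normrM mulrAC; apply: ler_pM => //; last exact: clamp_le.
by rewrite distrC.
Qed.

Lemma Zb_cont i : continuous (fun q : R * V => Zb i q.1 q.2).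
Proof.
exact: (@picard_lim_cont R n n state_index T1 contraction weight burgers_init burgers_duhamel
  state_component burgers_source source_bound M source_lip_z T10 kap0 la_ge0 hOpB hOpC hOpW cAN
    ANM ANct hPhiC hPhiM Lz0 MP0 Mp hPhiZ smallN i).
Qed.

Lemma Zmn_cont m i : continuous (fun q : R * V => picard_iter T1 burgers_init burgers_duhamel
  state_component burgers_source m i q.1 q.2).
Proof. exact: (@picard_iter_cont R n n state_index T1 burgers_init burgers_duhamel
  state_component burgers_source source_bound hOpC cAN hPhiC hPhiM m i). Qed.

Lemma Zb_approx m i t x : `|Zb i t x - picard_iter T1 burgers_init burgers_duhamel
  state_component burgers_source m i t x| <=
  2 * picard_gap T1 contraction weight source_bound M * 2^-1 ^+ m.
Proof. exact: (picard_lim_approx state_component T10 kap0 la_ge0 hOpB hOpC hOpW cAN ANM ANct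
  hPhiC hPhiM Lz0 MP0 Mp hPhiZ smallN). Qed.

Lemma Zb_bound i t x : `|Zb i t x| <= 2 * picard_gap T1 contraction weight source_bound M.
Proof.
have := picard_lim_approx state_component T10 kap0 la_ge0 hOpB hOpC hOpW cAN ANM ANct hPhiC hPhiM
  Lz0 MP0 Mp hPhiZ smallN 0%N i t x.
by rewrite /= subr0 expr0 mulr1.
Qed.

Lemma Zb_fix i t x : Zb i t x = burgers_init i t x + burgers_duhamel i (burgers_rhs
  (state_component i)) (ct t) x.
Proof.
exact: (picard_lim_fix state_component T10 kap0 la_ge0 hOpB hOpC hOpW cAN ANM ANct hPhiC hPhiM
  Lz0 MP0 Mp hPhiZ smallN).
Qed.

Lemma burgers_rhs_cont k : continuous (fun q : R * V => burgers_rhs k q.1 q.2).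
Proof. by apply: hPhiC; exact: Zb_cont. Qed.

Lemma burgers_rhs_le k t x : `|burgers_rhs k t x| <= source_bound.
Proof. exact: hPhiM. Qed.

Definition rhs_lip_const : R := source_lip state_index T1 contraction weight LA source_lip_z
  source_lip_x.

Lemma burgers_rhs_lip k t (x v : V) : `|burgers_rhs k t (x + v) - burgers_rhs k t x| <=
  rhs_lip_const * `|v|.
Proof.
exact: (source_at_Zl_lip state_component T10 kap0 la_ge0 hOpB hOpT hOpC hOpW cAN ANM ANL ANct
  hPhiC hPhiM
  Lz0 Lx0 LA0 MP0 Mp hPhiZ hPhiX smallN).
Qed.

Lemma rhs_lip_const_ge0 : 0 <= rhs_lip_const.
Proof. exact: (source_lip_ge0 state_index T1 weight kap0 Lz0 Lx0 LA0). Qed.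

Lemma burgers_u_eq k t x : 0 <= t <= T1 -> burgers_u k t x = Sop (h k) t x + Dop (burgers_rhs k)
  t x.
Proof. by move=> tT; rewrite /burgers_u Zb_fix /= ctime_id. Qed.

Lemma burgers_grad_eq k j t x : 0 <= t <= T1 -> burgers_grad k j t x = Sop (dh k j) t x + Dj j
  (burgers_rhs k) t x.
Proof. by move=> tT; rewrite /burgers_grad Zb_fix /= ctime_id. Qed.

Lemma burgers_u0 k x : burgers_u k 0 x = h k x.
Proof. by rewrite burgers_u_eq ?lexx// Sop0 /Dop mul0r addr0. Qed.

Lemma burgers_u_derive k j t x : 0 <= t <= T1 -> is_derive x (ebase R j) (burgers_u k t)
  (burgers_grad k j t x).
Proof.
move=> tT; have /andP[t0 _] := tT.
have -> : burgers_u k t = (fun y => Sop (h k) t y + Dop (burgers_rhs k) t y) by apply/funext =>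
  y; exact: burgers_u_eq.
rewrite burgers_grad_eq//; apply: isd_add.
  exact: (Eg_derive (q0_integrable G) (sg nu t) x (@ch k) (@cdh k j) (@hM k) (@dhM k j) (hD1 k j)).
exact: (Dop_derive G nu0 (@burgers_rhs_cont k) (burgers_rhs_le k)).
Qed.

Lemma burgers_grad_derive k i j t x : 0 <= t <= T1 -> is_derive x (ebase R i) (burgers_grad k j
  t) (burgers_hess k i j t x).
Proof.
move=> tT; have /andP[t0 _] := tT.
have -> : burgers_grad k j t = (fun y => Sop (dh k j) t y + Dj j (burgers_rhs k) t y) by
  apply/funext => y; exact: burgers_grad_eq.
apply: isd_add.
  exact: (Eg_derive (q0_integrable G) (sg nu t) x (@cdh k j) (@cd2h k i j) (@dhM k j) (@d2hM k i
    j) (hD2 k i j)).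
exact: (Dj_derive G nu0 (@burgers_rhs_cont k) (burgers_rhs_le k) rhs_lip_const_ge0
  (burgers_rhs_lip k)).
Qed.

Lemma burgers_u_time_derive k t x : 0 < t < T1 ->
  is_derive t (1 : R) (fun s => burgers_u k s x) (burgers_rhs k t x + nu * \sum_i burgers_hess k
    i i t x).
Proof.
move=> /andP[t0 tT].
have H1 := Sop_time_derive G nu0 (@ch k) (@hM k) (@cdh k) (@dhM k) (@cd2h k) (@d2hM k)
  (hD1 k) (hD2 k) x t0.
have H2 := Dop_time_derive G nu0 (@burgers_rhs_cont k) (burgers_rhs_le k) rhs_lip_const_ge0
  (burgers_rhs_lip k) x t0.
have H := isd_add H1 H2.
have e0 : 0 < Num.min t (T1 - t) by rewrite lt_min t0 subr_gt0.
apply: (isd_near e0 _ (isd_eq H _)).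
  move=> s; rewrite lt_min => /andP[]; rewrite !ltr_norml => /andP[h1 h2] /andP[h3 h4].
  rewrite burgers_u_eq//; apply/andP; split; lra.
by rewrite /burgers_hess big_split/=; ring.
Qed.

Lemma burgers_hess_cont k i j : continuous (fun q : R * V => burgers_hess k i j (ct q.1) q.2).
Proof.
apply: contD; first exact: cont_SN (@cd2h k i j) (@d2hM k i j).
apply: (@Dij_continuous R n G nu nu0 (burgers_rhs k) source_bound (@burgers_rhs_cont k)
  (burgers_rhs_le k) rhs_lip_const rhs_lip_const_ge0 (burgers_rhs_lip k)
  (R * V)%type i j (fun q => ct q.1) T1 snd).
- by apply: cont_ctime; exact: cont_fst.
- exact: cont_snd.
- by move=> q; have /andP[] := ct_itv q.1.
Qed.

Definition hess_bound : R := M + \sum_i \sum_j (nu^-1 * rhs_lip_const * sg nu T1 * gm2 G i j).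

Lemma burgers_hess_bound k i j t x : t <= T1 -> `|burgers_hess k i j t x| <= hess_bound.
Proof.
have tm i' j' : 0 <= nu^-1 * rhs_lip_const * sg nu T1 * gm2 G i' j'.
  by rewrite !mulr_ge0 ?invr_ge0 ?(ltW nu0)// ?rhs_lip_const_ge0 ?sg_ge0 ?gm2_ge0.
move=> tT; rewrite (le_trans (ler_normD _ _))// lerD//.
  exact: (Sop_bound G nu t x (@cd2h k i j) (@d2hM k i j)).
apply: (le_trans (Dij_bound G nu0 (@burgers_rhs_cont k) (burgers_rhs_le k) rhs_lip_const_ge0
  (burgers_rhs_lip k) i j x tT)).
rewrite (bigD1 i)//= (bigD1 j)//= -addrA lerDl addr_ge0//; first by rewrite sumr_ge0.
by rewrite sumr_ge0// => i' _; rewrite sumr_ge0.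
Qed.

Lemma source_iter_cont m k : continuous (fun q : R * V => source_at burgers_source (picard_iter
  T1 burgers_init burgers_duhamel state_component burgers_source m) k q.1 q.2).
Proof. by apply: hPhiC; exact: Zmn_cont. Qed.

Lemma burgers_rhsE k t x : burgers_rhs k t x = F k t x (\row_j burgers_u j t x) -
  \sum_j (eta j t x + clamp M0 (burgers_u j t x)) * clamp L (burgers_grad k j t x).
Proof. by []. Qed.

Section Apriori.
Variables (K tau : R).
Hypotheses (K0 : 0 <= K) (tauT : tau < T1).
Hypothesis hK : forall k i x (e : R), `|h k (x + e *: ebase R i) - h k x| <= K * `|e|.
Hypothesis etaK : forall j i t x (e : R), `|eta j t (x + e *: ebase R i) - eta j t x| <= K * `|e|.
Hypothesis FXK : forall k i t x y (e : R), `|F k t (x + e *: ebase R i) y - F k t x y| <= K * `|e|.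
Hypothesis FYK : forall k t x (y v : V) (b : R), (forall l, `|v 0 l| <= b) ->
  `|F k t x (y + v) - F k t x y| <= n%:R * K * b.

(** In the equation of a difference quotient of [u], these are the contributions free of the
    quotients: [K] from [F] in [x], and [K * L] per coordinate from [eta] against the truncated
    gradient. [apriori_rate] collects the coefficients of the quotients: [n K] from [F] in [y], and
    [n L] from the increment of [u] against the truncated gradient. *)
Definition apriori_const : R := K + n%:R * (K * L).
Definition apriori_rate : R := n%:R * K + n%:R * L.

Let tauI t : 0 < t <= tau -> 0 < t < T1.
Proof. by move=> /andP[-> h1]; rewrite (le_lt_trans h1). Qed.
Let tauI' t : 0 < t <= tau -> 0 <= t <= T1.
Proof. by move=> /tauI/andP[h1 h2]; rewrite !ltW. Qed.
Let tauI0 t : 0 <= t <= tau -> 0 <= t <= T1.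
Proof. by move=> /andP[-> h1]; rewrite (le_trans h1)// ltW. Qed.

(** Maximum principle with drift [M + M0], [al = M], [be = 0] and [N = M + 1], so the rate
    [M / (M + 1) + 1] is at most 2. The truncation level [M0] is absent from the bound, which is why
    it can later be taken equal to it. *)
Lemma burgers_u_le k t x : 0 <= t <= tau -> `|burgers_u k t x| <= (M + 1) * expR (2 * T1).
Proof.
move=> tT.
have M1 : 0 < M + 1 by rewrite ltr_wpDl.
have H := @max_principle R n n nu nu0 burgers_u (fun k t x => burgers_rhs k t x + nu * \sum_i
  burgers_hess k i i t x)
  burgers_grad (fun k i => burgers_hess k i i) (2 * picard_gap T1 contraction weight source_bound
    M) (M + M0) M 0 (M + 1) tau
  (addr_ge0 Mp M00) Mp (lexx 0) M1.
have {H} := H (fun k => @Zb_cont (inl k)) (fun k => Zb_bound (inl k)).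
move=> H; have {H} := H (fun k t x tt => burgers_u_time_derive k x (tauI tt))
  (fun k j t x tt => burgers_u_derive k j x (tauI' tt)) (fun k j t x tt => burgers_grad_derive k
    j j x (tauI' tt)).
move=> H; have {H} H := H _ _ k t x tT; apply: (le_trans (H _ _)).
- clear H tT; move=> {}k {}t {}x b _ _; rewrite mul0r addr0 addrK burgers_rhsE.
  rewrite (le_trans (ler_normB _ _))// addrC lerD//.
  rewrite (le_trans (ler_norm_sum _ _ _))// mulr_sumr ler_sum// => j _.
  rewrite normrM; apply: ler_pM => //.
    by rewrite (le_trans (ler_normD _ _))// lerD// clamp_le.
  have := clamp_lip (burgers_grad k j t x) 0 L0; rewrite (clamp_id (b := 0)) ?normr0// !subr0;
    exact.
- by clear H; move=> {}k {}x; rewrite burgers_u0 (le_trans (hM _ _))// lerDl.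
rewrite ler_wpM2l ?(ltW M1)// ler_expR; apply: ler_pM.
- by rewrite add0r addr_ge0// divr_ge0// ltW.
- by have /andP[] := tT.
- have : M / (M + 1) <= 1 by rewrite ler_pdivrMr// mul1r lerDl.
  lra.
- by have /andP[_ le_tT] := tauI0 tT.
Qed.

(** The maximum principle is applied to difference quotients because the gradient lacks the
    regularity to satisfy an equation itself, while the quotients inherit that of [u]. Increments of
    the truncated gradient are put into the drift term, which the bound does not see. Initially the
    quotients are at most [K]; the level [K + 1] is taken to be positive. *)
Lemma burgers_grad_quotient k i (e : R) t x : e != 0 -> 0 <= t <= tau ->
  `|(burgers_u k t (x + e *: ebase R i) - burgers_u k t x) * e^-1| <=
    (K + 1) * expR ((apriori_rate + apriori_const / (K + 1) + 1) * t).
Proof.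
move=> e0 tT; set c := e *: ebase R i.
have K1 : 0 < K + 1 by rewrite ltr_wpDl.
have al0 : 0 <= apriori_const by rewrite addr_ge0// !mulr_ge0.
have be0 : 0 <= apriori_rate by rewrite addr_ge0// !mulr_ge0.
pose v k t x := (burgers_u k t (x + c) - burgers_u k t x) * e^-1.
pose v1 k j t x := (burgers_grad k j t (x + c) - burgers_grad k j t x) * e^-1.
pose v2 k j t x := (burgers_hess k j j t (x + c) - burgers_hess k j j t x) * e^-1.
pose gt k t x := burgers_rhs k t x + nu * \sum_i burgers_hess k i i t x.
pose vt k t x := (gt k t (x + c) - gt k t x) * e^-1.
have eN : 0 < `|e^-1| by rewrite normr_gt0 invr_eq0.
have ee : `|e| * `|e^-1| = 1 by rewrite -normrM divff// normr1.
set CB := 2 * picard_gap T1 contraction weight source_bound M.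
have H := @max_principle R n n nu nu0 v vt v1 v2 ((CB + CB) * `|e^-1|) (M + M0) apriori_const
  apriori_rate (K + 1) tau
  (addr_ge0 Mp M00) al0 be0 K1.
apply: H tT.
- move=> {}k; apply: contM; last exact: cont_cst; apply: contB; last exact: (@Zb_cont (inl k)).
  have cc : continuous (fun q : R * V => q.2 + c) by apply: contD; [exact: cont_snd|exact:
    cont_cst].
  exact: (cont_uncurry (@Zb_cont (inl k)) (@cont_fst _ _) cc).
- move=> {}k {}t {}x; rewrite normrM ler_wpM2r// (le_trans (ler_normB _ _))// lerD//; exact:
  Zb_bound.
- move=> {}k {}t {}x tt; apply: is_derive_mulc.
  exact: (isd_sub (burgers_u_time_derive k (x + c) (tauI tt)) (burgers_u_time_derive k x (tauI
    tt))).
- move=> {}k j {}t {}x tt; apply: is_derive_mulc; apply: isd_sub.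
    by apply: is_derive_translate; exact: burgers_u_derive (tauI' tt).
  exact: burgers_u_derive (tauI' tt).
- move=> {}k j {}t {}x tt; apply: is_derive_mulc; apply: isd_sub.
    by apply: is_derive_translate; exact: burgers_grad_derive (tauI' tt).
  exact: burgers_grad_derive (tauI' tt).
- move=> {}k {}t {}x b tt vb.
  have -> : vt k t x - nu * \sum_j v2 k j t x = (burgers_rhs k t (x + c) - burgers_rhs k t x) *
    e^-1.
    have gen (a a' s s' : R) : ((a + nu * s) - (a' + nu * s')) * e^-1 - nu * ((s - s') * e^-1) =
      (a - a') * e^-1 by ring.
    by rewrite /vt /v2 /gt -mulr_suml sumrB; exact: gen.
  have dU l : `|burgers_u l t (x + c) - burgers_u l t x| <= b * `|e|.
    have := ler_wpM2r (normr_ge0 e) (vb l); rewrite /v normrM -mulrA (mulrC `|e^-1|) ee mulr1.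
    exact.
  have b0 : 0 <= b by rewrite (le_trans _ (vb k)).
  have dQ j : `|burgers_grad k j t (x + c) - burgers_grad k j t x| = `|v1 k j t x| * `|e|.
    by rewrite /v1 normrM -mulrA (mulrC `|e^-1|) ee mulr1.
  have main : `|burgers_rhs k t (x + c) - burgers_rhs k t x| <=
     ((M + M0) * (\sum_j `|v1 k j t x|) + apriori_const + apriori_rate * b) * `|e|.
    rewrite !burgers_rhsE.
    set y' : V := \row_j burgers_u j t (x + c); set y : V := \row_j burgers_u j t x.
    have -> : forall a a' s s' : R, a - s - (a' - s') = (a - a') - (s - s') by move=> *; ring.
    rewrite (le_trans (ler_normB _ _))//.
    have hF : `|F k t (x + c) y' - F k t x y| <= (K + n%:R * K * b) * `|e|.
      have sub3 (a a' d : R) : a - d = (a - a') + (a' - d) by ring.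
      rewrite (sub3 _ (F k t x y')).
      rewrite (le_trans (ler_normD _ _))// mulrDl; apply: lerD; first exact: FXK.
      have -> : y' = y + (y' - y) by rewrite addrC subrK.
      rewrite -mulrA; apply: FYK => l; rewrite !mxE; exact: dU.
    have hS : `|\sum_j (eta j t (x + c) + clamp M0 (burgers_u j t (x + c))) * clamp L
      (burgers_grad k j t (x + c))
        - \sum_j (eta j t x + clamp M0 (burgers_u j t x)) * clamp L (burgers_grad k j t x)| <=
        \sum_(j < n) ((K + b) * `|e| * L + (M + M0) * (`|v1 k j t x| * `|e|)).
      rewrite -sumrB (le_trans (ler_norm_sum _ _ _))// ler_sum// => j _.
      set a' := clamp M0 _; set a := clamp M0 (burgers_u j t x).
      set p' := clamp L _; set p := clamp L (burgers_grad k j t x).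
      (* Arranged so that increments of [eta] and [u] meet a factor bounded by [L], and increments
         of the gradient a factor bounded by [M + M0]. *)
      have pr (e1 e2 : R) : (e1 + a') * p' - (e2 + a) * p =
        ((e1 - e2) + (a' - a)) * p' + (e2 + a) * (p' - p) by ring.
      rewrite pr.
      rewrite (le_trans (ler_normD _ _))// !normrM lerD//; apply: ler_pM => //.
      + rewrite (le_trans (ler_normD _ _))// mulrDl; apply: lerD; first exact: etaK.
        by rewrite (le_trans (clamp_lip _ _ M00))//; exact: dU.
      + exact: clamp_le.
      + by rewrite (le_trans (ler_normD _ _))// lerD// clamp_le.
      + by rewrite -mulrA (mulrC `|e^-1|) ee mulr1 (le_trans (clamp_lip _ _ L0)).
    apply: (le_trans (lerD hF hS)).
    have fin (S ea : R) : (K + n%:R * K * b) * ea + (n%:R * ((K + b) * ea * L) + (M + M0) * (S *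
      ea)) =
      ((M + M0) * S + (K + n%:R * (K * L)) + (n%:R * K + n%:R * L) * b) * ea by ring.
    rewrite big_split/= sumr_const card_ord -(mulr_natl ((K + b) * `|e| * L)) -mulr_sumr -mulr_suml.
    rewrite le_eqVlt; apply/orP; left; apply/eqP; rewrite /apriori_const /apriori_rate.
    exact: fin.
  have := ler_wpM2r (normr_ge0 e^-1) main; rewrite -normrM -mulrA ee mulr1; exact.
- move=> {}k {}x; rewrite /v !burgers_u0 normrM.
  have := ler_wpM2r (normr_ge0 e^-1) (hK k i x e); rewrite -mulrA ee mulr1 => h1.
  by rewrite (le_trans h1)// lerDl.
Qed.

Hypotheses (M0E : M0 = (M + 1) * expR (2 * T1)) (LE : L = (K + 1) * expR 1).
Hypothesis tau_small : (apriori_rate + apriori_const / (K + 1) + 1) * tau <= 1.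

Definition solution_bound : R := 2 * picard_gap T1 contraction weight source_bound M +
  source_bound + hess_bound.

Lemma Burgers_solution : solution nu T1 tau solution_bound h eta F burgers_u burgers_grad
  burgers_rhs burgers_hess.
Proof.
have c0 : 0 <= 2 * picard_gap T1 contraction weight source_bound M.
  by rewrite mulr_ge0// /picard_gap mulr_ge0 ?expR_ge0// addr_ge0// mulr_ge0.
have w0 : 0 <= hess_bound.
  rewrite addr_ge0// sumr_ge0// => i _; rewrite sumr_ge0// => j _.
  by rewrite !mulr_ge0 ?invr_ge0 ?(ltW nu0)// ?rhs_lip_const_ge0 ?sg_ge0 ?gm2_ge0.
split.
- by move=> k; exact: Zb_cont.
- by move=> k j; exact: Zb_cont.
- exact: burgers_rhs_cont.
- exact: burgers_hess_cont.
- by move=> k t x; rewrite (le_trans (Zb_bound _ _ _))// /solution_bound -addrA lerDl addr_ge0.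
- by move=> k j t x; rewrite (le_trans (Zb_bound _ _ _))// /solution_bound -addrA lerDl addr_ge0.
- by move=> k t x; rewrite (le_trans (burgers_rhs_le _ _ _))// /solution_bound addrAC lerDr
  addr_ge0.
- by move=> k i j t x tT; rewrite (le_trans (burgers_hess_bound _ _ _ _ tT))// /solution_bound
  lerDr addr_ge0.
- exact: burgers_u0.
- exact: burgers_u_derive.
- exact: burgers_grad_derive.
- exact: burgers_u_time_derive.
move=> k t x tt; rewrite burgers_rhsE; congr (_ - _); apply: eq_bigr => j _.
(* Both truncations are inactive on [[0, tau]]: the bound on [u] is the level [M0] itself, and the
   bound on the quotients passes to the derivative, with its exponent at most 1 by [tau_small]. *)
rewrite clamp_id; last by rewrite M0E; exact: burgers_u_le.
rewrite clamp_id// LE; apply: (derive_bound (burgers_u_derive k j x (tauI0 tt))) => e e0.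
apply: (le_trans (burgers_grad_quotient k j x e0 tt)).
rewrite ler_wpM2l ?addr_ge0// ler_expR (le_trans _ tau_small)// ler_wpM2l//.
  rewrite addr_ge0// addr_ge0//; first by rewrite addr_ge0// mulr_ge0.
  by rewrite divr_ge0// addr_ge0// !mulr_ge0.
by have /andP[] := tt.
Qed.

End Apriori.

End Burgers.

(** * Measurability in the random parameter *)

Section ParamIntegral.
Context (R : realType) d (T : measurableType d) d' (Y : measurableType d')
  (mu : {sigma_finite_measure set Y -> \bar R}).

(** Tonelli applies to the positive and negative parts separately, so no integrability in [y] is
    needed: the extended integral is a difference of measurable functions, and [fine] is
    measurable. *)
Lemma Rintegral_param_measurable (phi : T * Y -> R) : measurable_fun setT phi ->
  measurable_fun setT (fun t => \int[mu]_y phi (t, y)).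
Proof.
move=> mphi; rewrite /Rintegral.
have me : measurable_fun setT (EFin \o phi) by exact/measurable_EFinP.
have H : measurable_fun setT (fun t => \int[mu]_y (phi (t, y))%:E)%E.
  rewrite (_ : (fun t => _) = (fun t => (\int[mu]_y ((EFin \o phi)^\+ (t, y)) -
      \int[mu]_y ((EFin \o phi)^\- (t, y)))%E)); last first.
    apply/funext => t; rewrite [LHS]integralE.
    by congr (_ - _)%E; apply: eq_integral => y _; rewrite ?funeposE ?funenegE.
  apply: emeasurable_funB.
    apply: (measurable_fun_fubini_tonelli_F (m2 := mu) ((EFin \o phi)^\+)%E).
      exact: measurable_funepos.
    by move=> x; exact: funepos_ge0.
  apply: (measurable_fun_fubini_tonelli_F (m2 := mu) ((EFin \o phi)^\-)%E).
    exact: measurable_funeneg.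
  by move=> x; exact: funeneg_ge0.
exact: (measurableT_comp (@fine_measurable R setT measurableT) H).
Qed.

End ParamIntegral.

Section ParamDuhamel.
Context (R : realType) (n : nat) (G : gaussian_vector R n) (nu : R).
Context d (T : measurableType d).
Local Notation V := 'rV[R]_n.

Lemma Eg_param_measurable (f : V -> T -> R) (s : T -> R) (q : gv_type G -> R) (x : V) :
  (forall y, measurable_fun setT (f y)) -> (forall t, continuous (f^~ t)) ->
  measurable_fun setT s -> measurable_fun setT q ->
  measurable_fun setT (fun t => Eg q (f^~ t) (s t) x).
Proof.
move=> mf cf ms mq.
apply: (@Rintegral_param_measurable R _ _ _ _ (gv_mu G)
  (fun p : T * gv_type G => f (x + s p.1 *: gv_Z p.2) p.1 * q p.2)).
apply: measurable_funM; last exact: (measurableT_comp mq measurable_snd).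
apply: (@measurable_caratheodory_comp R _ (T * gv_type G)%type n
  (fun p => x + s p.1 *: gv_Z p.2) (fun y p => f y p.1)).
- move=> i.
  rewrite (_ : (fun p => _) = (fun p : T * gv_type G => x 0 i + s p.1 * gv_Z p.2 0 i)); last first.
    by apply/funext => p; rewrite !mxE.
  apply: measurable_funD; first exact: measurable_cst.
  apply: measurable_funM; first exact: (measurableT_comp ms measurable_fst).
  exact: (measurableT_comp (gv_Z_meas G i) measurable_snd).
- by move=> y; exact: (measurableT_comp (mf y) measurable_fst).
- by move=> p; exact: cf.
Qed.

End ParamDuhamel.

Section ParamDuhamelOperator.
Context (R : realType) (n : nat) (G : gaussian_vector R n) (nu : R).
Context d (T : measurableType d).
Local Notation V := 'rV[R]_n.
Local Notation leb := (@lebesgue_measure R).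

(** Measurability of [g s y] is required for [s <= t] only, so a Duhamel integral of an adapted
    source is adapted. The Caratheodory argument is used in the time variable and, inside
    [Eg_param_measurable], in the space variable. *)
Lemma Dw_param_measurable (g : R -> V -> T -> R) (a : R -> R) (q : gv_type G -> R) (t : R) (x : V) :
  0 <= t ->
  (forall s y, 0 <= s <= t -> measurable_fun setT (g s y)) ->
  (forall w, continuous (fun p : R * V => g p.1 p.2 w)) ->
  measurable_fun setT a -> measurable_fun setT q ->
  measurable_fun setT (fun w => Dw nu a q (fun s y => g s y w) t x).
Proof.
move=> t0 mg cg ma mq.
(* The time is clamped to [[0, t]] because [u] now ranges over the whole line; on []0, 1]] the clamp
   is the identity. *)
pose f (y : V) (p : T * measurableTypeR R) : R := g (ctime t (t * (1 - p.2 ^+ 2))) y p.1.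
pose phi (p : T * measurableTypeR R) : R :=
  a p.2 * Eg q (f^~ p) (p.2 * sg nu t) x * \1_(`]0, 1]%classic : set R) p.2.
have E w : Dw nu a q (fun s y => g s y w) t x = \int[leb]_u phi (w, u).
  rewrite /Dw Rintegral_mkcond; apply: eq_Rintegral => u _.
  rewrite patchE /phi indicE; case: ifPn => u01; last by rewrite mulr0.
  rewrite mulr1; congr (_ * Eg _ _ _ _); apply/funext => y; rewrite /f/= ctime_id//.
  move: u01; rewrite inE/= in_itv/= => /andP[u0 u1].
  have v1 : u ^+ 2 <= 1 by rewrite expr2 mulr_ile1// ltW.
  have v0 : 0 <= u ^+ 2 by exact: sqr_ge0.
  by rewrite mulr_ge0 ?subr_ge0//= ler_piMr// lerBlDr lerDl.
rewrite (_ : (fun w => _) = (fun w => \int[leb]_u phi (w, u))); last by apply/funext.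
apply: (@Rintegral_param_measurable R _ T _ (measurableTypeR R) leb phi).
apply: measurable_funM; last first.
  by apply: (measurableT_comp (g := snd)) => //; exact: measurable_indic.
apply: measurable_funM; first exact: (measurableT_comp ma measurable_snd).
have ms : measurable_fun setT (snd : T * measurableTypeR R -> R) by exact: measurable_snd.
apply: (@Eg_param_measurable R n G _ (T * measurableTypeR R)%type f).
- move=> y.
  have := @measurable_caratheodory_comp R _ (T * measurableTypeR R)%type 1
    (fun p => \row_(_ < 1) (t * (1 - p.2 ^+ 2) : R)) (fun r p => g (ctime t (r 0 0)) y p.1).
  move=> H; rewrite (_ : f y = (fun p : T * measurableTypeR R =>
    g (ctime t ((\row_(_ < 1) (t * (1 - p.2 ^+ 2) : R)) 0 0)) y p.1)); last first.
    by apply/funext => p; rewrite mxE.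
  apply: H.
  + move=> i; rewrite (_ : (fun p => _) = (fun p : T * measurableTypeR R => t * (1 - p.2 ^+ 2) :
    R)).
      apply: measurable_funM => //; apply: measurable_funB => //.
      exact: measurable_funM.
    by apply/funext => p; rewrite mxE.
  + move=> r; apply: (measurableT_comp (mg _ y _) measurable_fst); exact: ctime_itv.
  + move=> p.
    have c1 : continuous (fun r : 'rV[R]_1 => ctime t (r 0 0)).
      by apply: cont_ctime; apply: cont_coord; exact: cont_id.
    have c2 : continuous (fun _ : 'rV[R]_1 => y) by exact: cont_cst.
    exact: (cont_uncurry (k := fun s z => g s z p.1) (cg p.1) c1 c2).
- move=> p; have c1 : continuous (fun _ : V => ctime t (t * (1 - p.2 ^+ 2))) by exact: cont_cst.
  exact: (cont_uncurry (k := fun s z => g s z p.1) (cg p.1) c1 (@cont_id V)).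
- by apply: measurable_funM.
- exact: mq.
Qed.

End ParamDuhamelOperator.

(** * Traces of sigma-algebras and measurable versions *)

Section Trace.
Context (R : realType) (d : measure_display) (Omega : measurableType d).

(** A sigma-algebra on the whole of [Omega] that imposes no condition off [O0]. Functions may thus
    be set to 0 there without knowing that [O0] belongs to [F]. *)
Definition trace_alg (F : set (set Omega)) (O0 : set Omega) : set (set Omega) :=
  [set A | exists2 B, F B & A `&` O0 = B `&` O0].

Lemma trace_sigma F O0 : sigma_algebra setT F -> sigma_algebra setT (trace_alg F O0).
Proof.
move=> [F0 FC FU]; split.
- by exists set0.
- move=> A [B FB AB]; exists (setT `\` B); first exact: FC.
  apply/seteqP; split => w [[_ nA] w0]; split => //; split => // Bw; apply: nA.
    by have [] : (A `&` O0) w by rewrite AB.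
  by have [] : (B `&` O0) w by rewrite -AB.
- move=> A HA; pose B k := s2val (cid2 (HA k)).
  exists (\bigcup_k B k); first by apply: FU => k; rewrite /B; case: cid2.
  have AB k : A k `&` O0 = B k `&` O0 by rewrite /B; case: cid2.
  apply/seteqP; split => w [[k _ h] w0]; split => //; exists k => //.
    by have [] : (B k `&` O0) w by rewrite -AB.
  by have [] : (A k `&` O0) w by rewrite AB.
Qed.

Lemma traceS F F' O0 : F `<=` F' -> trace_alg F O0 `<=` trace_alg F' O0.
Proof. by move=> FF A [B FB AB]; exists B => //; exact: FF. Qed.

Lemma meas_wrtS (F F' : set (set Omega)) (f : Omega -> R) : F `<=` F' -> meas_wrt F f -> meas_wrt
  F' f.
Proof. by move=> FF mf B mB; apply: FF; exact: mf. Qed.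

(** Turns measurability for a varying family of sets into that of a measurable type, so that the
    usual closure properties apply to every sigma-algebra of the filtration. *)
Lemma meas_wrtE (F : set (set Omega)) (f : Omega -> R) : sigma_algebra setT F ->
  meas_wrt F f <-> measurable_fun (setT : set (g_sigma_algebraType F)) (f : g_sigma_algebraType F
    -> R).
Proof.
move=> sF; split=> [mf _ B mB|mf B mB].
  by rewrite setTI; apply: sub_sigma_algebra; exact: mf.
have := mf measurableT B mB; rewrite setTI => H.
by have : <<s F >> (f @^-1` B) := H; rewrite sigma_algebra_id.
Qed.

Lemma meas_wrt_restrict F O0 (f : Omega -> R) : sigma_algebra setT F -> meas_wrt F f ->
  meas_wrt (trace_alg F O0) (fun w => if w \in O0 then f w else 0).
Proof.
move=> sF mf B mB; exists (f @^-1` B); first exact: mf.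
apply/seteqP; split => w [h w0]; split => //; move: h; rewrite /= mem_set//.
Qed.

(** For each rational [q], some set of [F] agrees on [O0] with the set where [f > q]. The supremum
    of the [q] whose set contains [w] is [F]-measurable and equals [f] on [O0]. *)
Lemma meas_wrt_version F O0 (f : Omega -> R) (C : R) : sigma_algebra setT F ->
  meas_wrt (trace_alg F O0) f -> (forall w, `|f w| <= C) ->
  exists2 f' : Omega -> R, meas_wrt F f' & forall w, O0 w -> f' w = f w.
Proof.
move=> sF mf fC.
have C0 : 0 <= C by rewrite (le_trans _ (fC point)).
pose q (k : nat) : R := if unpickle k is Some r then ratr (r : rat) else 0.
have H k : trace_alg F O0 (f @^-1` `]q k, +oo[) by apply: mf.
pose B k := s2val (cid2 (H k)).
have FB k : F (B k) by rewrite /B; case: cid2.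
have BE k : f @^-1` `]q k, +oo[ `&` O0 = B k `&` O0 by rewrite /B; case: cid2.
(* The sets [B k] have no prescribed order off [O0]; clamping to [[- C, C]] keeps the supremum
   finite there, and changes nothing on [O0] since [|f| <= C]. *)
pose f_ k w : R := if w \in B k then clamp C (q k) else - C.
have f_le k w : - C <= f_ k w <= C.
  rewrite /f_; case: ifP => _; last by rewrite lexx (le_trans _ C0)// oppr_le0.
  by have := clamp_le (q k) C0; rewrite ler_norml.
have ub w : has_ubound (range (f_^~ w)) by exists C => _ [k _ <-]; have /andP[] := f_le k w.
exists (fun w => sups (f_^~ w) 0%N).
  apply/(meas_wrtE _ sF).
  apply: measurable_fun_sups; first by move=> w _; exact: ub.
  move=> k; apply: measurable_fun_ifT.
  - apply: (measurable_fun_bool true); rewrite setTI.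
    rewrite (_ : _ @^-1` _ = B k); first exact: sub_sigma_algebra.
    by apply/seteqP; split => w /= => [/set_mem|/mem_set].
  - exact: measurable_cst.
  - exact: measurable_cst.
move=> w w0.
have f_w k : f_ k w = if q k < f w then clamp C (q k) else - C.
  rewrite /f_; case: ifPn => [/set_mem h|/negP h].
    have : (f @^-1` `]q k, +oo[ `&` O0) w by rewrite BE.
    by case; rewrite /= in_itv/= andbT => -> _.
  case: ifPn => // h2; exfalso; apply: h; apply/mem_set.
  have : (B k `&` O0) w by rewrite -BE; split => //=; rewrite in_itv/= andbT.
  by case.
have := fC w; rewrite ler_norml => /andP[fl fu].
have rg : sups (f_^~ w) 0%N = sup (range (f_^~ w)).
  by rewrite /sups /sdrop/=; congr sup; apply/seteqP; split => _ [k _ <-]; exists k.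
rewrite rg; apply/eqP; rewrite eq_le; apply/andP; split.
  apply: ge_sup; first by exists (f_ 0%N w); exists 0%N.
  move=> _ [k _ <-]; rewrite f_w; case: ifPn => // h.
  by rewrite /clamp ge_max fl ge_min (ltW h) orbT.
rewrite leNgt; apply/negP => lt.
have [r] := rat_in_itvoo lt; rewrite in_itv/= => /andP[r1 r2].
have [k qk] : exists k, q k = ratr r by exists (pickle r); rewrite /q pickleK.
have : f_ k w <= sup (range (f_^~ w)) by apply: ub_le_sup; [exact: ub|exists k].
rewrite f_w qk r2.
have rl : ratr r <= clamp C (ratr r).
  by rewrite /clamp le_max le_min lexx andbT (le_trans (ltW r2) fu) orbT.
by move=> /(le_trans rl); rewrite leNgt r1.
Qed.

End Trace.

(** * Adaptedness of the Picard iterates *)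

Section Adapted.
Context (R : realType) (n : nat) (G : gaussian_vector R n) (nu : R).
Context (d : measure_display) (Omega : measurableType d).
Local Notation V := 'rV[R]_n.
Variables (T T1 M0 L M LF : R) (Gt : R -> set (set Omega)).
Hypotheses (TT1 : T <= T1).
Hypothesis Gs : forall t, 0 <= t <= T -> sigma_algebra setT (Gt t).
Hypothesis Gm : forall s t, 0 <= s -> s <= t -> t <= T -> Gt s `<=` Gt t.
Variables (h : 'I_n -> V -> Omega -> R) (dh : 'I_n -> 'I_n -> V -> Omega -> R)
  (eta : 'I_n -> R -> V -> Omega -> R) (F : 'I_n -> R -> V -> V -> Omega -> R).
Hypothesis mh : forall k x, meas_wrt (Gt 0) (h k x).
Hypothesis mdh : forall k j x, meas_wrt (Gt 0) (dh k j x).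
Hypothesis meta : forall j t x, 0 <= t <= T -> meas_wrt (Gt t) (eta j t x).
Hypothesis mF : forall k t x y, 0 <= t <= T -> meas_wrt (Gt t) (F k t x y).
Hypothesis ch : forall k w, continuous (fun x => h k x w).
Hypothesis cdh : forall k j w, continuous (fun x => dh k j x w).
Hypothesis cF : forall k w, continuous (fun q : R * (V * V) => F k q.1 q.2.1 q.2.2 w).

Local Notation PhiW w := (burgers_source M0 L (fun j t x => eta j t x w) (fun k t x y => F k t x
  y w)).
Local Notation AW w := (burgers_init G nu T1 (fun k x => h k x w) (fun k j x => dh k j x w)).
Local Notation ZW w := (picard_iter T1 (AW w) (@burgers_duhamel R n G nu) (@state_component n)
  (PhiW w)).
Hypothesis cgW : forall m k w, continuous (fun q : R * V => source_at (PhiW w) (ZW w m) k q.1 q.2).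

Lemma clamp_measurable d' (X : measurableType d') (a : R) (f : X -> R) :
  measurable_fun setT f -> measurable_fun setT (fun x => clamp a (f x)).
Proof.
move=> mf; apply: (measurableT_comp (f := clamp a)) => //.
by apply: continuous_measurable_fun; apply: cont_clamp; exact: cont_id.
Qed.

Lemma source_at_measurable d' (X : measurableType d') (F' : V -> X -> R) (e a p : 'I_n -> X -> R) :
  (forall y, measurable_fun setT (F' y)) -> (forall w, continuous (F'^~ w)) ->
  (forall j, measurable_fun setT (e j)) -> (forall j, measurable_fun setT (a j)) ->
  (forall j, measurable_fun setT (p j)) ->
  measurable_fun setT (fun w => F' (\row_j a j w) w -
    \sum_j (e j w + clamp M0 (a j w)) * clamp L (p j w)).
Proof.
move=> mF' cF' me ma mp; apply: measurable_funB.
  apply: (@measurable_caratheodory_comp R _ X n (fun w => \row_j a j w) F') => // i.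
  rewrite (_ : (fun t => _) = a i)//; apply/funext => w; by rewrite mxE.
apply: measurable_sum => j; apply: measurable_funM.
  by apply: measurable_funD => //; exact: clamp_measurable.
exact: clamp_measurable.
Qed.

(** Induction on [m] for all times at once: the next iterate at [t] uses the preceding one at times
    [s <= t], where [Gt s] is contained in [Gt t], and the initial data, measurable for [Gt 0]. *)
Lemma ZW_meas m i t x : 0 <= t <= T -> meas_wrt (Gt t) (fun w => ZW w m i t x).
Proof.
elim: m i t x => [|m IH] i t x tT.
  apply/(meas_wrtE _ (Gs tT)); exact: measurable_cst.
have /andP[t0 tT'] := tT.
have sub0 : Gt 0 `<=` Gt t by exact: Gm.
have tT1 : 0 <= t <= T1 by rewrite t0 (le_trans tT').
apply/(meas_wrtE _ (Gs tT)).
set X := g_sigma_algebraType (Gt t).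
have mG k s y : 0 <= s <= t ->
    measurable_fun (setT : set X) (fun w => source_at (PhiW w) (ZW w m) k s y).
  move=> /andP[s0 st].
  have sT : 0 <= s <= T by rewrite s0 (le_trans st).
  have subs : Gt s `<=` Gt t by exact: Gm.
  have U (f : Omega -> R) : meas_wrt (Gt s) f -> measurable_fun (setT : set X) f.
    by move=> mf; apply/(meas_wrtE _ (Gs tT)); exact: (meas_wrtS subs).
  apply: (@source_at_measurable _ X (fun v w => F k s y v w) (fun j => eta j s y)
    (fun j w => ZW w m (inl j) s y) (fun j w => ZW w m (inr (k, j)) s y)).
  - by move=> v; apply: U; exact: mF.
  - move=> w; have c1 : continuous (fun v : V => (s, (y, v))).
      by apply: cont_pair; [exact: cont_cst|apply: cont_pair; [exact: cont_cst|exact: cont_id]].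
    exact: (cont_comp c1 (@cF k w)).
  - by move=> j; apply: U; exact: meta.
  - by move=> j; apply: U; exact: IH.
  - by move=> j; apply: U; exact: IH.
have mS (f : V -> Omega -> R) : (forall y, meas_wrt (Gt 0) (f y)) ->
    (forall w, continuous (f^~ w)) ->
    measurable_fun (setT : set X) (fun w => Sop G nu (f^~ w) t x).
  move=> mf cf; apply: (@Eg_param_measurable R n G _ X f (fun=> sg nu t)) => //.
  - by move=> y; apply/(meas_wrtE _ (Gs tT)); exact: (meas_wrtS sub0).
  - exact: gv_rho_meas.
have m1 j : measurable_fun setT (@q1 R n G j).
  by apply: measurable_funM; [exact: gv_Z_meas|exact: gv_rho_meas].
case: i => [k|[k j]].
  rewrite (_ : (fun w => _) = (fun w => Sop G nu (fun x => h k x w) t x +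
      t * Dw nu (fun u => 2 * u) (@q0 R n G) (fun s y => source_at (PhiW w) (ZW w m) k s y) t
        x)); last first.
    by apply/funext => w /=; rewrite ctime_id.
  apply: measurable_funD; first exact: mS.
  apply: measurable_funM; first exact: measurable_cst.
  apply: (@Dw_param_measurable R n G nu _ X (fun s y w => source_at (PhiW w) (ZW w m) k s y)) => //.
  - exact: mG.
  - exact: measurable_funM.
  - exact: gv_rho_meas.
rewrite (_ : (fun w => _) = (fun w => Sop G nu (fun x => dh k j x w) t x + Num.sqrt (t / (2 * nu)) *
    Dw nu (fun=> 2) (@q1 R n G j) (fun s y => source_at (PhiW w) (ZW w m) k s y) t x)); last first.
  by apply/funext => w /=; rewrite ctime_id.
apply: measurable_funD; first exact: mS.
apply: measurable_funM; first exact: measurable_cst.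
apply: (@Dw_param_measurable R n G nu _ X (fun s y w => source_at (PhiW w) (ZW w m) k s y)) => //.
- exact: mG.
Qed.

Lemma ZW_limit_meas (Z : state_index n -> R -> V -> Omega -> R) (c : R) i t x : 0 <= t <= T ->
  (forall m w, `|Z i t x w - ZW w m i t x| <= c * 2^-1 ^+ m) -> meas_wrt (Gt t) (Z i t x).
Proof.
move=> tT H; apply/(meas_wrtE _ (Gs tT)).
apply: (@measurable_fun_cvg _ (g_sigma_algebraType (Gt t)) R setT (fun m w => ZW w m i t x)).
  by move=> m; apply/(meas_wrtE _ (Gs tT)); exact: ZW_meas.
move=> w _; apply/cvgrPdist_lt => e e0.
have [m me] := geo_small c e0.
exists m => // k /= mk; apply: (le_lt_trans (H k w)); apply: le_lt_trans me.
have c0 : 0 <= c.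
  by have := H 0%N w; rewrite expr0 mulr1; apply: le_trans.
by rewrite ler_wpM2l// ler_wiXn2l// ?invr_ge0// invf_le1// ler1n.
Qed.

End Adapted.

Lemma coord_le (R : realType) n (v : 'rV[R]_n) j : `|v 0 j| <= `|v|.
Proof.
rewrite [leRHS]mx_normrE.
exact: (le_bigmax _ (fun ij : 'I_1 * 'I_n => `|v ij.1 ij.2|) (0, j)).
Qed.

Lemma isd_component (R : realType) (V : normedModType R) n (f : V -> 'rV[R]_n) (z v : V) j :
  derivable f z v -> is_derive z v (fun x => f x 0 j) ((derive f z v) 0 j).
Proof.
move=> df; have H := (derivable_mxP f z v).1 df.
by split; [exact: H|rewrite derive_mx// mxE].
Qed.

Lemma isd_row (R : realType) (V : normedModType R) n (f : 'I_n -> V -> R) (z v : V) (l : 'I_n ->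
  R) :
  (forall k, is_derive z v (f k) (l k)) ->
  is_derive z v (fun x => \row_k f k x : 'rV[R]_n) (\row_k l k).
Proof.
move=> H.
have E i j : (fun x => (\row_k f k x : 'rV[R]_n) i j) = f j by apply/funext => x; rewrite mxE.
have D : derivable (fun x => \row_k f k x : 'rV[R]_n) z v.
  by apply/derivable_mxP => i j; rewrite E; have [] := H j.
split => //; rewrite derive_mx//; apply/matrixP => i j; rewrite !mxE E.
by have [_ ->] := H j.
Qed.

Lemma cont_within_comp (X Y Z : topologicalType) (A : set Y) (f : Y -> Z) (phi : X -> Y) :
  {within A, continuous f} -> continuous phi -> (forall x, A (phi x)) ->
  continuous (fun x => f (phi x)).
Proof.
move=> /subspace_continuousP cf cphi Aphi x W fW.
have H : nbhs (phi x) (fun y => A y -> W (f y)) := cf (phi x) (Aphi x) W fW.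
have H2 : nbhs x (fun z => A (phi z) -> W (f (phi z))) := cphi x _ H.
suff : nbhs x (fun z => W (f (phi z))) by [].
by apply: filterS H2 => y; apply; exact: Aphi.
Qed.

Lemma within_eq_continuous (Y Z : topologicalType) (A : set Y) (f g : Y -> Z) :
  continuous g -> (forall y, A y -> g y = f y) -> {within A, continuous f}.
Proof.
move=> cg fg; apply: (@subspace_eq_continuous _ _ _ g); last exact: continuous_subspaceT.
by move=> y /set_mem; exact: fg.
Qed.

(** * The random backward system *)

Section MeanValue.
Context (R : realType).

Lemma line_lip (V : normedModType R) (f df : V -> R) (v : V) (K : R) :
  (forall z, is_derive z v f (df z)) -> (forall z, `|df z| <= K) ->
  forall x (e : R), `|f (x + e *: v) - f x| <= K * `|e|.
Proof.
move=> fd dK.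
have pos (x : V) (e : R) : 0 <= e -> `|f (x + e *: v) - f x| <= K * `|e|.
  move=> e0; pose phi (a : R) := f (a *: v + x).
  have dphi (a : R) : is_derive a (1 : R) phi (df (a *: v + x)) by exact: is_derive_line_at.
  have cphi : {within `[0, e], continuous phi}.
    by apply: derivable_within_continuous => a _; have [] := dphi a.
  have [c _ E] := MVT_segment e0 (fun a _ => dphi a) cphi.
  have -> : f (x + e *: v) - f x = phi e - phi 0 by rewrite /phi scale0r add0r (addrC x).
  by rewrite E subr0 normrM ler_wpM2r.
move=> x e; have [e0|e0] := leP 0 e; first exact: pos.
have := pos (x + e *: v) (- e); rewrite oppr_ge0 (ltW e0) => /(_ isT).
by rewrite scaleNr addrK normrN distrC.
Qed.

(** Only partial derivatives are available, so the increment is split into moves along one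
    coordinate at a time, each handled by the mean value theorem. *)
Lemma partials_lip n (f : 'rV[R]_n -> R) (D : 'I_n -> 'rV[R]_n -> R) (K : R) :
  (forall i z, is_derive z (ebase R i) f (D i z)) -> (forall i z, `|D i z| <= K) ->
  forall x v : 'rV[R]_n, `|f (x + v) - f x| <= \sum_i (K * `|v 0 i|).
Proof.
move=> fd DK x v.
rewrite {1}(row_sum_delta v).
elim: (index_enum _) x => [|i r IH] x; first by rewrite !big_nil addr0 subrr normr0.
rewrite !big_cons addrA.
set S := \sum_(j <- r) _ in IH *; set y := x + _.
rewrite (_ : _ - _ = (f (y + S) - f y) + (f y - f x)); last by rewrite addrA subrK.
rewrite (le_trans (ler_normD _ _))// addrC lerD//.
exact: (line_lip (fd i) (DK i)).
Qed.

Lemma partials_lip_norm n (f : 'rV[R]_n -> R) (D : 'I_n -> 'rV[R]_n -> R) (K b : R) : 0 <= K ->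
  (forall i z, is_derive z (ebase R i) f (D i z)) -> (forall i z, `|D i z| <= K) ->
  forall x v : 'rV[R]_n, (forall i, `|v 0 i| <= b) -> `|f (x + v) - f x| <= n%:R * K * b.
Proof.
move=> K0 fd DK x v vb; rewrite (le_trans (partials_lip fd DK x v))//.
apply: (@le_trans _ _ (\sum_(i < n) (K * b))); first by apply: ler_sum => i _; rewrite ler_wpM2l.
by rewrite sumr_const card_ord -(mulr_natl (K * b)) mulrA.
Qed.

Lemma derive_seq_cvg (V : normedModType R) (f : V -> R) (x v : V) (l : R) : is_derive x v f l ->
  (f (x + mesh R m *: v) - f x) * (mesh R m)^-1 @[m --> \oo] --> l.
Proof.
move=> [df dl].
have c : h^-1 *: ((f \o shift x) (h *: v) - f x) @[h --> (0 : R)^'] --> l by rewrite -dl; exact: df.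
apply/cvgrPdist_lt => e e0.
have /cvgrPdist_lt /(_ _ e0) H0 := c.
have H1 : nbhs (0 : R) (fun h : R => h != 0 ->
  `|l - h^-1 *: ((f \o shift x) (h *: v) - f x)| < e) := H0.
have H2 : \forall m \near \oo, mesh R m != 0 ->
  `|l - (mesh R m)^-1 *: ((f \o shift x) (mesh R m *: v) - f x)| < e := @cvg_inv_nat R _ H1.
apply: filterS H2 => m /(_ (mesh_neq0 R m)) /=; rewrite [x + _]addrC mulrC; exact.
Qed.

End MeanValue.

(** Coordinatewise regularity of one realisation, for all real times. The bound [M] on all norms and
    the bound [K] on first derivatives are kept apart because the lifespan may depend on the latter
    alone. *)
Record regdata (R : realType) (n : nat) (M K : R)
  (h : 'I_n -> 'rV[R]_n -> R) (dh : 'I_n -> 'I_n -> 'rV[R]_n -> R)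
  (d2h : 'I_n -> 'I_n -> 'I_n -> 'rV[R]_n -> R)
  (eta : 'I_n -> R -> 'rV[R]_n -> R) (de : 'I_n -> 'I_n -> R -> 'rV[R]_n -> R)
  (F : 'I_n -> R -> 'rV[R]_n -> 'rV[R]_n -> R)
  (dx dy : 'I_n -> 'I_n -> R -> 'rV[R]_n -> 'rV[R]_n -> R) : Prop := RegData {
  rd_ch : forall k, continuous (h k);
  rd_h : forall k z, `|h k z| <= M;
  rd_cdh : forall k j, continuous (dh k j);
  rd_dh : forall k j z, `|dh k j z| <= M;
  rd_cd2h : forall k i j, continuous (d2h k i j);
  rd_d2h : forall k i j z, `|d2h k i j z| <= M;
  rd_hD1 : forall k j z, is_derive z (ebase R j) (h k) (dh k j z);
  rd_hD2 : forall k i j z, is_derive z (ebase R i) (dh k j) (d2h k i j z);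
  rd_hK : forall k j z, `|dh k j z| <= K;
  rd_ceta : forall j, continuous (fun q : R * 'rV[R]_n => eta j q.1 q.2);
  rd_eta : forall j t x, `|eta j t x| <= M;
  rd_etaD : forall j i t z, is_derive z (ebase R i) (eta j t) (de j i t z);
  rd_de : forall j i t z, `|de j i t z| <= M;
  rd_deK : forall j i t z, `|de j i t z| <= K;
  rd_cF : forall k, continuous (fun q : R * ('rV[R]_n * 'rV[R]_n) => F k q.1 q.2.1 q.2.2);
  rd_F : forall k t x y, `|F k t x y| <= M;
  rd_FX : forall k i t x y, is_derive x (ebase R i) (fun z => F k t z y) (dx k i t x y);
  rd_FY : forall k i t x y, is_derive y (ebase R i) (F k t x) (dy k i t x y);
  rd_dx : forall k i t x y, `|dx k i t x y| <= M;
  rd_dxK : forall k i t x y, `|dx k i t x y| <= K;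
  rd_dy : forall k i t x y, `|dy k i t x y| <= M;
  rd_dyK : forall k i t x y, `|dy k i t x y| <= K }.

(** Covers the realisations outside [Omega0], so that the construction runs for every [omega] and
    measurability can be discussed on the whole space. *)
Lemma regdata0 (R : realType) n (M K : R) : 0 <= M -> 0 <= K ->
  regdata M K (fun (_ : 'I_n) _ => 0) (fun _ _ _ => 0) (fun _ _ _ _ => 0) (fun _ _ _ => 0)
    (fun _ _ _ _ => 0) (fun _ _ _ _ => 0) (fun _ _ _ _ _ => 0) (fun _ _ _ _ _ => 0).
Proof.
by move=> M0 K0; split => *; rewrite ?normr0//; first [exact: cont_cst | exact: isd_cst].
Qed.

(** The truncation levels are the a priori bounds themselves: [Mcut] that of [burgers_u_le], [Lcut]
    that of [burgers_grad_quotient] when the exponent is at most 1. *)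
Definition Mcut (R : realType) (M T1 : R) : R := (M + 1) * expR (2 * T1).
Definition Lcut (R : realType) (K : R) : R := (K + 1) * expR 1.
(** Reciprocal of the growth rate of the difference quotients, with [Lcut K] in the place of [L]. *)
Definition lifespan (R : realType) (n : nat) (K : R) : R :=
  (apriori_rate n (Lcut K) K + apriori_const n (Lcut K) K / (K + 1) + 1)^-1.

(** * The solution for one realisation of the data *)

Section RegularSolution.
Context (R : realType) (n : nat) (G : gaussian_vector R n) (nu : R).
Hypothesis nu0 : 0 < nu.
Variables (M K T1 tau : R).
Hypotheses (M0 : 0 <= M) (K0 : 0 <= K) (T10 : 0 <= T1) (tauT : tau < T1).
Hypothesis tauK : tau <= lifespan n K.
Local Notation LF := (n%:R * M).

Lemma lifespan_inv_gt0 : 0 < apriori_rate n (Lcut K) K + apriori_const n (Lcut K) K / (K + 1) + 1.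
Proof.
have L0 : 0 <= Lcut K by rewrite mulr_ge0 ?expR_ge0// addr_ge0.
rewrite ltr_wpDl// addr_ge0//; first by rewrite addr_ge0// mulr_ge0.
by apply: divr_ge0; [rewrite addr_ge0// mulr_ge0// mulr_ge0|rewrite addr_ge0].
Qed.

Section Data.
Variables (h : 'I_n -> 'rV[R]_n -> R) (dh : 'I_n -> 'I_n -> 'rV[R]_n -> R)
  (d2h : 'I_n -> 'I_n -> 'I_n -> 'rV[R]_n -> R)
  (eta : 'I_n -> R -> 'rV[R]_n -> R) (de : 'I_n -> 'I_n -> R -> 'rV[R]_n -> R)
  (F : 'I_n -> R -> 'rV[R]_n -> 'rV[R]_n -> R)
  (dx dy : 'I_n -> 'I_n -> R -> 'rV[R]_n -> 'rV[R]_n -> R).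
Hypothesis rd : regdata M K h dh d2h eta de F dx dy.

Let L0 : 0 <= Lcut K. Proof. by rewrite mulr_ge0 ?expR_ge0// addr_ge0. Qed.
Let Mc0 : 0 <= Mcut M T1. Proof. by rewrite mulr_ge0 ?expR_ge0// addr_ge0. Qed.
Let LF0 : 0 <= LF. Proof. by rewrite mulr_ge0. Qed.
Let hL k (x v : 'rV[R]_n) : `|h k (x + v) - h k x| <= LF * `|v|.
Proof.
by apply: (partials_lip_norm M0 (rd_hD1 rd k) (rd_dh rd k)) => i; exact: coord_le.
Qed.
Let dhL k j (x v : 'rV[R]_n) : `|dh k j (x + v) - dh k j x| <= LF * `|v|.
Proof.
apply: (partials_lip_norm (D := fun i => d2h k i j) M0) => [i z|i z|i].
- exact: rd_hD2 rd k i j z.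
- exact: rd_d2h rd k i j z.
- exact: coord_le.
Qed.
Let etaL j t (x v : 'rV[R]_n) : `|eta j t (x + v) - eta j t x| <= LF * `|v|.
Proof.
apply: (partials_lip_norm (D := fun i => de j i t) M0) => [i z|i z|i].
- exact: rd_etaD rd j i t z.
- exact: rd_de rd j i t z.
- exact: coord_le.
Qed.
Let FX k t (x v y : 'rV[R]_n) : `|F k t (x + v) y - F k t x y| <= LF * `|v|.
Proof.
apply: (partials_lip_norm (f := fun z => F k t z y) (D := fun i z => dx k i t z y) M0) => [i z|i
  z|i].
- exact: rd_FX rd k i t z y.
- exact: rd_dx rd k i t z y.
- exact: coord_le.
Qed.
Let FY k t (x y v : 'rV[R]_n) : `|F k t x (y + v) - F k t x y| <= LF * `|v|.
Proof.
apply: (partials_lip_norm (D := fun i => dy k i t x) M0) => [i z|i z|i].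
- exact: rd_FY rd k i t x z.
- exact: rd_dy rd k i t x z.
- exact: coord_le.
Qed.

Local Notation UU := (burgers_u G nu T1 (Mcut M T1) (Lcut K) M LF h dh eta F).
Local Notation QQ := (burgers_grad G nu T1 (Mcut M T1) (Lcut K) M LF h dh eta F).
Local Notation gg := (burgers_rhs G nu T1 (Mcut M T1) (Lcut K) M LF h dh eta F).
Local Notation WW := (burgers_hess G nu T1 (Mcut M T1) (Lcut K) M LF h dh d2h eta F).
Local Notation CC := (solution_bound G nu T1 (Mcut M T1) (Lcut K) M LF LF).

Lemma regular_solution : solution nu T1 tau CC h eta F UU QQ gg WW.
Proof.
apply: (@Burgers_solution R n G nu nu0 T1 (Mcut M T1) (Lcut K) M LF LF T10 Mc0 L0 M0 LF0 LF0
  h dh d2h eta F (rd_ch rd) (rd_h rd) (rd_cdh rd) (rd_dh rd) (rd_cd2h rd) (rd_d2h rd) (rd_hD1 rd)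
  (rd_hD2 rd) hL dhL (rd_ceta rd) (rd_eta rd) etaL (rd_cF rd) (rd_F rd) FX FY K tau K0 tauT _ _ _ _
  erefl erefl).
- by move=> k i x e; exact: (line_lip (rd_hD1 rd k i) (fun z => rd_hK rd k i z)).
- move=> j i t x e.
  exact: (line_lip (fun z => rd_etaD rd j i t z) (fun z => rd_deK rd j i t z)).
- move=> k i t x y e.
  exact: (line_lip (fun z => rd_FX rd k i t z y) (fun z => rd_dxK rd k i t z y)).
- move=> k t x y v b vb.
  exact: (partials_lip_norm K0 (fun i z => rd_FY rd k i t x z) (fun i z => rd_dyK rd k i t x z) y
    vb).
- by have p := lifespan_inv_gt0; rewrite mulrC -ler_pdivlMr// mul1r.
Qed.

Lemma regular_source_iter_cont m k : continuous (fun q : R * 'rV[R]_n =>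
  source_at (burgers_source (Mcut M T1) (Lcut K) eta F) (picard_iter T1 (burgers_init G nu T1 h
    dh) (@burgers_duhamel R n G nu) (@state_component n)
    (burgers_source (Mcut M T1) (Lcut K) eta F) m) k q.1 q.2).
Proof.
exact: (@source_iter_cont R n G nu T1 (Mcut M T1) (Lcut K) M Mc0 L0 h dh eta F (rd_ch rd) (rd_h rd)
  (rd_cdh rd) (rd_dh rd) (rd_ceta rd) (rd_eta rd) (rd_cF rd) (rd_F rd) m k).
Qed.

Lemma regular_approx m i t x :
  `|picard_lim T1 (contraction G nu T1 (Mcut M T1) (Lcut K) M LF) (weight G nu T1 (Mcut M T1)
    (Lcut K) M LF)
      (burgers_init G nu T1 h dh) (@burgers_duhamel R n G nu) (@state_component n)
        (burgers_source (Mcut M T1) (Lcut K) eta F)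
      (source_bound n (Mcut M T1) (Lcut K) M) M i t x -
    picard_iter T1 (burgers_init G nu T1 h dh) (@burgers_duhamel R n G nu) (@state_component n)
      (burgers_source (Mcut M T1) (Lcut K) eta F) m i t x| <=
  2 * picard_gap T1 (contraction G nu T1 (Mcut M T1) (Lcut K) M LF) (weight G nu T1 (Mcut M T1)
    (Lcut K) M LF)
    (source_bound n (Mcut M T1) (Lcut K) M) M * 2^-1 ^+ m.
Proof.
exact: (@Zb_approx R n G nu nu0 T1 (Mcut M T1) (Lcut K) M LF T10 Mc0 L0 M0 LF0 h dh eta F
  (rd_ch rd) (rd_h rd) (rd_cdh rd) (rd_dh rd) (rd_ceta rd) (rd_eta rd) (rd_cF rd) (rd_F rd) FY).
Qed.

End Data.
End RegularSolution.

(** * Return to backward time *)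

Section Backward.
Context (R : realType) (n : nat).
Local Notation V := 'rV[R]_n.
Local Notation leb := (@lebesgue_measure R).
Variables (nu T a C : R) (h : 'I_n -> V -> R) (eta : 'I_n -> R -> V -> R) (F : 'I_n -> R -> V ->
  V -> R).
Variables (U : 'I_n -> R -> V -> R) (Q : 'I_n -> 'I_n -> R -> V -> R) (g : 'I_n -> R -> V -> R)
  (W : 'I_n -> 'I_n -> 'I_n -> R -> V -> R).
Variables (hv : V -> V) (ev : R -> V -> V) (Fv : R -> V -> V -> V) (y : R -> V -> V).
Hypotheses (a0 : 0 <= a) (T0 : 0 < T).
Hypothesis S : solution nu (T + 1) (T - a) C h eta F U Q g W.
Hypothesis hE : forall k x, h k x = hv x 0 k.
Hypothesis eE : forall j t x, 0 <= t <= T -> eta j t x = ev t x 0 j.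
Hypothesis FE : forall k t x z, 0 <= t <= T -> F k t x z = Fv t x z 0 k.
Hypothesis yE : forall t x, a <= t <= T -> y t x = \row_k U k (T - t) x.

Let tI t : a <= t <= T -> 0 <= T - t <= T + 1.
Proof. by move: a0 T0 => b0 b1 /andP[h1 h2]; apply/andP; split; lra. Qed.
Let tJ t : a <= t <= T -> 0 <= T - t <= T - a.
Proof. by move: a0 T0 => b0 b1 /andP[h1 h2]; apply/andP; split; lra. Qed.
Let tK t : a <= t <= T -> 0 <= T - t <= T.
Proof. by move: a0 T0 => b0 b1 /andP[h1 h2]; apply/andP; split; lra. Qed.
Let tO t : a < t < T -> 0 < T - t < T + 1.
Proof. by move: a0 T0 => b0 b1 /andP[h1 h2]; apply/andP; split; lra. Qed.
Let oc t : a < t < T -> a <= t <= T.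
Proof. by move=> /andP[h1 h2]; rewrite !ltW. Qed.

Lemma y_derive1 t x j : a <= t <= T -> is_derive x (ebase R j) (y t) (\row_k Q k j (T - t) x).
Proof.
move=> tt; have -> : y t = (fun z => \row_k U k (T - t) z) by apply/funext => z; exact: yE.
by apply: isd_row => k; exact: (sol_d1 S) (tI tt).
Qed.

Lemma y_D1 t x j : a <= t <= T -> derive (y t) x (ebase R j) = \row_k Q k j (T - t) x.
Proof. by move=> tt; have [_ ->] := y_derive1 x j tt. Qed.

Lemma y_derive2 t x i j : a <= t <= T ->
  is_derive x (ebase R i) (fun w => derive (y t) w (ebase R j)) (\row_k W k i j (T - t) x).
Proof.
move=> tt; have -> : (fun w => derive (y t) w (ebase R j)) = (fun z => \row_k Q k j (T - t) z).
  by apply/funext => z; exact: y_D1.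
by apply: isd_row => k; exact: (sol_d2 S) (tI tt).
Qed.

Lemma y_D2 t x i j : a <= t <= T ->
  derive (fun w => derive (y t) w (ebase R j)) x (ebase R i) = \row_k W k i j (T - t) x.
Proof. by move=> tt; have [_ ->] := y_derive2 x i j tt. Qed.

Let cT : continuous (fun q : R * V => T - q.1).
Proof. by apply: contB; [exact: cont_cst|exact: cont_fst]. Qed.

Let cUk k : continuous (fun q : R * V => U k q.1 q.2). Proof. by case: S => H *; exact: H. Qed.
Let cQk k j : continuous (fun q : R * V => Q k j q.1 q.2). Proof. by case: S => _ H *; exact: H.
  Qed.
Let cgk k : continuous (fun q : R * V => g k q.1 q.2). Proof. by case: S => _ _ H *; exact: H. Qed.
Let cWk k i j : continuous (fun q : R * V => W k i j (ctime (T + 1) q.1) q.2).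
Proof. by case: S => _ _ _ H *; exact: H. Qed.

Let cUT k : continuous (fun q : R * V => U k (T - q.1) q.2).
Proof. exact: (cont_uncurry (@cUk k) cT (@cont_snd R V)). Qed.
Let cQT k j : continuous (fun q : R * V => Q k j (T - q.1) q.2).
Proof. exact: (cont_uncurry (@cQk k j) cT (@cont_snd R V)). Qed.
Let cgT k : continuous (fun q : R * V => g k (T - q.1) q.2).
Proof. exact: (cont_uncurry (@cgk k) cT (@cont_snd R V)). Qed.
Let cWT k i j : continuous (fun q : R * V => W k i j (ctime (T + 1) (T - q.1)) q.2).
Proof.
exact: (cont_uncurry (k := fun s z => W k i j (ctime (T + 1) s) z) (@cWk k i j) cT (@cont_snd R V)).
Qed.

Let leC (b : R) : b <= C -> b <= `|C|.
Proof. by move=> h1; rewrite (le_trans h1)// ler_norm. Qed.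

Lemma y_C02b : C02b (ebase R (n:=n)) [set t | a <= t <= T] y.
Proof.
split; first split.
- apply: (@within_eq_continuous _ _ _ _ (fun q : R * V => \row_k U k (T - q.1) q.2)).
    by apply: cont_row => k; exact: cUT.
  by move=> q /= tt; rewrite yE.
- by move=> t z i /= tt; have [] := y_derive1 z i tt.
- by move=> t z i j /= tt; have [] := y_derive2 z i j tt.
- move=> i; apply: (@within_eq_continuous _ _ _ _ (fun q : R * V => \row_k Q k i (T - q.1) q.2)).
    by apply: cont_row => k; exact: cQT.
  by move=> q /= tt; rewrite /pd1 y_D1.
- move=> i j; apply: (@within_eq_continuous _ _ _ _
    (fun q : R * V => \row_k W k i j (ctime (T + 1) (T - q.1)) q.2)).
    by apply: cont_row => k; exact: cWT.
  by move=> q /= tt; rewrite /pd2 y_D2// ctime_id// tI.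
exists `|C| => t z /= tt; split.
- by rewrite yE//; apply: row_norm_le => // k; rewrite mxE; apply: leC; exact: (sol_U S).
- by move=> i; rewrite /pd1 y_D1//; apply: row_norm_le => // k; rewrite mxE; apply: leC; exact:
  (sol_Q S).
- move=> i j; rewrite /pd2 y_D2//; apply: row_norm_le => // k; rewrite mxE; apply: leC.
  by apply: (sol_W S); have /andP[] := tI tt.
Qed.

Lemma y_time_derive t x : a < t < T -> is_derive t (1 : R) (fun s => y s x)
  (\row_k (- (g k (T - t) x + nu * \sum_i W k i i (T - t) x))).
Proof.
move=> tt.
have H : is_derive t (1 : R) (fun s : R => \row_k U k (T - s) x : V)
    (\row_k (- (g k (T - t) x + nu * \sum_i W k i i (T - t) x))).
  apply: isd_row => k.
  have d1 := isd_sub (isd_cst T t (1 : R)) (isd_id t).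
  have d2 := @isd_comp R (fun r => U k r x) (fun s => T - s) t _ _ (sol_t S k x (tO tt)) d1.
  by apply: (isd_eq d2); rewrite sub0r mulrN1.
move: H; apply: near_eq_is_derive.
have e0 : 0 < Num.min (t - a) (T - t) by rewrite lt_min !subr_gt0.
apply/nbhs_ballP; exists (Num.min (t - a) (T - t)) => //= s; rewrite /ball/= lt_min.
move=> /andP[]; rewrite !ltr_norml => /andP[h1 h2] /andP[h3 h4]; rewrite yE//.
by apply/andP; split; lra.
Qed.

Lemma y_Dt t x : a < t < T -> derive (fun s => y s x) t (1 : R) =
  \row_k (- (g k (T - t) x + nu * \sum_i W k i i (T - t) x)).
Proof. by move=> tt; have [_ ->] := y_time_derive x tt. Qed.

Lemma y_Dt_jcont : jcont [set t | a < t < T] (fun t x => derive (fun s => y s x) t (1 : R)).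
Proof.
apply: (@within_eq_continuous _ _ _ _ (fun q : R * V =>
  \row_k (- (g k (T - q.1) q.2 + nu * \sum_i W k i i (ctime (T + 1) (T - q.1)) q.2)))).
  apply: cont_row => k; apply: contN; apply: contD; first exact: cgT.
  by apply: contM; [exact: cont_cst|apply: cont_sum => i; exact: cWT].
move=> q /= tt; rewrite y_Dt//; apply/rowP => k; rewrite !mxE.
by rewrite ctime_id// tI// oc.
Qed.

Lemma y_Dt_bound : exists M : R, forall t x, a < t < T -> `|derive (fun s => y s x) t (1 : R)| <= M.
Proof.
exists (`|C| + `|nu| * (\sum_(i < n) `|C|)) => t x tt; rewrite y_Dt//; apply: row_norm_le.
  by rewrite addr_ge0// mulr_ge0// sumr_ge0.
move=> k; rewrite mxE normrN (le_trans (ler_normD _ _))// lerD//.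
  by apply: leC; exact: (sol_g S).
rewrite normrM ler_wpM2l// (le_trans (ler_norm_sum _ _ _))// ler_sum// => i _.
by apply: leC; apply: (sol_W S); have /andP[] := tI (oc tt).
Qed.

(** Fundamental theorem for [s] mapped to [- U (T - s)], whose value at [s = T] is minus the datum
    [h]. The integral of the statement is finite because on [[t, T]] its integrand agrees with the
    function [f], continuous on the whole line thanks to [ctime]. *)
Lemma y_integral t x (i : 'I_n) : a <= t <= T ->
  (y t x 0 i)%:E = ((hv x 0 i)%:E + (\int[leb]_(s in [set s : R | (t <= s <= T)%R])
     ((nu *: lapl (y s) x - transp (ev (T - s) x + y s x) (y s) x
       + Fv (T - s) x (y s x)) 0 i)%:E))%E.
Proof.
move=> tt; have /andP[at_ tT] := tt.
pose f (s : R) := g i (T - s) x + nu * \sum_j W i j j (ctime (T + 1) (T - s)) x.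
have cx : continuous (fun s : R => (s, x)) by apply: cont_pair; [exact: cont_id|exact: cont_cst].
have cf : continuous f.
  apply: contD; first exact: (cont_comp cx (@cgT i)).
  apply: contM; first exact: cont_cst.
  by apply: cont_sum => j; exact: (cont_comp cx (@cWT i j j)).
have cU : continuous (fun s : R => - U i (T - s) x).
  apply: contN; apply: (cont_uncurry (@cUk i)); last exact: cont_cst.
  by apply: contB; [exact: cont_cst|exact: cont_id].
have setE : [set s : R | (t <= s <= T)%R] = `[t, T]%classic.
  by apply/seteqP; split => s /=; rewrite in_itv.
have I : \int[leb]_(s in `[t, T]) f s = U i (T - t) x - h i x.
  transitivity ((fun s => - U i (T - s) x) T - (fun s => - U i (T - s) x) t); last first.
    by rewrite /= subrr (sol_0 S) opprK addrC.
  apply: (@FTC_Rintegral R (fun s => - U i (T - s) x) f t T tT).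
  - by move=> u _; exact: cU.
  - by move=> u _; exact: cf.
  move=> s /andP[ts sT].
  have ss : a < s < T by rewrite (le_lt_trans at_ ts).
  have d1 := isd_sub (isd_cst T s (1 : R)) (isd_id s).
  have d2 := @isd_comp R (fun r => U i r x) (fun s => T - s) s _ _ (sol_t S i x (tO ss)) d1.
  have d3 := is_derive_mulc (- 1) d2.
  rewrite (_ : (fun s => - U i (T - s) x) = (fun s => U i (T - s) x * - 1)); last first.
    by apply/funext => r; rewrite mulrN1.
  apply: (isd_eq d3); rewrite /f ctime_id; last by rewrite tI// oc.
  by rewrite sub0r !mulrN1 opprK.
have E : (\int[leb]_(s in [set s : R | (t <= s <= T)%R])
     ((nu *: lapl (y s) x - transp (ev (T - s) x + y s x) (y s) x
       + Fv (T - s) x (y s x)) 0 i)%:E)%E = (\int[leb]_(s in `[t, T]) f s)%:E.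
  rewrite setE /Rintegral fineK; last first.
    apply: integrable_fin_num => //.
    by apply: continuous_itv_integrable => u _; exact: cf.
  apply: eq_integral => s; rewrite inE/= in_itv/= => /andP[ts sT]; congr EFin.
  have ss : a <= s <= T by rewrite (le_trans at_ ts).
  rewrite /f (sol_eq S _ _ (tJ ss)) ctime_id ?tI//.
  rewrite !mxE /lapl /transp !summxE yE// FE ?tK//.
  have -> : \sum_j derive (fun w => derive (y s) w (ebase R j)) x (ebase R j) 0 i =
      \sum_j W i j j (T - s) x by apply: eq_bigr => j _; rewrite y_D2// mxE.
  have -> : \sum_j ((ev (T - s) x + \row_k U k (T - s) x) 0 j *: derive (y s) x (ebase R j)) 0 i =
      \sum_j (eta j (T - s) x + U j (T - s) x) * Q i j (T - s) x.
    by apply: eq_bigr => j _; rewrite y_D1// !mxE eE// tK.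
  by move: (\sum_j _) (\sum_j _) (Fv _ _ _ _ _) => s1 s2 s3; ring.
by rewrite E I yE// mxE hE -EFinD [in RHS]addrC subrK.
Qed.

End Backward.

Section KBounds.
Context (R : realType) (n : nat).
Local Notation V := 'rV[R]_n.

Lemma jacn_ge0 (f : V -> V) z : 0 <= jacn f z.
Proof. exact: bigmax_ge_id. Qed.

Lemma le_jacn (f : V -> V) z j : `|derive f z (ebase R j)| <= jacn f z.
Proof. exact: (le_bigmax _ (fun j => `|derive f z (ebase R j)|) j). Qed.

Lemma jacn_le (f : V -> V) z (B : R) : 0 <= B -> (forall j, `|derive f z (ebase R j)| <= B) ->
  jacn f z <= B.
Proof. by move=> picard_step H; apply/bigmax_leP; split. Qed.

Lemma ebase2_l i : ebase2 R (lshift n i) = (ebase R i, 0) :> V * V.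
Proof. by rewrite /ebase2 -[lshift n i]/(unsplit (inl i)) unsplitK. Qed.

Lemma ebase2_r i : ebase2 R (rshift n i) = (0, ebase R i) :> V * V.
Proof. by rewrite /ebase2 -[rshift n i]/(unsplit (inr i)) unsplitK. Qed.

(** In the direction [ebase2 (lshift n i)] the second variable stays fixed, so regularity of [F] in
    the pair contains that in [x] alone; [isd_right] is the same for [y]. *)
Lemma isd_left (f : V * V -> V) x z i : derivable f (x, z) (ebase2 R (lshift n i)) ->
  is_derive x (ebase R i) (fun u => f (u, z)) (derive f (x, z) (ebase2 R (lshift n i))).
Proof.
move=> /derivableP/is_derive_line H; apply/is_derive_line.
rewrite (_ : (fun a => _) = (fun b : R => f (b *: ebase2 R (lshift n i) + (x, z))))//.
by apply/funext => b; rewrite ebase2_l; congr f; congr pair; rewrite /= scaler0 add0r.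
Qed.

Lemma isd_right (f : V * V -> V) x z i : derivable f (x, z) (ebase2 R (rshift n i)) ->
  is_derive z (ebase R i) (fun u => f (x, u)) (derive f (x, z) (ebase2 R (rshift n i))).
Proof.
move=> /derivableP/is_derive_line H; apply/is_derive_line.
rewrite (_ : (fun a => _) = (fun b : R => f (b *: ebase2 R (rshift n i) + (x, z))))//.
by apply/funext => b; rewrite ebase2_r; congr f; congr pair; rewrite /= scaler0 add0r.
Qed.

(** The upper bound [B] is what makes [sup A] an actual supremum. *)
Lemma sup_ge0_ub (A : set R) (r B : R) : (forall s, A s -> 0 <= s <= B) -> A r ->
  0 <= r <= sup A.
Proof.
move=> H Ar; have /andP[-> _] := H _ Ar; apply: ub_le_sup => //.
by exists B => s /H/andP[].
Qed.

End KBounds.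

Lemma isd_coordv (R : realType) (V : normedModType R) n (f : V -> 'rV[R]_n) (z v : V) l j :
  is_derive z v f l -> is_derive z v (fun x => f x 0 j) (l 0 j).
Proof. by move=> [df <-]; exact: isd_component. Qed.

Lemma jcont_ctime (R : realType) (V W : normedModType R) (T : R) (g : R -> V -> W) : 0 <= T ->
  jcont [set t | 0 <= t <= T] g -> continuous (fun q : R * V => g (ctime T q.1) q.2).
Proof.
move=> T0 jg; have cp : continuous (fun q : R * V => (ctime T q.1, q.2)).
  by apply: cont_pair; [apply: cont_ctime; exact: cont_fst|exact: cont_snd].
by apply: (cont_within_comp jg cp) => q /=; exact: ctime_itv.
Qed.

Lemma jcont_cst (R : realType) (V W : normedModType R) (f : V -> W) :
  jcont [set 0] (fun=> f) -> continuous f.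
Proof.
move=> jg; have cp : continuous (fun x : V => ((0 : R), x)).
  by apply: cont_pair; [exact: cont_cst|exact: cont_id].
by apply: (cont_within_comp jg cp).
Qed.

(** * Random data, set to zero outside the good realisations *)

Section RandomData.
Context (R : realType) (n : nat) (d : measure_display) (Omega : measurableType d).
Local Notation V := 'rV[R]_n.
Variables (T M : R) (Omega0 : set Omega) (eta : R -> V -> Omega -> V)
  (F : R -> V -> V -> Omega -> V) (h : V -> Omega -> V).
Hypothesis T0 : 0 < T.
Hypothesis reg : forall w, Omega0 w ->
  [/\ C02 (ebase R (n:=n)) [set t | 0 <= t <= T] (fun t x => eta t x w)
        /\ bnd02 (ebase R (n:=n)) [set t | 0 <= t <= T] (fun t x => eta t x w) M,
      C02 (ebase2 R (n:=n)) [set t | 0 <= t <= T] (fun t p => F t p.1 p.2 w)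
        /\ bnd02 (ebase2 R (n:=n)) [set t | 0 <= t <= T] (fun t p => F t p.1 p.2 w) M
    & C02 (ebase R (n:=n)) [set 0] (fun _ x => h x w)
        /\ bnd02 (ebase R (n:=n)) [set 0] (fun _ x => h x w) M].
Local Notation K := (`|Kconst T Omega0 eta F h|).
Local Notation M' := (`|M|).

Let T0' : 0 <= T. Proof. exact: ltW. Qed.
Let zT : 0 <= (0 : R) <= T. Proof. by rewrite lexx. Qed.
Let leM (b : R) : b <= M -> b <= M'. Proof. by move=> h1; rewrite (le_trans h1)// ler_norm. Qed.

Let F_left w t x z i : Omega0 w -> 0 <= t <= T -> is_derive x (ebase R i) (fun u => F t u z w)
  (derive (fun p => F t p.1 p.2 w) (x, z) (ebase2 R (lshift n i))).
Proof.
move=> w0 tT; have [_ [[_ dF _ _ _] _] _] := reg w0.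
exact: (isd_left (f := fun p => F t p.1 p.2 w)) (dF t (x, z) (lshift n i) tT).
Qed.

Let F_right w t x z i : Omega0 w -> 0 <= t <= T -> is_derive z (ebase R i) (fun u => F t x u w)
  (derive (fun p => F t p.1 p.2 w) (x, z) (ebase2 R (rshift n i))).
Proof.
move=> w0 tT; have [_ [[_ dF _ _ _] _] _] := reg w0.
exact: (isd_right (f := fun p => F t p.1 p.2 w)) (dF t (x, z) (rshift n i) tT).
Qed.

Let F_pd w t p k : Omega0 w -> 0 <= t <= T ->
  `|derive (fun p => F t p.1 p.2 w) p (ebase2 R k)| <= M'.
Proof.
by move=> w0 tT; have [_ [_ bF] _] := reg w0; have [_ H _] := bF t p tT; apply: leM; exact: H.
Qed.

(** The deterministic bound [M] makes the three sets of [Kconst] bounded, so each supremum dominates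
    its elements; each is also nonnegative, hence at most the sum, and the absolute value in [K] is
    harmless. *)
Lemma Kconst_bounds w : Omega0 w -> [/\ (forall x, jacn (fun z => h z w) x <= K),
  (forall t x, 0 <= t <= T -> jacn (fun z => eta t z w) x <= K) &
  (forall t x z, 0 <= t <= T -> jacn (fun u => F t u z w) x + jacn (fun u => F t x u w) z <= K)].
Proof.
move=> w0; rewrite /Kconst.
set S1 := [set r | exists w x, _]; set S2 := [set r | exists w t x, _].
set S3 := [set r | exists w t x y, _].
have b1 s : S1 s -> 0 <= s <= M'.
  move=> [w' [x [w0' ->]]]; rewrite jacn_ge0; apply: jacn_le => // j.
  by have [_ _ [_ bh]] := reg w0'; have [_ H _] := bh 0 x erefl; apply: leM; exact: H.
have b2 s : S2 s -> 0 <= s <= M'.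
  move=> [w' [t [x [w0' tT ->]]]]; rewrite jacn_ge0; apply: jacn_le => // j.
  by have [[_ be] _ _] := reg w0'; have [_ H _] := be t x tT; apply: leM; exact: H.
have b3 s : S3 s -> 0 <= s <= M' + M'.
  move=> [w' [t [x [z [w0' tT ->]]]]]; rewrite addr_ge0 ?jacn_ge0//= lerD//; apply: jacn_le => // j.
    by have [_ ->] := F_left x z j w0' tT; exact: F_pd.
  by have [_ ->] := F_right x z j w0' tT; exact: F_pd.
have e1 x : S1 (jacn (fun z => h z w) x) by exists w, x.
have e2 t x : 0 <= t <= T -> S2 (jacn (fun z => eta t z w) x) by exists w, t, x.
have e3 t x z : 0 <= t <= T -> S3 (jacn (fun u => F t u z w) x + jacn (fun u => F t x u w) z).
  by exists w, t, x, z.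
have p1 : 0 <= sup S1 by have /andP[a b] := sup_ge0_ub b1 (e1 0); exact: le_trans b.
have p2 : 0 <= sup S2 by have /andP[a b] := sup_ge0_ub b2 (e2 0 0 zT); exact: le_trans b.
have p3 : 0 <= sup S3 by have /andP[a b] := sup_ge0_ub b3 (e3 0 0 0 zT); exact: le_trans b.
rewrite ger0_norm ?addr_ge0//; split.
- move=> x; have /andP[_ b] := sup_ge0_ub b1 (e1 x).
  by rewrite (le_trans b)// -addrA lerDl addr_ge0.
- move=> t x tT; have /andP[_ b] := sup_ge0_ub b2 (e2 t x tT).
  by rewrite (le_trans b)// addrAC lerDr addr_ge0.
- move=> t x z tT; have /andP[_ b] := sup_ge0_ub b3 (e3 t x z tT).
  by rewrite (le_trans b)// lerDr addr_ge0.
Qed.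

Definition hW k x w : R := if w \in Omega0 then h x w 0 k else 0.
Definition dhW k j x w : R := if w \in Omega0 then derive (fun z => h z w) x (ebase R j) 0 k else 0.
Definition etaW j t x w : R := if w \in Omega0 then eta (ctime T t) x w 0 j else 0.
Definition FW k t x y w : R := if w \in Omega0 then F (ctime T t) x y w 0 k else 0.

(** Only [h], its gradient, [eta] and [F] enter the Picard iterates and need explicit formulas
    measurable in [w]; the other derivatives may stay existential. *)
Lemma regdataW w : exists d2h de dx dy, regdata M' K (fun k x => hW k x w) (fun k j x => dhW k j
  x w)
  d2h (fun j t x => etaW j t x w) de (fun k t x y => FW k t x y w) dx dy.
Proof.
rewrite /hW /dhW /etaW /FW; case: (boolP (w \in Omega0)) => [/set_mem w0|_]; last first.
  do 4 eexists; exact: regdata0.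
have [[[je de1 de2 cje _] be] [[jF dF1 _ _ _] bF] [[jh dh1 dh2 cjh cjh2] bh]] := reg w0.
have [Kh Ke KF] := Kconst_bounds w0.
have cT t : 0 <= ctime T t <= T by exact: ctime_itv.
exists (fun k i j x => derive (fun z => derive (fun z => h z w) z (ebase R j)) x (ebase R i) 0 k).
exists (fun j i t x => derive (fun z => eta (ctime T t) z w) x (ebase R i) 0 j).
exists (fun k i t x z => derive (fun p => F (ctime T t) p.1 p.2 w) (x, z) (ebase2 R (lshift n i))
  0 k).
exists (fun k i t x z => derive (fun p => F (ctime T t) p.1 p.2 w) (x, z) (ebase2 R (rshift n i))
  0 k).
split.
- by move=> k; apply: cont_coord; exact: jcont_cst jh.
- by move=> k z; have [H _ _] := bh 0 z erefl; rewrite (le_trans (coord_le _ _))//; exact: leM.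
- by move=> k j; apply: cont_coord; exact: jcont_cst (cjh j).
- by move=> k j z; have [_ H _] := bh 0 z erefl; rewrite (le_trans (coord_le _ _))//; apply: leM;
  exact: H.
- by move=> k i j; apply: cont_coord; exact: jcont_cst (cjh2 i j).
- by move=> k i j z; have [_ _ H] := bh 0 z erefl; rewrite (le_trans (coord_le _ _))//; apply:
  leM; exact: H.
- by move=> k j z; apply: isd_component; exact: dh1 0 z j erefl.
- by move=> k i j z; apply: isd_component; exact: dh2 0 z i j erefl.
- by move=> k j z; rewrite (le_trans (coord_le _ _))// (le_trans (le_jacn _ _ _))//.
- by move=> j; apply: cont_coord; exact: (jcont_ctime T0' je).
- by move=> j t x; have [H _ _] := be _ x (cT t); rewrite (le_trans (coord_le _ _))//; exact: leM.
- by move=> j i t z; apply: isd_component; exact: de1 (cT t).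
- by move=> j i t z; have [_ H _] := be _ z (cT t); rewrite (le_trans (coord_le _ _))//; apply:
  leM; exact: H.
- by move=> j i t z; rewrite (le_trans (coord_le _ _))// (le_trans (le_jacn _ _ _))// Ke.
- by move=> k; apply: cont_coord; exact: (jcont_ctime T0' jF).
- by move=> k t x z; have [H _ _] := bF _ (x, z) (cT t); rewrite (le_trans (coord_le _ _))//;
  exact: leM.
- by move=> k i t x z; apply: isd_coordv; exact: F_left.
- by move=> k i t x z; apply: (isd_coordv (f := fun u => F (ctime T t) x u w)); exact: F_right.
- by move=> k i t x z; rewrite (le_trans (coord_le _ _))//; exact: F_pd.
- move=> k i t x z; rewrite (le_trans (coord_le _ _))// (le_trans _ (KF _ x z (cT t)))//.
  have [_ <-] := F_left x z i w0 (cT t).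
  by rewrite (le_trans (le_jacn _ _ i))// lerDl jacn_ge0.
- by move=> k i t x z; rewrite (le_trans (coord_le _ _))//; exact: F_pd.
- move=> k i t x z; rewrite (le_trans (coord_le _ _))// (le_trans _ (KF _ x z (cT t)))//.
  have [_ <-] := F_right x z i w0 (cT t).
  by rewrite (le_trans (le_jacn _ _ i))// lerDr jacn_ge0.
Qed.

Variable Ft : R -> set (set Omega).
Hypothesis filt : filtration T Ft.
Hypothesis meta : forall t x, 0 <= t <= T -> meas_wrt_vec (Ft t) (eta t x).
Hypothesis mF : forall t x y, 0 <= t <= T -> meas_wrt_vec (Ft t) (F t x y).
Hypothesis mh : forall x, meas_wrt_vec (Ft 0) (h x).
Local Notation Gt := (fun t => trace_alg (Ft t) Omega0).

Lemma Gt_sigma t : 0 <= t <= T -> sigma_algebra setT (Gt t).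
Proof. by move=> tT; apply: trace_sigma; exact: filt.1. Qed.

Lemma hW_meas k x : meas_wrt (Gt 0) (hW k x).
Proof. exact: (meas_wrt_restrict Omega0 (filt.1 _ zT) (mh x k)). Qed.

(** Measurability is assumed of [h] alone; its derivative is a limit of difference quotients along
    the sequence [mesh]. *)
Lemma dhW_meas k j x : meas_wrt (Gt 0) (dhW k j x).
Proof.
apply/(meas_wrtE _ (Gt_sigma zT)).
apply: (@measurable_fun_cvg _ (g_sigma_algebraType (Gt 0)) R setT
  (fun m w => (hW k (x + mesh R m *: ebase R j) w - hW k x w) * (mesh R m)^-1)).
  move=> m; apply: measurable_funM; last exact: measurable_cst.
  by apply: measurable_funB; apply/(meas_wrtE _ (Gt_sigma zT)); exact: hW_meas.
move=> w _; rewrite /hW /dhW; case: (boolP (w \in Omega0)) => [/set_mem w0|_]; last first.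
  by under eq_fun do rewrite subrr mul0r; exact: cvg_cst.
have [_ _ [[_ dh1 _ _ _] _]] := reg w0.
exact: (derive_seq_cvg (isd_component k (dh1 0 x j erefl))).
Qed.

Lemma etaW_meas j t x : 0 <= t <= T -> meas_wrt (Gt t) (etaW j t x).
Proof.
move=> tT; rewrite /etaW ctime_id//.
exact: (meas_wrt_restrict Omega0 (filt.1 _ tT) (meta x tT j)).
Qed.

Lemma FW_meas k t x z : 0 <= t <= T -> meas_wrt (Gt t) (FW k t x z).
Proof.
move=> tT; rewrite /FW ctime_id//.
exact: (meas_wrt_restrict Omega0 (filt.1 _ tT) (mF x z tT k)).
Qed.

Variables (G : gaussian_vector R n) (nu : R).
Hypothesis nu0 : 0 < nu.
Local Notation T1 := (T + 1).
Local Notation LF := (n%:R * M').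
Local Notation UW w := (burgers_u G nu T1 (Mcut M' T1) (Lcut K) M' LF (fun k x => hW k x w)
  (fun k j x => dhW k j x w) (fun j t x => etaW j t x w) (fun k t x y => FW k t x y w)).

Let T10 : 0 <= T1. Proof. by rewrite addr_ge0. Qed.

Lemma UW_meas k t x : 0 <= t <= T -> meas_wrt (Gt t) (fun w => UW w k t x).
Proof.
move=> tT.
apply: (@ZW_limit_meas R n G nu d Omega T T1 (Mcut M' T1) (Lcut K) Gt _ _ _ hW dhW etaW FW
  _ _ _ _ _ _ _ _ (fun i t x w => picard_lim T1 (contraction G nu T1 (Mcut M' T1) (Lcut K) M' LF)
    (weight G nu T1 (Mcut M' T1) (Lcut K) M' LF)
    (burgers_init G nu T1 (fun k x => hW k x w) (fun k j x => dhW k j x w)) (@burgers_duhamel R n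
      G nu) (@state_component n)
    (burgers_source (Mcut M' T1) (Lcut K) (fun j t x => etaW j t x w) (fun k t x y => FW k t x y w))
    (source_bound n (Mcut M' T1) (Lcut K) M') M' i t x)
  (2 * picard_gap T1 (contraction G nu T1 (Mcut M' T1) (Lcut K) M' LF) (weight G nu T1 (Mcut M'
    T1) (Lcut K) M' LF)
    (source_bound n (Mcut M' T1) (Lcut K) M') M') (inl k) t x) => //.
- by rewrite lerDl.
- by move=> s; exact: Gt_sigma.
- by move=> s r s0 sr rT; apply: traceS; exact: filt.2.2.
- exact: hW_meas.
- exact: dhW_meas.
- by move=> *; exact: etaW_meas.
- by move=> *; exact: FW_meas.
- by move=> k' w; have [d2h [de [dx [dy rd]]]] := regdataW w; case: rd => H *; exact: H.
- by move=> k' j w; have [d2h [de [dx [dy rd]]]] := regdataW w; case: rd => _ _ H *; exact: H.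
- by move=> k' w; have [d2h [de [dx [dy rd]]]] := regdataW w; case: rd => _ _ _ _ _ _ _ _ _ _ _ _
  _ _ H *; exact: H.
- move=> m k' w; have [d2h [de [dx [dy rd]]]] := regdataW w.
  exact: (regular_source_iter_cont (normr_ge0 _) (normr_ge0 _) rd).
- move=> m w; have [d2h [de [dx [dy rd]]]] := regdataW w.
  exact: (regular_approx G nu0 (normr_ge0 _) (normr_ge0 _) T10 rd).
Qed.

End RandomData.

Theorem mainTheorem6 (R : realType) (n : nat) :
  exists gamma : R -> R -> R, (forall K C : R, 0 < gamma K C) /\
  forall (d : measure_display) (Omega : measurableType d) (P : probability Omega R)
    (T nu : R) (Ft : R -> set (set Omega))
    (eta : R -> 'rV[R]_n -> Omega -> 'rV[R]_n)
    (F : R -> 'rV[R]_n -> 'rV[R]_n -> Omega -> 'rV[R]_n)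
    (h : 'rV[R]_n -> Omega -> 'rV[R]_n)
    (Omega0 : set Omega),
    0 < T -> 0 < nu -> filtration T Ft ->
    (forall t x, 0 <= t <= T -> meas_wrt_vec (Ft t) (eta t x)) ->
    (forall t x y, 0 <= t <= T -> meas_wrt_vec (Ft t) (F t x y)) ->
    (forall x, meas_wrt_vec (Ft 0) (h x)) ->
    measurable Omega0 -> P Omega0 = 1%E ->
    (exists M : R, forall w, Omega0 w ->
       [/\ C02 (ebase R (n:=n)) [set t | 0 <= t <= T] (fun t x => eta t x w)
             /\ bnd02 (ebase R (n:=n)) [set t | 0 <= t <= T] (fun t x => eta t x w) M,
           C02 (ebase2 R (n:=n)) [set t | 0 <= t <= T] (fun t p => F t p.1 p.2 w)
             /\ bnd02 (ebase2 R (n:=n)) [set t | 0 <= t <= T] (fun t p => F t p.1 p.2 w) M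
         & C02 (ebase R (n:=n)) [set 0] (fun _ x => h x w)
             /\ bnd02 (ebase R (n:=n)) [set 0] (fun _ x => h x w) M]) ->
    let a := Num.max 0 (T - gamma (Kconst T Omega0 eta F h) (Cconst T Omega0 eta F h)) in
    exists ybar : R -> 'rV[R]_n -> Omega -> 'rV[R]_n,
      (forall t x, a <= t <= T -> meas_wrt_vec (Ft (T - t)) (ybar t x)) /\
      exists Omega1 : set Omega,
        [/\ measurable Omega1, P Omega1 = 1%E &
        forall w, Omega1 w ->
        [/\ C02b (ebase R (n:=n)) [set t | a <= t <= T] (fun t x => ybar t x w),
            (forall t x, a < t < T -> derivable (fun s => ybar s x w) t 1),
            jcont [set t | a < t < T] (fun t x => derive (fun s => ybar s x w) t 1),
            (exists M : R, forall t x, a < t < T ->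
                `|derive (fun s => ybar s x w) t 1| <= M)
          & forall t x (i : 'I_n), a <= t <= T ->
              (ybar t x w 0 i)%:E =
              (h x w 0 i)%:E +
              (\int[@lebesgue_measure R]_(s in [set s : R | (t <= s <= T)%R])
                 ((nu *: lapl (fun z => ybar s z w) x
                   - transp (eta (T - s) x w + ybar s x w) (fun z => ybar s z w) x
                   + F (T - s) x (ybar s x w) w) 0 i)%:E)%E]].
Proof.
(* The absolute value makes the lifespan positive for every real argument, including those that are
   not suprema of norms. *)
exists (fun K _ => lifespan n `|K|); split.
  by move=> K C; rewrite invr_gt0; exact: (lifespan_inv_gt0 n (normr_ge0 K)).
move=> d Omega P T nu Ft eta F h Omega0 T0 nu0 filt meta mF mh mO PO [M reg] a.
have [G] := gaussian_vector_exists R n.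
set K := Kconst T Omega0 eta F h in a *.
have ls : 0 < lifespan n `|K| by rewrite invr_gt0; exact: (lifespan_inv_gt0 n (normr_ge0 K)).
have a0 : 0 <= a by rewrite le_max lexx.
have T1 : 0 <= T + 1 by rewrite addr_ge0// ltW.
have tauT : T - a < T + 1 by move: a0; lra.
have tauK : T - a <= lifespan n `|K| by rewrite lerBlDr -lerBlDl le_max lexx orbT.
(* The forward problem is solved on [[0, T + 1]], so that [T - a] is strictly inside even if
   [a = 0]: the maximum principle asks for a two-sided time derivative up to and including the final
   time. *)
pose U w := burgers_u G nu (T + 1) (Mcut `|M| (T + 1)) (Lcut `|K|) `|M| (n%:R * `|M|)
  (fun k x => hW Omega0 h k x w) (fun k j x => dhW Omega0 h k j x w)
  (fun j t x => etaW T Omega0 eta j t x w) (fun k t x y => FW T Omega0 F k t x y w).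
pose C0 := solution_bound G nu (T + 1) (Mcut `|M| (T + 1)) (Lcut `|K|) `|M| (n%:R * `|M|) (n%:R * `|M|).
have sol w : exists Q g W, solution nu (T + 1) (T - a) C0 (fun k x => hW Omega0 h k x w)
    (fun j t x => etaW T Omega0 eta j t x w) (fun k t x y => FW T Omega0 F k t x y w) (U w) Q g W.
  have [d2h [de [dx [dy rd]]]] := regdataW T0 reg w.
  do 3 eexists.
  exact: (regular_solution G nu0 (normr_ge0 M) (normr_ge0 K) T1 tauT tauK rd).
(* A version is chosen for each component, time and point. All agree with [U] on the whole of
   [Omega0], not merely almost surely, so uncountably many choices create no exceptional set, and
   regularity in time and space is inherited. *)
have ver (p : 'I_n * R * 'rV[R]_n) : exists f : Omega -> R, 0 <= p.1.2 <= T ->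
    meas_wrt (Ft p.1.2) f /\ forall w, Omega0 w -> f w = U w p.1.1 p.1.2 p.2.
  move: p => [[k s] x] /=; case: (pselect (0 <= s <= T)) => [sT|ns]; last by exists (fun=> 0).
  have mU := UW_meas T0 reg filt meta mF mh G nu0 k x sT.
  have bU w : `|U w k s x| <= C0 by have [Q [g [W S]]] := sol w; exact: (sol_U S).
  have [f mf fE] := meas_wrt_version (filt.1 _ sT) mU bU.
  by exists f.
have [v vP] := choice ver.
have tT t : a <= t <= T -> 0 <= T - t <= T.
  by move: a0 => b0 /andP[h1 h2]; apply/andP; split; lra.
exists (fun t x w => \row_k v (k, T - t, x) w); split.
  move=> t x tt i.
  rewrite (_ : (fun w => _) = v (i, T - t, x)); last by apply/funext => w; rewrite mxE.
  exact: (vP (i, T - t, x) (tT t tt)).1.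
exists Omega0; split => // w w0.
have yE t x : a <= t <= T -> \row_k v (k, T - t, x) w = \row_k U w k (T - t) x :> 'rV[R]_n.
  by move=> tt; apply/rowP => k; rewrite !mxE; exact: ((vP (k, T - t, x) (tT t tt)).2 w w0).
have hE k x : hW Omega0 h k x w = h x w 0 k by rewrite /hW mem_set.
have eE j t x : 0 <= t <= T -> etaW T Omega0 eta j t x w = eta t x w 0 j.
  by move=> tt; rewrite /etaW mem_set// ctime_id.
have FE k t x z : 0 <= t <= T -> FW T Omega0 F k t x z w = F t x z w 0 k.
  by move=> tt; rewrite /FW mem_set// ctime_id.
have [Q [g [W S]]] := sol w.
split.
- exact: (y_C02b a0 T0 S yE).
- by move=> t x tt; have [] := y_time_derive a0 T0 S yE x tt.
- exact: (y_Dt_jcont a0 T0 S yE).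
- exact: (y_Dt_bound a0 T0 S yE).
- move=> t x i tt.
  exact: (y_integral (hv := fun x => h x w) (ev := fun t x => eta t x w)
    (Fv := fun t x z => F t x z w) a0 T0 S hE eE FE yE x i tt).
Qed.
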